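(* Let $\mathcal{H}$ be a separable complex Hilbert space, let $1\leq p\leq\infty$, and let $T,S\in\mathfrak{C}_p(\mathcal{H})$. Let $f,g$ be non-negative continuous functions on $[0,\infty)$ such that $f(x)g(x)=x$ for all $x\geq 0$. Then $$w_p\left(\begin{bmatrix}0&T\\ S&0\end{bmatrix}\right)\leq 2^{\frac2p-2}\Big(\big\|f(|S|)g(|T^*|)\big\|_p+\big\|f(|T|)g(|S^*|)\big\|_p\Big)+2^{\frac1p-2}\Big(\big\|f^2(|S|)+g^2(|S|)\big\|_p^p+\big\|f^2(|T|)+g^2(|T|)\big\|_p^p\Big)^{\frac1p},$$ where for $p=\infty$ the last factor $(a^p+b^p)^{1/p}$ is interpreted as $\max\{a,b\}$ and $1/p$ as $0$.
   Context: $\mathfrak{L}(\mathcal{H})$ is the space of bounded linear operators on $\mathcal{H}$, and $|X|=(X^*X)^{1/2}$. The operator matrix acts on $\mathcal{H}\oplus\mathcal{H}$. For $1\leq p<\infty$, the Schatten class $\mathfrak{C}_p(\mathcal{H})$ is the set of compact operators $X$ on $\mathcal{H}$ with $\operatorname{tr}(|X|^p)=\sum_j s_j(X)^p<\infty$ ($s_j$ the singular values), and $\|X\|_p=(\operatorname{tr}|X|^p)^{1/p}$. For $p=\infty$, $\|\cdot\|_\infty$ is the usual operator norm and $\mathfrak{C}_\infty(\mathcal{H})$ is read as $\mathfrak{L}(\mathcal{H})$. The norm $\|X\|_p$ of a bounded operator $X$ not in the Schatten $p$-class is $+\infty$ (so the inequality is trivial if its right-hand side is infinite). The $p$-numerical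 radius of an operator $X$ is $w_p(X)=\sup_{\theta\in\mathbb{R}}\|\Re(e^{i\theta}X)\|_p$, where $\Re(X)=\frac{X+X^*}{2}$. Functions of positive operators are defined by continuous functional calculus, and $f^2(|T|)=(f(|T|))^2$, and similarly for $g$ and for $S$. *)

(* Defs.v *)
From HB Require Import structures.
From mathcomp Require Import all_boot all_order all_algebra sesquilinear.
From mathcomp Require Import complex ring.
From mathcomp Require Import all_classical all_reals all_analysis.

Set Implicit Arguments.
Unset Strict Implicit.
Unset Printing Implicit Defensive.

Import Order.TTheory GRing.Theory Num.Theory.
Import numFieldNormedType.Exports.

Local Open Scope classical_set_scope.
Local Open Scope complex_scope.
Local Open Scope ring_scope.

HB.mixin Record isHilbert (R : realType) H & CompleteNormedModule R[i] H := {
  inner : {dot H for (@Num.conj R[i])} ;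
  normr_inner : forall x : H, `|x| ^+ 2 = inner x x }.

#[short(type="hilbertType")]
HB.structure Definition Hilbert (R : realType) :=
  { H of CompleteNormedModule R[i] H & isHilbert R H }.


(* The sup norm that the library puts on [H * K] is not a Hilbert norm, hence
   the type alias. *)
Definition dsum (H K : Type) : Type := (H * K)%type.

Section DirectSum.
Context {R : realType} {H K : hilbertType R}.
Local Notation C := R[i].
Local Notation HK := (dsum H K).
Implicit Types x y : HK.

HB.instance Definition _ := GRing.Lmodule.on HK.

Definition dsum_norm x : C := sqrtC (`|x.1| ^+ 2 + `|x.2| ^+ 2).

Let sqr_ge0 x : 0 <= `|x.1| ^+ 2 + `|x.2| ^+ 2.
Proof. by rewrite addr_ge0 ?exprn_ge0. Qed.

Lemma dsum_norm_ge0 x : 0 <= dsum_norm x.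
Proof. by rewrite sqrtC_ge0. Qed.

Lemma dsum_norm_sqr x : dsum_norm x ^+ 2 = `|x.1| ^+ 2 + `|x.2| ^+ 2.
Proof. exact: sqrtCK. Qed.

Lemma dsum_norm_fst x : `|x.1| <= dsum_norm x.
Proof.
rewrite -(@ler_pXn2r _ 2) ?nnegrE ?dsum_norm_ge0//.
by rewrite dsum_norm_sqr lerDl exprn_ge0.
Qed.

Lemma dsum_norm_snd x : `|x.2| <= dsum_norm x.
Proof.
rewrite -(@ler_pXn2r _ 2) ?nnegrE ?dsum_norm_ge0//.
by rewrite dsum_norm_sqr lerDr exprn_ge0.
Qed.

Lemma dsum_norm_le x : dsum_norm x <= `|x.1| + `|x.2|.
Proof.
rewrite -(@ler_pXn2r _ 2) ?nnegrE ?dsum_norm_ge0 ?addr_ge0//.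
by rewrite dsum_norm_sqr sqrrD -addrA lerD2l lerDr mulrn_wge0 ?mulr_ge0.
Qed.

Lemma ler_dsum_normD x y : dsum_norm (x + y) <= dsum_norm x + dsum_norm y.
Proof.
rewrite -(@ler_pXn2r _ 2) ?nnegrE ?addr_ge0 ?dsum_norm_ge0//.
have le_dot : `|x.1| * `|y.1| + `|x.2| * `|y.2| <= dsum_norm x * dsum_norm y.
  rewrite -(@ler_pXn2r _ 2) ?nnegrE ?addr_ge0 ?mulr_ge0 ?dsum_norm_ge0//.
  rewrite exprMn !dsum_norm_sqr -subr_ge0.
  rewrite (_ : _ - _ = (`|x.1| * `|y.2| - `|x.2| * `|y.1|) ^+ 2); last by ring.
  by rewrite real_exprn_even_ge0// rpredB// ger0_real// mulr_ge0.
rewrite sqrrD !dsum_norm_sqr.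
apply: (@le_trans _ _ ((`|x.1| + `|y.1|) ^+ 2 + (`|x.2| + `|y.2|) ^+ 2)).
  by rewrite lerD// ler_pXn2r ?nnegrE ?addr_ge0// ler_normD.
have := ler_wMn2r 2 le_dot.
rewrite -subr_ge0 => le_dot2; rewrite -subr_ge0.
by apply: le_trans le_dot2 _; rewrite le_eqVlt; apply/orP; left; apply/eqP; ring.
Qed.

Lemma dsum_normZ (a : C) x : dsum_norm (a *: x) = `|a| * dsum_norm x.
Proof.
apply/eqP; rewrite -(@eqrXn2 _ 2) ?mulr_ge0 ?dsum_norm_ge0//.
by rewrite exprMn !dsum_norm_sqr !normrZ !exprMn mulrDr.
Qed.

Lemma dsum_norm_eq0 x : dsum_norm x = 0 -> x = 0.
Proof.
move=> x0; have := dsum_norm_snd x; have := dsum_norm_fst x.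
by rewrite x0 !normr_le0; case: x {x0} => a b /= /eqP -> /eqP ->.
Qed.

HB.instance Definition _ := Lmodule_isNormed.Build C HK
  ler_dsum_normD dsum_normZ dsum_norm_eq0.

Lemma dsum_complete (F : set_system HK) : ProperFilter F -> cauchy F -> cvg F.
Proof.
move=> FF /cauchyP Fc.
have c1 : cvg ((fst : HK -> H) @ F).
  apply/cauchy_cvgP/cauchyP => e e0; have [x Fx] := Fc e e0.
  exists x.1; rewrite /nbhs/=; apply: filterS Fx => y.
  rewrite -!ball_normE /ball_/=; apply: le_lt_trans.
  exact: dsum_norm_fst (x - y).
have c2 : cvg ((snd : HK -> K) @ F).
  apply/cauchy_cvgP/cauchyP => e e0; have [x Fx] := Fc e e0.
  exists x.2; rewrite /nbhs/=; apply: filterS Fx => y.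
  rewrite -!ball_normE /ball_/=; apply: le_lt_trans.
  exact: dsum_norm_snd (x - y).
move: c1 => /cvg_ex[l1 cl1].
move: c2 => /cvg_ex[l2 cl2].
apply/cvg_ex; exists ((l1, l2) : HK).
apply/cvgrPdist_lt => e e0.
have e20 : 0 < e / 2 by rewrite divr_gt0.
have /cvgrPdist_lt/(_ _ e20) n1 := cl1.
have /cvgrPdist_lt/(_ _ e20) n2 := cl2.
near=> y.
rewrite (le_lt_trans (dsum_norm_le _))// (splitr e) ltrD//=.
- by near: y; exact: n1.
- by near: y; exact: n2.
Unshelve. all: by end_near. Qed.

HB.instance Definition _ := Uniform_isComplete.Build HK dsum_complete.

Definition dsum_inner x y : C := inner x.1 y.1 + inner x.2 y.2.

Fact dsum_inner_is_bilinear : bilinear_for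
  (GRing.Scale.Law.clone _ _ ( *%R ) _)
  (GRing.Scale.Law.clone _ _ (@Num.conj C \; *%R ) _) dsum_inner.
Proof.
split=> z a x y; rewrite /dsum_inner/=.
- by rewrite !linearPl !mulrDr addrACA.
- by rewrite !linearPr/= !mulrDr addrACA.
Qed.

HB.instance Definition _ := bilinear_isBilinear.Build C HK HK C
  (GRing.Scale.Law.clone _ _ ( *%R ) _)
  (GRing.Scale.Law.clone _ _ (@Num.conj C \; *%R ) _)
  dsum_inner dsum_inner_is_bilinear.

Fact dsum_inner_is_hermitian x y :
  dsum_inner x y = (-1) ^+ false * (dsum_inner y x)^*.
Proof.
rewrite /dsum_inner expr0 mul1r rmorphD/=.
by congr (_ + _); rewrite hermC mul1r.
Qed.

HB.instance Definition _ := isHermitianSesquilinear.Build C HK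
  false (@Num.conj C) dsum_inner dsum_inner_is_hermitian.

Fact dsum_normr_inner x : `|x| ^+ 2 = dsum_inner x x.
Proof. by rewrite dsum_norm_sqr !normr_inner. Qed.

Fact dsum_inner_gt0 x : x != 0 -> 0 < dsum_inner x x.
Proof. by move=> x0; rewrite -dsum_normr_inner exprn_gt0// normr_gt0. Qed.

HB.instance Definition _ := isDotProduct.Build C HK dsum_inner dsum_inner_gt0.

HB.instance Definition _ := isHilbert.Build R HK dsum_normr_inner.

End DirectSum.

Section Operators.
Context {R : realType} {H : hilbertType R}.
Local Notation C := R[i].
Implicit Types (X A : H -> H) (p : \bar R).

Definition separable_hilbert := exists D : set H, countable D /\ dense D.

Definition bounded_op X := linear X /\ continuous X.

Definition opnorm X : \bar R :=
  ereal_sup [set (complex.Re `|X x|)%:E | x in [set x : H | `|x| <= 1]].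

(* Adjoints, functional calculus and orthonormal bases are made total by
   choice: [xget d P] is a point of [P], and the irrelevant default [d] if [P]
   is empty. *)
Definition adjoint X : H -> H :=
  xget (fun=> 0)
    [set Y | bounded_op Y /\ forall x y, inner (X x) y = inner x (Y y)].

Definition spectrum A : set C :=
  [set z | ~ exists B : H -> H, [/\ bounded_op B,
      forall x, B (A x - z *: x) = x & forall x, A (B x) - z *: B x = x]].

Definition poly_op (q : {poly R}) A : H -> H :=
  fun x => \sum_(i < size q) (q`_i)%:C *: iter i A x.

(* Continuous functional calculus of a self-adjoint [A]: the operator-norm limit
   of [q_n(A)] for real polynomials [q_n] converging to [f] uniformly on the
   spectrum, which is contained in the real line. *)
Definition fun_calc (f : R -> R) A : H -> H :=
  xget (fun=> 0)
    [set B | bounded_op B /\ exists q : nat -> {poly R},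
      {uniform [set t : R | spectrum A t%:C],
        (fun n t => (q n).[t]) @ \oo --> f} /\
      (fun n => opnorm (poly_op (q n) A - B)) @ \oo --> 0%E].

(* |X| = (X^* X)^(1/2) *)
Definition abs_op X : H -> H := fun_calc Num.sqrt (adjoint X \o X).

Definition re_op X : H -> H := fun x => 2^-1 *: (X x + adjoint X x).

Definition orthonormal_basis (B : set H) :=
  (forall u v, B u -> B v -> inner u v = (u == v)%:R) /\
  (forall x, (forall u, B u -> inner x u = 0) -> x = 0).

(* Trace of a positive operator, in [0, +oo]. *)
Definition trace A : \bar R :=
  \esum_(u in xget set0 orthonormal_basis) (complex.Re (inner (A u) u))%:E.

Definition compact_op X :=
  bounded_op X /\ precompact (X @` [set x : H | `|x| <= 1]).

(* tr(|X|^r) *)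
Definition schatten_trace (r : R) X : \bar R :=
  trace (fun_calc (fun t => t `^ r) (abs_op X)).

(* Only meaningful for 1 <= p; [schatten_class +oo] is the set of all bounded
   operators. *)
Definition schatten_class p X :=
  match p with
  | r%:E => compact_op X /\ (schatten_trace r X < +oo)%E
  | +oo%E => bounded_op X
  | -oo%E => False
  end.

Definition schatten_norm p X : \bar R :=
  match p with
  | r%:E => if `[< schatten_class p X >] then (schatten_trace r X `^ r^-1)%E
            else +oo%E
  | _ => opnorm X
  end.

Definition expi (t : R) : C := cos t +i* sin t.

(* The p-numerical radius w_p. *)
Definition num_radius p X : \bar R :=
  ereal_sup (range (fun t : R => schatten_norm p (re_op (expi t *: X)))).

End Operators.

Arguments separable_hilbert {R} H.

(* The operator matrix [[X11, X12], [X21, X22]] on the direct sum. *)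
Definition op_mx {R : realType} {H : hilbertType R}
    (X11 X12 X21 X22 : H -> H) : dsum H H -> dsum H H :=
  fun x => (X11 x.1 + X12 x.2, X21 x.1 + X22 x.2).

(* 1/p, with 1/oo = 0 *)
Definition inv_exp {R : realType} (p : \bar R) : R :=
  if p is r%:E then r^-1 else 0.

(* (a^p + b^p)^(1/p), read as max(a, b) when p = oo *)
Definition lp_sum {R : realType} (p a b : \bar R) : \bar R :=
  if p is r%:E then ((a `^ r + b `^ r) `^ r^-1)%E else maxe a b.

(* Main.v *)
(** Write [M = [[0, T], [S, 0]] = U |M|] and [e = exp (i t)].  With
    [K = e U g(|M|)] and [F = f(|M|)] one has [2 Re (e M) = K F + F K^* = A B]
    for [A = (K, F)] and [B = (F, K^* )^T].  An eigenvector of the self-adjoint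
    [A B] is mapped by [B] to an eigenvector of [B A] with the same eigenvalue,
    so triangularising [B A] by Gram-Schmidt turns the eigenvalues of [A B] into
    diagonal entries [<B A w_i, w_i>] for an orthonormal family [w_i] (for
    [p = oo], one approximate eigenvector suffices).  The diagonal blocks of
    [B A] contribute [f(|S|) g(|T^*|)] and [f(|T|) g(|S^*|)] up to contractions;
    the off-diagonal ones are dominated by [f^2 + g^2] of [|S|] and [|T|].
    Each contribution is bounded by a Schatten norm through Jensen's inequality
    in the tangent form [s^r >= (1 - r) m^r + r m^(r - 1) s] inserted in the
    functional calculus, and Minkowski's inequality sums them. *)

(* In [A B] the product [K F] is just [e M], so [f] and [g] of different operators never meet. In [B
   A = [[F K, F^2], [K^* K, K^* F]]] they do: up to the phase, [F K] contains
   [f(|S|) V g(|T|) = f(|S|) g(|T^*|) V] with [V] the polar part of [T]. The price is that [B A] is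
   not self-adjoint; triangularisation still exhibits its eigenvalues in an orthonormal family.
   Origin of the constants: the four components of each [w_i] have total squared norm 1. Each mixed
   product sits in two diagonal blocks, so Jensen's inequality with mass [c = 1/2] gives
   [2^(1-r) 2 t]; the 1/2 of the real part adds [2^(-r)], and the root is [2^(2/r - 2)]. Off the
   diagonal the arithmetic-geometric mean brings a second 1/2, and each [f^2 + g^2] is tested on two
   components with [c = 1]: this gives [2^(-2r) 2 (t_S + t_T)], with root [2^(1/r - 2)]. The trace
   is defined in a chosen basis. Trace estimates therefore go through families that satisfy only
   Bessel's inequality, a property that coordinates and contractions of orthonormal families
   keep. *)
Require Import Defs.
From HB Require Import structures.
From mathcomp Require Import all_boot all_order all_algebra sesquilinear.
From mathcomp Require Import complex ring lra.
From mathcomp Require Import all_classical all_reals all_analysis.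

Import Order.TTheory GRing.Theory Num.Theory.
Import numFieldNormedType.Exports.

Local Open Scope classical_set_scope.
Local Open Scope ring_scope.

Set Implicit Arguments.
Unset Strict Implicit.
Unset Printing Implicit Defensive.

(** * Hilbert space geometry and adjoints *)

Section RealInner.
Context {R : realType} {H : hilbertType R}.
Implicit Types (x y z : H) (a : R[i]) (t : R).

(* The norm and the inner product take values in [R[i]]; [nm] and [ip] are the
   real ones of the underlying real Hilbert space. *)
Definition ip x y : R := complex.Re (inner x y).
Definition nm x : R := complex.Re `|x|.

Lemma normE x : `|x| = (nm x)%:C%C.
Proof. by rewrite /nm RRe_real// ger0_real. Qed.

Lemma nm_ge0 x : 0 <= nm x.
Proof. by rewrite -ler0c -normE. Qed.

Lemma ReD (a b : R[i]) : complex.Re (a + b) = complex.Re a + complex.Re b.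
Proof. by case: a; case: b. Qed.

Lemma ReM (a b : R[i]) : complex.Re (a * b) =
  complex.Re a * complex.Re b - complex.Im a * complex.Im b.
Proof. by case: a => a1 a2; case: b. Qed.

(** [inner] is Hermitian for the abstract conjugation of a closed field, while computations use the
    one on pairs. They agree because ['i * conj 'i] is [|'i|^2 = 1], which forces
    [conj 'i = - 'i]. *)
Lemma conjE a : Num.conj a = conjc a.
Proof.
have h : 'i%C * Num.conj 'i%C = 1 :> R[i].
  by rewrite -normCK -add_Re2_Im2/= expr0n expr1n add0r.
have hi : Num.conj 'i%C = - 'i%C :> R[i].
  have i2 : ('i%C : R[i]) * 'i%C = -1 by rewrite -expr2 sqr_i.
  apply: (@mulfI _ ('i%C : R[i])).
    by apply/eqP => /(congr1 (@complex.Im R))/= /eqP; rewrite oner_eq0.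
  by rewrite h mulrN i2 opprK.
rewrite [in LHS](complexE a) rmorphD rmorphM/= hi !(CrealP _); last first.
- by rewrite complex_real.
- by rewrite complex_real.
by case: a => u v; apply/eqP; rewrite eq_complex/=; apply/andP; split; apply/eqP; ring.
Qed.

Lemma innerC x y : inner x y = conjc (inner y x).
Proof. by rewrite hermC expr0 mul1r; exact: conjE. Qed.

Lemma ipC x y : ip x y = ip y x.
Proof. by rewrite /ip innerC; case: (inner y x). Qed.

Lemma ipDl x y z : ip (x + y) z = ip x z + ip y z.
Proof. by rewrite /ip linearDl ReD. Qed.

Lemma ipDr x y z : ip z (x + y) = ip z x + ip z y.
Proof. by rewrite ipC ipDl !(ipC z). Qed.

Lemma ipZl a x y : ip (a *: x) y =
  complex.Re a * ip x y - complex.Im a * complex.Im (inner x y).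
Proof. by rewrite /ip linearZl ReM. Qed.

Lemma ipZlR t x y : ip (t%:C%C *: x) y = t * ip x y.
Proof. by rewrite ipZl/= mul0r subr0. Qed.

Lemma ipZrR t x y : ip y (t%:C%C *: x) = t * ip y x.
Proof. by rewrite ipC ipZlR ipC. Qed.

Lemma ipNl x y : ip (- x) y = - ip x y.
Proof. by rewrite -scaleN1r ipZl/= oppr0 mul0r subr0 mulN1r. Qed.

Lemma ipNr x y : ip x (- y) = - ip x y.
Proof. by rewrite ipC ipNl ipC. Qed.

Lemma ip0l x : ip 0 x = 0.
Proof. by rewrite -(scale0r 0) ipZlR mul0r. Qed.

Lemma ip0r x : ip x 0 = 0.
Proof. by rewrite ipC ip0l. Qed.

Definition ipE := (ipDl, ipDr, ipNl, ipNr, ipZlR, ipZrR, ip0l, ip0r).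

(** The second argument is conjugate-linear, so rotating it by ['i] turns the imaginary part into a
    real part; complex identities thus reduce to [ip]. *)
Lemma innerE x y : inner x y = Complex (ip x y) (ip x ('i%C *: y)).
Proof.
apply/eqP; rewrite eq_complex/= eqxx/= ipC ipZl/= mul0r add0r mul1r.
by rewrite innerC; case: (inner y x) => u v /=.
Qed.

Lemma ipxx x : ip x x = nm x ^+ 2.
Proof. by rewrite /ip -normr_inner normE -rmorphXn. Qed.

Lemma ip_ge0 x : 0 <= ip x x.
Proof. by rewrite ipxx exprn_ge0// nm_ge0. Qed.

Lemma innerxx x : inner x x = (nm x ^+ 2)%:C%C.
Proof. by rewrite -normr_inner normE -rmorphXn. Qed.

Lemma nm0 : nm 0 = 0. Proof. by rewrite /nm normr0. Qed.

Lemma nm_eq0 x : nm x = 0 -> x = 0.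
Proof. by move=> h; apply/eqP; rewrite -normr_eq0 normE h. Qed.

Lemma nmN x : nm (- x) = nm x. Proof. by rewrite /nm normrN. Qed.

Lemma nm_distC x y : nm (x - y) = nm (y - x). Proof. by rewrite /nm distrC. Qed.

Lemma nmD x y : nm (x + y) <= nm x + nm y.
Proof. by rewrite -lecR rmorphD/= -!normE ler_normD. Qed.

Lemma nmZ a x : nm (a *: x) = Normc.normc a * nm x.
Proof.
have absE' : `|a| = (Normc.normc a)%:C%C by [].
by apply: complexI; rewrite rmorphM/= -!normE normrZ absE'.
Qed.

Lemma nmZR t x : nm (t%:C%C *: x) = `|t| * nm x.
Proof. by rewrite nmZ /= expr0n/= addr0 sqrtr_sqr. Qed.

Lemma nmD2 x y : nm (x + y) ^+ 2 = nm x ^+ 2 + 2 * ip x y + nm y ^+ 2.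
Proof. by rewrite -!ipxx !ipE (ipC y x); ring. Qed.

Lemma nmB2 x y : nm (x - y) ^+ 2 = nm x ^+ 2 - 2 * ip x y + nm y ^+ 2.
Proof. by rewrite nmD2 ipNr nmN; ring. Qed.

Lemma ip_le x y : ip x y <= nm x * nm y.
Proof.
have [/nm_eq0 ->|x0] := eqVneq (nm x) 0; first by rewrite ip0l nm0 mul0r.
have [/nm_eq0 ->|y0] := eqVneq (nm y) 0; first by rewrite ip0r nm0 mulr0.
(* The square of [|y| x - |x| y] is [2 |x| |y| (|x| |y| - <x, y>)]. *)
have := ip_ge0 ((nm y)%:C%C *: x - (nm x)%:C%C *: y).
rewrite !ipE (ipC y x) !ipxx.
have h : 0 < nm x * nm y by rewrite mulr_gt0 // lt_neqAle eq_sym nm_ge0 ?x0 ?y0.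
move=> h1; rewrite -subr_ge0 -(pmulr_rge0 _ h) -(@pmulr_rge0 _ 2)//.
by move: h1; congr (0 <= _); ring.
Qed.

Lemma ip_abs x y : `|ip x y| <= nm x * nm y.
Proof. by rewrite ler_norml ip_le andbT lerNl -ipNl -(nmN x) ip_le. Qed.

(* |<x, y>|^2 *)
Definition msq x y : R := ip x y ^+ 2 + ip x ('i%C *: y) ^+ 2.

Lemma msq_ge0 x y : 0 <= msq x y.
Proof. by rewrite addr_ge0 ?sqr_ge0. Qed.

Lemma msqE x y : msq x y = complex.Re (inner x y * inner y x).
Proof.
by rewrite (innerC y) innerE ReM/=; rewrite /msq; ring.
Qed.

Lemma msqC x y : msq x y = msq y x.
Proof. by rewrite !msqE mulrC. Qed.

(** By [innerE] the imaginary part is [ip] against ['i y], and [X] commutes with ['i], so checking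
    real products is enough. *)
Lemma adj_real_inner (X Y : H -> H) : scalable X ->
  (forall x y, ip (X x) y = ip x (Y y)) ->
  forall x y, inner (X x) y = inner x (Y y).
Proof.
move=> lX h x y.
rewrite !innerE; congr Complex; first exact: h.
have hi u v : ip u ('i%C *: v) = - ip ('i%C *: u) v.
  by rewrite [ip ('i%C *: u) v]ipZl/= mul0r sub0r mul1r opprK innerE.
by rewrite !hi -lX h.
Qed.

End RealInner.

(** * Completeness in terms of the real norm *)

Section Completeness.
Context {R : realType} {H : hilbertType R}.
Implicit Types (x y z : H) (a : R[i]) (t : R).

Lemma natSinv_le (e : R) : 0 < e ->
  exists n0 : nat, forall n, (n0 <= n)%N -> n.+1%:R^-1 <= e.
Proof.
move=> e0; have [n0 _ h] := near_infty_natSinv_lt (PosNum e0).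
by exists n0 => n /h /ltW.
Qed.

Lemma gt0_complexP (e : R[i]) : 0 < e -> exists2 t : R, 0 < t & e = t%:C%C.
Proof.
by case: e => u v; rewrite ltcE /= => /andP[/eqP -> u0]; exists u.
Qed.

Lemma hilbert_complete (u : nat -> H) :
  (forall e : R, 0 < e -> exists n0 : nat, forall n m, (n0 <= n)%N -> (n0 <= m)%N ->
    nm (u n - u m) <= e) ->
  exists l, forall e : R, 0 < e -> exists n0 : nat, forall n, (n0 <= n)%N ->
    nm (l - u n) <= e.
Proof.
move=> hu.
have : cauchy (u @ \oo).
  apply/cauchyP => _ /gt0_complexP[e e0 ->].
  have [n0 hn0] := hu (e / 2) ltac:(by rewrite divr_gt0).
  exists (u n0), n0 => // n n0n; rewrite -ball_normE/= normE ltcR.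
  apply: (@le_lt_trans _ _ (e / 2)); first exact: hn0.
  by rewrite ltr_pdivrMr// ltr_pMr// ltr1n.
move=> /cauchy_cvgP/cvg_ex[/= l /cvgrPdist_le hl].
exists l => e e0; have := hl (e%:C)%C; rewrite ltcR => /(_ e0)[n0 _ h].
by exists n0 => n /h /=; rewrite normE lecR.
Qed.

End Completeness.

Lemma ge0_small_eq0 {R : realFieldType} (t : R) :
  0 <= t -> (forall e : R, 0 < e -> t <= e) -> t = 0.
Proof.
move=> t0 h; apply/eqP; rewrite eq_le t0 andbT; apply/ler_addgt0Pr => e e0.
by rewrite add0r h.
Qed.

(** * Bounded operators between two Hilbert spaces *)

Section Operators.
Context {R : realType} {H K L : hilbertType R}.

(** An explicit real bound replaces continuity, and domain and codomain may differ, as maps between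
    [H] and its direct sums require; [bopP] links this to [bounded_op]. *)
Definition bop (H K : hilbertType R) (X : H -> K) :=
  linear X /\ exists2 M : R, 0 <= M & forall x, nm (X x) <= M * nm x.

Lemma bopP (X : H -> H) : bounded_op X <-> bop X.
Proof.
split=> -[lX cX]; split=> //.
  pose fX := HB.pack_for {linear H -> H} X (GRing.isLinear.Build _ _ _ _ X lX).
  have /linear_bounded_continuous/linear_boundedP : continuous fX by [].
  move=> hr.
  have [r [r0 hM]] : exists r : R[i], 0 < r /\ forall x, `|X x| <= r * `|x|.
    near (+oo : set_system R[i])%R => r; exists r; split.
      by near: r; apply: nbhs_pinfty_gt; exact: real0.
    by near: r.
  have [t t0 rt] := gt0_complexP r0; exists t; first exact: ltW.
  by move=> x; have := hM x; rewrite !normE rt -rmorphM lecR.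
pose fX := HB.pack_for {linear H -> H} X (GRing.isLinear.Build _ _ _ _ X lX).
suff : continuous fX by [].
apply/linear_bounded_continuous/linear_boundedP.
case: cX => M M0 hM; near=> r => x.
have Mr : M%:C%C <= r by near: r; apply: nbhs_pinfty_ge; rewrite ger0_real ?ler0c.
apply: le_trans (ler_wpM2r (normr_ge0 x) Mr).
by rewrite !normE -rmorphM lecR; exact: hM.
Unshelve. all: by end_near. Qed.

Variables (X : H -> K) (bX : bop X).

Lemma bopD x y : X (x + y) = X x + X y.
Proof. by have /= := bX.1 1 x y; rewrite !scale1r. Qed.

Lemma bop0 : X 0 = 0.
Proof. by have := bopD 0 0; rewrite addr0 => /eqP; rewrite -subr_eq0 opprD addNKr oppr_eq0 => /eqP. Qed.

Lemma bopZ a x : X (a *: x) = a *: X x.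
Proof. by have := bX.1 a x 0; rewrite bop0 !addr0. Qed.

Lemma bopN x : X (- x) = - X x.
Proof. by rewrite -scaleN1r bopZ scaleN1r. Qed.

Lemma bopB x y : X (x - y) = X x - X y.
Proof. by rewrite bopD bopN. Qed.

Lemma bop_sum I (r : seq I) (P : pred I) (F : I -> H) :
  X (\sum_(i <- r | P i) F i) = \sum_(i <- r | P i) X (F i).
Proof. exact: (big_morph X bopD bop0). Qed.

End Operators.

(** * Closure properties of bounded operators, orthogonal projection *)

Section Bop.
Context {R : realType}.
Implicit Types (H K L : hilbertType R).

Lemma bop_comp H K L (X : K -> L) (Y : H -> K) : bop X -> bop Y -> bop (X \o Y).
Proof.
move=> bX bY; split=> [a u v|] /=; first by rewrite bY.1 bX.1.
have [_ [M M0 hM]] := bX; have [_ [N N0 hN]] := bY.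
exists (M * N); first exact: mulr_ge0.
by move=> x; rewrite (le_trans (hM _))// -mulrA ler_wpM2l.
Qed.

Lemma bop_add H K (X Y : H -> K) : bop X -> bop Y -> bop (fun x => X x + Y x).
Proof.
move=> bX bY; split=> [a u v|] /=; first by rewrite bY.1 bX.1 scalerDr addrACA.
have [_ [M M0 hM]] := bX; have [_ [N N0 hN]] := bY.
exists (M + N); first exact: addr_ge0.
by move=> x; rewrite (le_trans (nmD _ _))// mulrDl lerD.
Qed.

Lemma bop_scale H K a (X : H -> K) : bop X -> bop (fun x => a *: X x).
Proof.
move=> bX; split=> [b u v|] /=.
  by rewrite bX.1 scalerDr !scalerA mulrC.
have [_ [M M0 hM]] := bX; exists (Normc.normc a * M).
  by apply: mulr_ge0 => //; case: a => *; rewrite sqrtr_ge0.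
move=> x; rewrite nmZ -mulrA ler_wpM2l//.
by case: a => *; rewrite sqrtr_ge0.
Qed.

Lemma bop_id H : bop (@id H).
Proof. by split=> //; exists 1 => // x; rewrite mul1r. Qed.

Lemma bop_zero H K : bop (fun _ : H => 0 : K).
Proof.
split=> [a u v|]; first by rewrite scaler0 addr0.
by exists 0 => // x; rewrite nm0 mul0r.
Qed.

Lemma bop_opp H K (X : H -> K) : bop X -> bop (fun x => - X x).
Proof.
move=> bX; split=> [a u v|]; first by rewrite bX.1 opprD scalerN.
by have [_ [M M0 hM]] := bX; exists M => // x; rewrite nmN.
Qed.

(** First-order condition at a minimum: at [t = b / (c + 1)] the quadratic equals
    [- t^2 (c + 2)]. *)
Lemma quad_ge0_eq0 (b c : R) : 0 <= c ->
  (forall t : R, 0 <= t ^+ 2 * c - 2 * t * b) -> b = 0.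
Proof.
move=> c0 h; have := h (b / (c + 1)); have c1 : 0 < c + 1 by rewrite ltr_wpDl.
have -> : (b / (c + 1)) ^+ 2 * c - 2 * (b / (c + 1)) * b =
   - (b / (c + 1)) ^+ 2 * (c + 2) by field; rewrite gt_eqF.
have c2 : 0 < c + 2 by rewrite ltr_wpDl.
rewrite pmulr_lge0// oppr_ge0 => h2.
have : (b / (c + 1)) ^+ 2 == 0 by rewrite eq_le h2 sqr_ge0.
by rewrite sqrf_eq0 mulf_eq0 invr_eq0 (gt_eqF c1) orbF => /eqP.
Qed.

(** [L] is an arbitrary linear subset, so the projection [y] is a limit of points of [L]. A
    minimising sequence is Cauchy by the parallelogram law, and the first variation at its limit
    gives orthogonality. *)
Lemma projection H (L : set H) : L 0 ->
  (forall a x y, L x -> L y -> L (a *: x + y)) ->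
  forall x, exists y, (forall e : R, 0 < e -> exists2 v, L v & nm (y - v) <= e) /\
    forall v, L v -> inner (x - y) v = 0.
Proof.
move=> L0 LP x.
pose E := [set nm (x - v) ^+ 2 | v in L].
have lE : has_lbound E by exists 0 => _ [v _ <-]; rewrite sqr_ge0.
have hE : has_inf E by split => //; exists (nm (x - 0) ^+ 2), 0.
pose d := inf E.
have dle v : L v -> d <= nm (x - v) ^+ 2 by move=> Lv; apply: ge_inf => //; exists v.
have ex n : exists v, L v /\ nm (x - v) ^+ 2 < d + n.+1%:R^-1.
  have n0 : 0 < n.+1%:R^-1 :> R by rewrite invr_gt0.
  by have [_ [v Lv <-] hv] := inf_adherent n0 hE; exists v.
have [v /all_and2[Lv hv]] := choice ex.
(* The midpoint of [v n] and [v m] lies in [L], so its squared distance to [x] is at least [d]. *)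
have par n m : nm (v n - v m) ^+ 2 <= 2 * n.+1%:R^-1 + 2 * m.+1%:R^-1.
  pose h : R[i] := (2^-1)%:C%C.
  have := dle _ (LP h _ _ (LP 1 _ _ (Lv n) (Lv m)) L0).
  have -> : x - (h *: (1 *: v n + v m) + 0) = h *: ((x - v n) + (x - v m)).
    have e : x = h *: (x + x).
      rewrite scalerDr -scalerDl -rmorphD/= (_ : 2^-1 + 2^-1 = 1 :> R) ?scale1r//.
      by field.
    by rewrite addr0 scale1r {1}e -scalerBr opprD addrACA.
  rewrite nmZR exprMn real_normK ?num_real// => hh.
  have -> : v n - v m = (x - v m) - (x - v n) by rewrite opprB [RHS]addrC addrA subrK.
  move: (hv n) (hv m) hh; set a := x - v m; set b := x - v n.
  rewrite (nmB2 a b) (nmD2 b a) (ipC b a).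
  by move: (n.+1%:R^-1 : R) (m.+1%:R^-1 : R) => ? ?; lra.
have [y hy] : exists y, forall e : R, 0 < e -> exists n0 : nat, forall n, (n0 <= n)%N ->
    nm (y - v n) <= e.
  apply: hilbert_complete => e e0.
  have [n0 hn0] := @natSinv_le R (e ^+ 2 / 4) ltac:(by rewrite divr_gt0// exprn_gt0).
  exists n0 => n m n0n n0m.
  rewrite -(@ler_pXn2r _ 2)// ?nnegrE ?nm_ge0 ?(ltW e0)//.
  have := par n m; have := hn0 _ n0n; have := hn0 _ n0m.
  move: (n.+1%:R^-1 : R) (m.+1%:R^-1 : R) (e ^+ 2) => ? ? ?; lra.
exists y; split.
  by move=> e /hy[n hn]; exists (v n) => //; exact: hn.
(* The limit still minimises the distance: [sqrt d] bounds [|x - (v n + w)|] from below for every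
   [n]. *)
have dy w : L w -> nm (x - y) <= nm (x - y - w).
  move=> Lw; apply/ler_addgt0Pr => e e0.
  have e4 : 0 < e / 3 by rewrite divr_gt0.
  have [n1 hn1] := hy _ e4; have [n2 hn2] := @natSinv_le R ((e / 3) ^+ 2) ltac:(by rewrite exprn_gt0).
  pose n := maxn n1 n2.
  have d0 : 0 <= d by apply: lb_le_inf; [exact: hE.1 | move=> _ [u _ <-]; rewrite sqr_ge0].
  have s0 := sqrtr_ge0 d.
  have h1 : nm (x - v n) <= Num.sqrt d + e / 3.
    rewrite -(@ler_pXn2r _ 2)// ?nnegrE ?nm_ge0 ?addr_ge0//; last exact: ltW.
    have := hv n; have := hn2 n (leq_maxr _ _); rewrite sqrrD sqr_sqrtr//.
    have : 0 <= Num.sqrt d * (e / 3) by rewrite mulr_ge0// ltW.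
    rewrite -mulr_natr; move: (n.+1%:R^-1 : R) ((e / 3) ^+ 2) => ? ?; lra.
  have h2 : nm (x - y) <= nm (x - v n) + e / 3.
    rewrite (_ : x - y = (x - v n) + (v n - y)); last by rewrite addrA subrK.
    by rewrite (le_trans (nmD _ _))// lerD2l nm_distC hn1// leq_maxl.
  have h3 : Num.sqrt d <= nm (x - y - w) + e / 3.
    apply: (@le_trans _ _ (nm (x - (v n + w)))).
      rewrite -(@ler_pXn2r _ 2)// ?nnegrE ?nm_ge0 ?sqr_sqrtr//.
      by apply: dle; rewrite -(scale1r (v n)); exact: LP.
    rewrite (_ : x - (v n + w) = (x - y - w) + (y - v n)); last first.
      by rewrite addrAC [x - y + _]addrA subrK opprD addrA.
    by rewrite (le_trans (nmD _ _))// lerD2l hn1// leq_maxl.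
  lra.
have ipo w : L w -> ip (x - y) w = 0.
  move=> Lw; apply: (@quad_ge0_eq0 _ (nm w ^+ 2)); first exact: sqr_ge0.
  move=> t; have := dy _ (LP t%:C%C _ _ Lw L0).
  rewrite addr0 -(@ler_pXn2r _ 2)// ?nnegrE ?nm_ge0//.
  by rewrite [leRHS]nmB2 ipZrR nmZR exprMn real_normK ?num_real//; lra.
move=> w Lw; rewrite innerE !ipo//.
by rewrite -(addr0 (_ *: _)); exact: LP.
Qed.

End Bop.

(** * Riesz representation, adjoints, approximate eigenvectors *)

Section Adjoint.
Context {R : realType}.
Implicit Types (H K : hilbertType R) (a : R[i]).

Lemma normc_le a : Normc.normc a <= `|complex.Re a| + `|complex.Im a|.
Proof.
case: a => u v /=; rewrite -(@ler_pXn2r _ 2)// ?nnegrE ?sqrtr_ge0 ?addr_ge0//.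
rewrite sqr_sqrtr ?addr_ge0 ?sqr_ge0// sqrrD !real_normK ?num_real//.
by rewrite lerD2r lerDl mulrn_wge0// mulr_ge0.
Qed.

(** The representing vector is a multiple of a normal [n] to the kernel, obtained by projecting a
    point outside the kernel. *)
Lemma riesz H (phi : H -> R[i]) (M : R) :
  (forall a x y, phi (a *: x + y) = a * phi x + phi y) ->
  (forall x, Normc.normc (phi x) <= M * nm x) ->
  exists y, forall x, phi x = inner x y.
Proof.
move=> lphi hM; pose L := [set x | phi x = 0].
have p0 : phi 0 = 0.
  have := lphi 1 0 0; rewrite scale1r mul1r addr0 => /eqP.
  by rewrite -subr_eq0 opprD addNKr oppr_eq0 => /eqP.
have LP a x y : L x -> L y -> L (a *: x + y).
  by rewrite /L/= lphi => -> ->; rewrite mulr0 addr0.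
have [h0|] := pselect (forall x, phi x = 0).
  by exists 0 => x; rewrite h0 linear0r.
move=> /existsNP[x0 x00].
have [y0 [hy0 oy0]] := projection p0 LP x0.
(* [y0] is only a limit of points of the kernel; boundedness of [phi] makes it vanish there. *)
have Ly0 : phi y0 = 0.
  apply: Normc.eq0_normc; apply: ge0_small_eq0.
    by case: (phi y0) => *; rewrite sqrtr_ge0.
  move=> e e0; have M1 : 0 < `|M| + 1 by rewrite ltr_wpDl.
  have [v Lv hv] := hy0 (e / (`|M| + 1)) ltac:(by rewrite divr_gt0).
  have -> : phi y0 = phi (y0 - v).
    by rewrite addrC -scaleN1r lphi Lv mulr0 add0r.
  rewrite (le_trans (hM _))// (@le_trans _ _ ((`|M| + 1) * nm (y0 - v)))//.
    by rewrite ler_wpM2r ?nm_ge0// (le_trans (ler_norm _))// lerDl.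
  by rewrite mulrC -ler_pdivlMr.
set n := x0 - y0 in oy0.
have pn : phi n != 0.
  by apply/eqP; rewrite /n addrC -scaleN1r lphi Ly0 mulr0 add0r.
have n0 : nm n != 0.
  by apply: contra_neq pn => /nm_eq0 ->.
have nC0 : (nm n)%:C%C != 0 :> R[i].
  by apply: contra_neq n0 => /(congr1 (@complex.Re R)).
exists ((Num.conj (phi n / (nm n ^+ 2)%:C%C)) *: n) => x.
rewrite linearZr/= conjCK.
(* The second vector lies in the kernel of [phi]. *)
have : inner n (- (phi x / phi n) *: n + x) = 0.
  by apply: oy0; rewrite /L/= lphi mulNr divfK// addNr.
rewrite innerC linearPl/= innerxx => /(congr1 (@conjc R)); rewrite conjcK conjc0.
move=> /eqP; rewrite mulNr addrC subr_eq0 => /eqP ->.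
by field; apply/andP.
Qed.

Lemma ip_ext H (x y : H) : (forall z, ip z x = ip z y) -> x = y.
Proof.
move=> h; apply/eqP; rewrite -subr_eq0; apply/eqP/nm_eq0.
by apply/eqP; rewrite -sqrf_eq0 -ipxx ipDr ipNr h subrr.
Qed.

(** Riesz representation is applied to [x -> <X x, y>] for each [y]; linearity of [Y] follows from
    uniqueness, boundedness from [|Y y|^2 = <X (Y y), y>]. *)
Lemma adjoint_ex H K (X : H -> K) : bop X ->
  exists Y : K -> H, bop Y /\ forall x y, inner (X x) y = inner x (Y y).
Proof.
move=> bX; have [_ [M M0 hM]] := bX.
have /choice[Y hY] : forall y, exists z, forall x, inner (X x) y = inner x z.
  (* The factor 2 comes from bounding a modulus by [|Re| + |Im|]. *)
  move=> y; apply: (@riesz _ _ (2 * M * nm y)).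
    by move=> a u v; rewrite bX.1 linearPl.
  move=> x; rewrite (le_trans (normc_le _))// innerE/=.
  have h : nm (X x) * nm y <= M * nm y * nm x by rewrite mulrAC ler_wpM2r ?nm_ge0.
  have := ip_abs (X x) y; have := ip_abs (X x) ('i%C *: y).
  rewrite nmZ/= expr0n expr1n/= add0r sqrtr1 mul1r.
  by move: h; rewrite -!mulrA; lra.
exists Y; split; last by move=> x y.
have hip x y : ip (X x) y = ip x (Y y) by rewrite /ip hY.
split=> [a u v|].
  apply: ip_ext => z; rewrite /ip -hY linearPr/= linearPr/= -!hY//.
exists M => // y; have [->|y0] := eqVneq (Y y) 0.
  by rewrite nm0 mulr_ge0 ?nm_ge0.
have Y0 : 0 < nm (Y y).
  by rewrite lt_neqAle nm_ge0 andbT eq_sym; apply: contra_neq y0 => /nm_eq0.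
rewrite -(ler_pM2l Y0) -expr2 -ipxx -hip (le_trans (ip_le _ _))//.
by rewrite mulrA [_ * M]mulrC ler_wpM2r ?nm_ge0.
Qed.

Lemma adjointP H (X : H -> H) : bop X ->
  bop (adjoint X) /\ forall x y, inner (X x) y = inner x (adjoint X y).
Proof.
move=> bX; rewrite /adjoint; case: xgetP => [_ ->|h].
  by case=> /bopP.
have [Y [/bopP bY hY]] := adjoint_ex bX.
by case: (h Y).
Qed.

Lemma bop_adj H (X : H -> H) : bop X -> bop (adjoint X).
Proof. by case/adjointP. Qed.

Lemma ip_adj H (X : H -> H) : bop X -> forall x y, ip (X x) y = ip x (adjoint X y).
Proof. by case/adjointP => _ h x y; rewrite /ip h. Qed.

Lemma ip_adjl H (X : H -> H) : bop X -> forall x y, ip (adjoint X x) y = ip x (X y).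
Proof. by move=> bX x y; rewrite ipC -ip_adj// ipC. Qed.

Lemma adj_uniq H (X Y : H -> H) : bop X -> (forall x y, ip (X x) y = ip x (Y y)) ->
  adjoint X = Y.
Proof.
by move=> bX h; apply/funext => y; apply: ip_ext => z; rewrite -ip_adj// h.
Qed.

Definition selfadj H (A : H -> H) := forall x y, ip (A x) y = ip x (A y).

(** Subspaces are sets: the estimates below are relative to a subset invariant under [A], so they
    apply to an orthogonal complement without making it a Hilbert space of its own. *)
Definition linear_subset H (L : set H) :=
  L 0 /\ forall a x y, L x -> L y -> L (a *: x + y).

Lemma linear_subsetT H : linear_subset [set: H]. Proof. by []. Qed.

Lemma linear_subsetD H (L : set H) x y : linear_subset L -> L x -> L y -> L (x + y).
Proof. by move=> [_ h] Lx Ly; rewrite -(scale1r x); exact: h. Qed.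

Lemma linear_subsetZ H (L : set H) a x : linear_subset L -> L x -> L (a *: x).
Proof. by move=> [h0 h] Lx; rewrite -(addr0 (_ *: _)); exact: h. Qed.

Lemma linear_subsetB H (L : set H) x y : linear_subset L -> L x -> L y -> L (x - y).
Proof. by move=> h Lx Ly; apply: linear_subsetD => //; rewrite -scaleN1r; exact: linear_subsetZ. Qed.

(** Polarisation writes [4 <A x, y>] as the difference of the quadratic form at [x + y] and [x - y];
    the parallelogram law bounds it by [2 m (|x|^2 + |y|^2)]. *)
Lemma selfadj_norm_le H (A : H -> H) (L : set H) (m : R) : bop A -> selfadj A -> linear_subset L ->
  (forall x, L x -> L (A x)) -> 0 <= m ->
  (forall x, L x -> `|ip (A x) x| <= m * nm x ^+ 2) ->
  forall x, L x -> nm (A x) <= m * nm x.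
Proof.
move=> bA sA sL AL m0 hm x Lx.
have key y : L y -> 2 * ip (A x) y <= m * (nm x ^+ 2 + nm y ^+ 2).
  move=> Ly; have := hm _ (linear_subsetD sL Lx Ly); have := hm _ (linear_subsetB sL Lx Ly).
  rewrite !ler_norml => /andP[h1 _] /andP[_ h2].
  move: h1 h2; rewrite (nmB2 x y) (nmD2 x y) !(bopD bA) (bopN bA) !ipE (sA y x) (ipC y (A x)); lra.
have [->|] := eqVneq (A x) 0; first by rewrite nm0 mulr_ge0 ?nm_ge0.
have [->|x0] := eqVneq x 0; first by rewrite (bop0 bA) eqxx.
move=> Ax0; have pos (z : H) : z != 0 -> 0 < nm z.
  by move=> z0; rewrite lt_neqAle nm_ge0 andbT eq_sym; apply: contra_neq z0 => /nm_eq0.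
(* The vector [(|x| / |A x|) A x] has the norm of [x], which balances the two squares. *)
have := key _ (linear_subsetZ (nm x / nm (A x))%:C%C sL (AL _ Lx)).
rewrite ipZrR nmZR ipxx gtr0_norm ?divr_gt0 ?pos// divfK ?gt_eqF ?pos//.
have -> : nm x / nm (A x) * nm (A x) ^+ 2 = nm x * nm (A x).
  by field; rewrite gt_eqF ?pos.
have -> : m * (nm x ^+ 2 + nm x ^+ 2) = 2 * (nm x * (m * nm x)) by ring.
by rewrite ler_pM2l// ler_pM2l// pos.
Qed.

Lemma nm_gt0 H (x : H) : x != 0 -> 0 < nm x.
Proof.
by move=> x0; rewrite lt_neqAle nm_ge0 andbT eq_sym; apply: contra_neq x0 => /nm_eq0.
Qed.

Lemma nm_normalize H (x : H) : x != 0 -> nm ((nm x)^-1%:C%C *: x) = 1.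
Proof.
by move=> x0; rewrite nmZR gtr0_norm ?invr_gt0 ?nm_gt0// mulVf// gt_eqF// nm_gt0.
Qed.

(** [m] is the supremum of [|<A x, x>|] over unit vectors of [L]. For a sign [s],
    [|A x - s m x|^2 <= 2 m (m - s <A x, x>)], so nearly extremal unit vectors are approximate
    eigenvectors. *)
Lemma selfadj_approx_eigen H (A : H -> H) (L : set H) : bop A -> selfadj A -> linear_subset L ->
  (forall x, L x -> L (A x)) -> (exists2 x, L x & x != 0) ->
  exists m l : R, [/\ 0 <= m, forall x, L x -> nm (A x) <= m * nm x, `|l| = m &
    forall e : R, 0 < e -> exists x, [/\ L x, nm x = 1 & nm (A x - l%:C%C *: x) <= e]].
Proof.
move=> bA sA sL AL [x0 Lx0 x00].
have [_ [M M0 hM]] := bA.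
pose E := [set `|ip (A x) x| | x in [set x | L x /\ nm x = 1]].
have E0 : E !=set0.
  exists `|ip (A ((nm x0)^-1%:C%C *: x0)) ((nm x0)^-1%:C%C *: x0)|.
  by exists ((nm x0)^-1%:C%C *: x0) => //; split; [exact: linear_subsetZ|exact: nm_normalize].
have hE : has_sup E.
  split=> //; exists M => _ [x [_ x1] <-]; rewrite (le_trans (ip_abs _ _))//.
  by rewrite x1 mulr1 -(mulr1 M) -{1}x1.
pose m := sup E.
have hm x : L x -> nm x = 1 -> `|ip (A x) x| <= m.
  by move=> Lx x1; apply: ub_le_sup; [exact: hE.2|exists x].
have m0 : 0 <= m by case: E0 => _ [x [Lx x1] _]; apply: le_trans (hm _ Lx x1).
have hmm x : L x -> nm (A x) <= m * nm x.
  apply: (selfadj_norm_le bA sA sL AL m0) => {}x Lx.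
  have [->|x1] := eqVneq x 0; first by rewrite ip0r normr0 nm0 expr0n mulr0.
  have := hm _ (linear_subsetZ (nm x)^-1%:C%C sL Lx) (nm_normalize x1).
  rewrite (bopZ bA) ipZlR ipZrR ipC !normrM gtr0_norm ?invr_gt0 ?nm_gt0//.
  by rewrite mulrA -invfM mulrC ler_pdivrMr -?expr2// exprn_gt0// nm_gt0.
have est (s : R) x (e : R) : L x -> nm x = 1 -> s ^+ 2 = 1 -> m - e <= s * ip (A x) x ->
    nm (A x - (s * m)%:C%C *: x) ^+ 2 <= 2 * m * e.
  move=> Lx x1 s1 h; rewrite nmB2 ipZrR nmZR x1 mulr1 real_normK ?num_real//.
  rewrite exprMn s1 mul1r.
  have : nm (A x) ^+ 2 <= m ^+ 2.
    by rewrite ler_pXn2r// ?nnegrE ?nm_ge0//; have := hmm _ Lx; rewrite x1 mulr1.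
  by move: (ler_wpM2l m0 h); rewrite expr2; lra.
have choose_e (s e : R) : s ^+ 2 = 1 -> 0 < e ->
    (forall d : R, 0 < d -> exists x, [/\ L x, nm x = 1 & m - d <= s * ip (A x) x]) ->
    exists x, [/\ L x, nm x = 1 & nm (A x - (s * m)%:C%C *: x) <= e].
  move=> s1 e0 h.
  have d0 : 0 < e ^+ 2 / (2 * m + 1) by rewrite divr_gt0 ?exprn_gt0// ltr_wpDl// mulr_ge0.
  have [x [Lx x1 hx]] := h _ d0; exists x; split=> //.
  rewrite -(@ler_pXn2r _ 2)// ?nnegrE ?nm_ge0 ?(ltW e0)//.
  rewrite (le_trans (est _ _ _ Lx x1 s1 hx))// mulrCA ler_piMr ?sqr_ge0//.
  by rewrite ler_pdivrMr ?mul1r ?lerDl// ltr_wpDl// mulr_ge0.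
(* Either values of the form come arbitrarily close to [m], or they stay below [m - d0], and then
   the supremum is approached near [- m]. *)
have [h|] := pselect (forall d : R, 0 < d -> exists x, [/\ L x, nm x = 1 & m - d <= ip (A x) x]).
  exists m, m; split=> //; first by rewrite ger0_norm.
  move=> e e0; have := @choose_e 1 e; rewrite expr1n mul1r; apply=> //.
  by move=> d /h[x]; exists x; rewrite mul1r.
move=> /existsNP[d0 /not_implyP[d00 hd0]].
exists m, (- m); split=> //; first by rewrite normrN ger0_norm.
move=> e e0; have := @choose_e (-1) e; rewrite sqrrN expr1n mulN1r; apply=> //.
move=> d d1; have mn0 : 0 < Num.min d d0 by rewrite lt_min d1.
have [_ [x [Lx x1] <-]] := sup_adherent mn0 hE.
rewrite -/m => hx; exists x; split=> //; rewrite mulN1r.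
move: hx; case: (ger0P (ip (A x) x)) => h hx.
  case: hd0; exists x; split=> //.
  by apply: le_trans (ltW hx); rewrite lerD2l lerN2 ge_min lexx orbT.
by apply: le_trans (ltW hx); rewrite lerD2l lerN2 ge_min lexx.
Qed.

End Adjoint.

(** * Polynomials of a self-adjoint operator and its spectrum *)

Section OperatorPolynomials.
Context {R : realType} {H : hilbertType R}.
Local Notation C := R[i].
Implicit Types (p q : {poly C}) (A : H -> H) (x y : H).

(** Coefficients are complex, although the calculus uses real polynomials, because the spectral
    argument below splits polynomials into linear factors. *)
Definition pop p A x : H := \sum_(i < size p) p`_i *: iter i A x.

Lemma popE n p A x : (size p <= n)%N -> pop p A x = \sum_(i < n) p`_i *: iter i A x.
Proof.
move=> pn; rewrite /pop -(big_mkord xpredT (fun i => p`_i *: iter i A x)).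
rewrite -(big_mkord xpredT (fun i => p`_i *: iter i A x)).
rewrite (big_cat_nat (leq0n _) pn)/= [X in _ = _ + X]big_nat.
rewrite [X in _ = _ + X]big1 ?addr0// => i /andP[pi _].
by rewrite nth_default ?scale0r.
Qed.

Lemma popD p q A x : pop (p + q) A x = pop p A x + pop q A x.
Proof.
have h := size_polyD p q.
rewrite (popE _ _ h) (popE _ _ (leq_maxl (size p) (size q))).
rewrite (popE _ _ (leq_maxr (size p) (size q))) -big_split/=.
by apply: eq_bigr => i _; rewrite coefD scalerDl.
Qed.

Lemma popZ c p A x : pop (c *: p) A x = c *: pop p A x.
Proof.
rewrite (popE _ _ (size_scale_leq c p)) /pop scaler_sumr.
by apply: eq_bigr => i _; rewrite coefZ scalerA.
Qed.

Lemma popC c A x : pop c%:P A x = c *: x.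
Proof.
by rewrite (popE _ _ (size_polyC_leq1 c)) big_ord1 coefC.
Qed.

Lemma popN p A x : pop (- p) A x = - pop p A x.
Proof. by rewrite -scaleN1r popZ scaleN1r. Qed.

Variables (A : H -> H) (bA : bop A).

Lemma popMX p x : pop (p * 'X) A x = A (pop p A x).
Proof.
rewrite (popE (n := (size p).+1)).
  rewrite big_ord_recl coefMX eqxx scale0r add0r /pop (bop_sum bA).
  by apply: eq_bigr => i _; rewrite coefMX/= (bopZ bA).
by rewrite (leq_trans (size_polyMleq _ _))// size_polyX addnC.
Qed.

Lemma bop_pop p : bop (pop p A).
Proof.
elim/poly_ind: p => [|p c [lp [M M0 hM]]].
  have -> : pop 0 A = (fun _ => 0); last exact: bop_zero.
  by apply/funext => x; rewrite -polyC0 popC scale0r.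
have -> : pop (p * 'X + c%:P) A = (fun x => A (pop p A x) + c *: x).
  by apply/funext => x; rewrite popD popMX popC.
apply: bop_add; first by apply: bop_comp => //; split => //; exists M.
by apply: bop_scale; exact: bop_id.
Qed.

Lemma popM p q x : pop (p * q) A x = pop p A (pop q A x).
Proof.
elim/poly_ind: p x => [|p c IH] x.
  by rewrite mul0r -polyC0 !popC !scale0r.
rewrite mulrDl mulrAC popD popMX IH popD popMX -/(polyC c) mul_polyC popZ popC.
by [].
Qed.

Definition rpop (q : {poly R}) := pop (map_poly (real_complex R) q) A.

Lemma poly_opE (q : {poly R}) : poly_op q A = rpop q.
Proof.
apply/funext => x; rewrite /poly_op /rpop /pop size_map_inj_poly//; last exact: complexI.
by apply: eq_bigr => i _; rewrite coef_map.
Qed.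

Lemma rpopD (p q : {poly R}) x : rpop (p + q) x = rpop p x + rpop q x.
Proof. by rewrite /rpop rmorphD popD. Qed.

Lemma rpopB (p q : {poly R}) x : rpop (p - q) x = rpop p x - rpop q x.
Proof. by rewrite /rpop rmorphB/= popD popN. Qed.

Lemma rpopM (p q : {poly R}) x : rpop (p * q) x = rpop p (rpop q x).
Proof. by rewrite /rpop rmorphM popM. Qed.

Lemma rpopC (c : R) x : rpop c%:P x = c%:C%C *: x.
Proof. by rewrite /rpop map_polyC popC. Qed.

Lemma rpopX x : rpop 'X x = A x.
Proof.
by rewrite /rpop map_polyX -[X in pop X]mul1r popMX -(polyC1 C) popC scale1r.
Qed.

Lemma bop_rpop (q : {poly R}) : bop (rpop q).
Proof. exact: bop_pop. Qed.

Lemma rpop_comm (q : {poly R}) x : rpop q (A x) = A (rpop q x).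
Proof. by rewrite -[in LHS]rpopX -rpopM mulrC rpopM rpopX. Qed.

Lemma selfadj_rpop (q : {poly R}) : selfadj A -> selfadj (rpop q).
Proof.
move=> sA; elim/poly_ind: q => [|q c IH] x y.
  by rewrite -polyC0 !rpopC scale0r !scale0r ip0l ip0r.
rewrite !rpopD !rpopC !ipE (ipC x y) [q * 'X]mulrC !rpopM !rpopX.
by rewrite sA IH rpop_comm (ipC x).
Qed.

End OperatorPolynomials.

(** * Spectral mapping, and the spectrum of a positive operator *)

Section Spectrum.
Context {R : realType} {H : hilbertType R}.
Local Notation C := R[i].
Implicit Types (A : H -> H) (x y : H).

Lemma normc_ge0 (z : C) : 0 <= Normc.normc z.
Proof. by case: z => u v; rewrite sqrtr_ge0. Qed.

Lemma bounded_below_pop A (r : seq C) : bop A ->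
  (forall z, z \in r -> exists2 c : R, 0 < c & forall x, c * nm x <= nm (A x - z *: x)) ->
  exists2 c : R, 0 < c & forall x, c * nm x <= nm (pop (\prod_(z <- r) ('X - z%:P)) A x).
Proof.
move=> bA; elim: r => [_|z r IH hr].
  by exists 1 => // x; rewrite big_nil -polyC1 popC scale1r mul1r.
have [c c0 hc] := hr z (mem_head _ _).
have [|d d0 hd] := IH; first by move=> w wr; apply: hr; rewrite inE wr orbT.
exists (c * d); first exact: mulr_gt0.
move=> x; rewrite big_cons popM//.
set y := pop _ A x; have -> : pop ('X - z%:P) A y = A y - z *: y.
  rewrite popD popN popC -['X]mul1r popMX// -(polyC1 C) popC scale1r//.
by apply: le_trans (hc y); rewrite -mulrA ler_pM2l.
Qed.

(** Factor [q - l] over the complex numbers. If every factor [A - z] were bounded below, so would be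
    [q(A) - l]; hence some root [z] is an approximate eigenvalue of [A]. It is real by
    self-adjointness, and a bounded inverse of [A - z] would contradict it. *)
Lemma spectrum_real_root A (q : {poly R}) (l : R) : bop A -> selfadj A ->
  (1 < size q)%N ->
  (forall e : R, 0 < e -> exists2 x, nm x = 1 & nm (rpop A q x - l%:C%C *: x) <= e) ->
  exists2 t : R, spectrum A t%:C%C & q.[t] = l.
Proof.
move=> bA sA sq hx.
pose p := map_poly (real_complex R) q - (l%:C%C)%:P.
have sp : size p = size q.
  rewrite /p size_polyDl size_map_inj_poly//; try exact: complexI.
  by rewrite size_polyN (leq_ltn_trans (size_polyC_leq1 _)).
have p0 : p != 0 by rewrite -size_poly_gt0 sp (leq_trans _ sq).
have [r pr] := closed_field_poly_normal p.
have [z zr hz] : exists2 z, z \in r &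
    forall c : R, 0 < c -> exists x, nm (A x - z *: x) < c * nm x.
  apply: contrapT => hno.
  have [|c c0 hc] := @bounded_below_pop A r bA.
    move=> z zr; apply: contrapT => hno2; apply: hno; exists z => // c c0.
    apply: contrapT => hno3; apply: hno2; exists c => // x.
    by rewrite leNgt; apply/negP => h; apply: hno3; exists x.
  have lp : 0 < Normc.normc (lead_coef p).
    rewrite lt_neqAle normc_ge0 andbT eq_sym.
    by apply/eqP => /Normc.eq0_normc/eqP; rewrite lead_coef_eq0 (negbTE p0).
  have [x x1] := hx (Normc.normc (lead_coef p) * c / 2) ltac:(by rewrite divr_gt0// mulr_gt0).
  have -> : rpop A q x - l%:C%C *: x = pop p A x by rewrite popD popN popC.
  rewrite pr popZ nmZ; have := hc x; rewrite x1 mulr1 -pr.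
  set N := nm _ => h; rewrite leNgt => /negP; apply.
  have := ler_wpM2l (ltW lp) h; have := mulr_gt0 lp c0; lra.
have pz : root p z by rewrite pr rootZ ?lead_coef_eq0// root_prod_XsubC.
(* [A x - (Re z) x] and ['i (Im z) x] are orthogonal for the real product, so
   [|A x - z x| >= |Im z| |x|]. *)
have bz : complex.Im z = 0.
  apply: contrapT => /eqP b0.
  have [x] := hz `|complex.Im z| ltac:(by rewrite normr_gt0).
  suff h : `|complex.Im z| * nm x <= nm (A x - z *: x) by rewrite ltNge h.
  rewrite -(@ler_pXn2r _ 2)// ?nnegrE ?nm_ge0 ?mulr_ge0 ?nm_ge0//.
  set u := A x - (complex.Re z)%:C%C *: x.
  set w := (complex.Im z)%:C%C *: ('i%C *: x).
  have -> : A x - z *: x = u - w.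
    rewrite /u /w scalerA -addrA -opprD -scalerDl; congr (_ - _ *: _).
    by rewrite mulrC {1}(complexE z).
  have uw : ip u w = 0.
    have h1 : ip x ('i%C *: x) = 0.
      by have := congr1 (@complex.Im R) (innerE x x); rewrite innerxx.
    rewrite /u /w ipZrR !ipE h1 mulr0 oppr0 addr0.
    have /eqP : ip (A x) ('i%C *: x) = - ip (A x) ('i%C *: x).
      rewrite {1}sA (bopZ bA).
      have hi (a b : H) : ip a ('i%C *: b) = - ip ('i%C *: a) b.
        by rewrite [ip ('i%C *: a) b]ipZl/= mul0r sub0r mul1r opprK innerE.
      by rewrite hi opprK ipC.
    by rewrite -addr_eq0 -mulr2n mulrn_eq0/= => /eqP ->; rewrite mulr0.
  rewrite nmB2 uw mulr0 subr0 exprMn real_normK ?num_real//.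
  have -> : nm w ^+ 2 = complex.Im z ^+ 2 * nm x ^+ 2.
    rewrite /w nmZR nmZ/= expr0n expr1n/= add0r sqrtr1 mul1r exprMn.
    by rewrite real_normK ?num_real.
  by rewrite lerDr sqr_ge0.
exists (complex.Re z).
  move=> [B [/bopP[lB [M M0 hM]] BA _]].
  have [x] := hz (M + 1)^-1 ltac:(by rewrite invr_gt0 ltr_wpDl).
  have zE : z = (complex.Re z)%:C%C by rewrite {1}(complexE z) bz mulr0 addr0.
  rewrite -zE in BA => hx1.
  have := hM (A x - z *: x); rewrite BA => hx2.
  have M1 : 0 < M + 1 by rewrite ltr_wpDl.
  have h3 : (M + 1) * nm (A x - z *: x) < nm x.
    by rewrite mulrC -ltr_pdivlMr// mulrC.
  have := nm_ge0 (A x - z *: x); lra.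
have zE : z = (complex.Re z)%:C%C by rewrite {1}(complexE z) bz mulr0 addr0.
move: pz; rewrite /root /p hornerD hornerN hornerC zE horner_map/=.
by rewrite subr_eq0 => /eqP/complexI.
Qed.

(** The norm of the self-adjoint [q(A)] is the modulus of an approximate eigenvalue, which is a
    value of [q] on the spectrum. *)
Lemma spectral_bound A (q : {poly R}) (m : R) : bop A -> selfadj A -> 0 <= m ->
  (forall t : R, spectrum A t%:C%C -> `|q.[t]| <= m) ->
  forall x, nm (rpop A q x) <= m * nm x.
Proof.
move=> bA sA m0 hm x0.
have [->|x00] := eqVneq x0 0.
  by rewrite (bop0 (bop_rpop bA q)) nm0 mulr0.
have key (p : {poly R}) : (1 < size p)%N -> exists l t : R, [/\ spectrum A t%:C%C, p.[t] = l &
    forall x, nm (rpop A p x) <= `|l| * nm x].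
  move=> sp; have [m' [l [m'0 hm' lm hx]]] :=
    selfadj_approx_eigen (bop_rpop bA p) (selfadj_rpop bA p sA) (linear_subsetT H) (fun _ _ => I)
      (ex_intro2 _ _ x0 I x00).
  have [|t st pt] := spectrum_real_root bA sA sp (l := l).
    by move=> e /hx[x [_ x1 hx1]]; exists x.
  by exists l, t; split=> // x; rewrite lm; exact: hm'.
have [sq|sq] := ltnP 1 (size q).
  have [l [t [st <- h]]] := key q sq.
  by rewrite (le_trans (h x0))// ler_wpM2r ?nm_ge0 ?hm.
(* A constant [q] still needs a spectral point to be compared with [m]; the case of ['X] supplies
   one. *)
have [l [t [st _ _]]] := key 'X ltac:(by rewrite size_polyX).
have := hm t st; rewrite (size1_polyC sq) hornerC => hc.
by rewrite rpopC nmZR ler_wpM2r ?nm_ge0.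
Qed.

(** The lower bound gives injectivity and, with completeness, a closed range; by self-adjointness
    the complement of the range is the kernel, which is zero. *)
Lemma selfadj_inverse (C0 : H -> H) (c : R) : bop C0 -> selfadj C0 -> 0 < c ->
  (forall x, c * nm x <= nm (C0 x)) ->
  exists B, [/\ bop B, forall x, B (C0 x) = x & forall x, C0 (B x) = x].
Proof.
move=> bC sC c0 hc.
have inj x y : C0 x = C0 y -> x = y.
  move=> h; apply/eqP; rewrite -subr_eq0; apply/eqP/nm_eq0.
  apply/eqP; rewrite eq_le nm_ge0 andbT -(@pmulr_rle0 _ c)//.
  by rewrite (le_trans (hc _))// (bopB bC) h subrr nm0.
have sur y : exists x, C0 x = y.
  pose L := range C0.
  have L0 : L 0 by exists 0 => //; exact: bop0.
  have LP a u v : L u -> L v -> L (a *: u + v).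
    by move=> [u' _ <-] [v' _ <-]; exists (a *: u' + v') => //; exact: bC.1.
  have [y0 [hy0 oy0]] := projection L0 LP y.
  have e0 n : 0 < n.+1%:R^-1 :> R by rewrite invr_gt0.
  have /choice[u hu] : forall n : nat, exists u, nm (y0 - C0 u) <= n.+1%:R^-1.
    by move=> n; have [_ [u _ <-] h] := hy0 _ (e0 n); exists u.
  have [x hx] : exists l, forall e : R, 0 < e -> exists n0 : nat, forall n, (n0 <= n)%N ->
      nm (l - u n) <= e.
    apply: hilbert_complete => e e1.
    have [n0 hn0] := @natSinv_le R (c * e / 2) ltac:(by rewrite divr_gt0// mulr_gt0).
    exists n0 => n m n0n n0m; rewrite -(ler_pM2l c0) (le_trans (hc _))//.
    rewrite (bopB bC) (_ : C0 (u n) - C0 (u m) = (y0 - C0 (u m)) - (y0 - C0 (u n))).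
      rewrite (le_trans (nmD _ _))// nmN.
      have := hu n; have := hu m; have := hn0 _ n0n; have := hn0 _ n0m.
      by move: (n.+1%:R^-1 : R) (m.+1%:R^-1 : R) => ? ?; lra.
    by rewrite opprB [RHS]addrC addrA subrK.
  have y0E : C0 x = y0.
    apply/eqP; rewrite -subr_eq0; apply/eqP/nm_eq0.
    apply: ge0_small_eq0; first exact: nm_ge0.
    have [_ [M M0 hM]] := bC => e e1.
    have M1 : 0 < M + 1 by rewrite ltr_wpDl.
    have [n1 h1] := hx (e / 2 / (M + 1)) ltac:(by rewrite !divr_gt0).
    have [n2 h2] := @natSinv_le R (e / 2) ltac:(by rewrite divr_gt0).
    pose n := maxn n1 n2.
    rewrite (_ : C0 x - y0 = C0 (x - u n) - (y0 - C0 (u n))); last first.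
      by rewrite (bopB bC) opprB addrA subrK.
    rewrite (le_trans (nmD _ _))// nmN.
    have h3 := h1 n (leq_maxl _ _); have h4 := h2 n (leq_maxr _ _).
    have h5 : (M + 1) * nm (x - u n) <= e / 2 by rewrite mulrC -ler_pdivlMr.
    have := hM (x - u n); have := hu n; have := nm_ge0 (x - u n).
    move: h4; move: (n.+1%:R^-1 : R) => ?; lra.
  exists x; rewrite y0E; apply/esym/eqP; rewrite -subr_eq0; apply/eqP.
  apply: inj; rewrite (bop0 bC); apply: ip_ext => z.
  by rewrite -sC ip0r ipC /ip oy0//; exists z.
have /choice[B hB] := sur.
exists B; split => //; last by move=> x; apply: inj; rewrite hB.
split=> [a u v|]; first by apply: inj; rewrite hB bC.1 !hB.
exists c^-1; first by rewrite invr_ge0 ltW.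
by move=> x; rewrite ler_pdivlMl// -[in leRHS](hB x).
Qed.

Definition posop A := [/\ bop A, selfadj A & forall x, 0 <= ip (A x) x].

(** Off [[0, M]] the operator [A - t] is bounded below, hence invertible: by [- t] through the
    quadratic form if [t < 0], by [t - M] through the triangle inequality if [t > M]. *)
Lemma spectrum_pos A (M : R) : posop A -> (forall x, nm (A x) <= M * nm x) ->
  forall t : R, spectrum A t%:C%C -> 0 <= t <= M.
Proof.
move=> [bA sA pA] hM t st; apply: contrapT => ht; apply: st.
pose C0 x := A x - t%:C%C *: x.
have bC : bop C0.
  apply: bop_add => //; have -> : (fun x : H => - (t%:C%C *: x)) = (fun x => (- t)%:C%C *: x).
    by apply/funext => x; rewrite rmorphN scaleNr.
  by apply: bop_scale; exact: bop_id.
have sC : selfadj C0 by move=> x y; rewrite /C0 !ipE sA (ipC x y).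
have [c c0 hc] : exists2 c : R, 0 < c & forall x, c * nm x <= nm (C0 x).
  have [t0|t0] := ltP t 0.
    exists (- t); first by rewrite oppr_gt0.
    move=> x; have [->|x0] := eqVneq x 0; first by rewrite nm0 mulr0 nm_ge0.
    rewrite -(ler_pM2r (nm_gt0 x0)) (le_trans _ (ip_le _ _))//.
    by rewrite /C0 !ipE ipxx -mulrA -expr2 mulNr lerDr.
  have {ht} : M < t by rewrite ltNge; apply/negP => h; apply: ht; rewrite t0.
  move=> Mt; exists (t - M); first by rewrite subr_gt0.
  move=> x; have := nmD (- (C0 x)) (A x).
  rewrite /C0 opprB subrK nmZR ger0_norm// -opprB !nmN; have := hM x; lra.
have [B [bB h1 h2]] := selfadj_inverse bC sC c0 hc.
by exists B; split=> //; exact/bopP.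
Qed.

End Spectrum.

(** * Continuous functional calculus *)

Section Weierstrass.
Context {R : realType}.
Implicit Types (f : R -> R) (x y e M : R).

Lemma heine f M : {within `[0, M], continuous f} -> forall e, 0 < e ->
  exists2 d : R, 0 < d & forall x y, 0 <= x <= M -> 0 <= y <= M ->
    `|x - y| < d -> `|f x - f y| <= e.
Proof.
move=> cf e e0.
have /compact_near_coveringP cK := @segment_compact R 0 M.
pose P (d : R) x := 0 <= x <= M -> forall y, 0 <= y <= M -> `|x - y| < d -> `|f x - f y| <= e.
have : \forall d \near 0^'+, `[0, M]%classic `<=` P d.
  apply: cK => x xM.
  have /subspace_continuousP/(_ x xM)/cvgrPdist_le/(_ (e / 2) (divr_gt0 e0 (ltr0Sn _ _))) := cf.
  rewrite near_withinE => /nbhs_ballP[r /= r0 hr].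
  have r2 : 0 < r / 2 by rewrite divr_gt0.
  exists (ball x (r / 2), [set d | d < r / 2]).
    split=> /=; first exact: nbhsx_ballx.
    exact: nbhs_right_lt.
  move=> [x' d]/= [xx' dr] x'M y yM xy.
  have h1 : `|f x - f x'| <= e / 2.
    apply: hr; last by rewrite /= in_itv.
    by apply: le_ball xx'; rewrite ler_pdivrMr// ler_peMr ?(ltW r0)// ler1n.
  have h2 : `|f x - f y| <= e / 2.
    apply: hr; last by rewrite /= in_itv.
    rewrite /ball/=; move: xx'; rewrite /ball/= => xx'.
    rewrite (_ : x - y = (x - x') + (x' - y)); last by rewrite addrA subrK.
    by rewrite (le_lt_trans (ler_normD _ _))// [ltRHS]splitr ltrD// (lt_trans xy).
  rewrite (_ : f x' - f y = (f x - f y) - (f x - f x')); last by ring.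
  by rewrite (le_trans (ler_normB _ _))// [leRHS]splitr lerD.
move=> [d /= d0 hd]; exists (d / 2); first by rewrite divr_gt0.
have hd2 : `[0, M]%classic `<=` P (d / 2).
  apply: hd => /=; last by rewrite divr_gt0.
  by rewrite sub0r normrN gtr0_norm ?divr_gt0// ltr_pdivrMr// ltr_pMr// ltr1n.
by move=> x y xM yM xy; apply: (hd2 x) => //; rewrite /= in_itv.
Qed.

(* Bernstein operator: expectation of [g] under the binomial law with [n]
   trials and success probability ['X], computed by conditioning on the first
   trial. *)
Fixpoint bernstein n (g : nat -> R) : {poly R} :=
  if n is n'.+1 then
    (1 - 'X) * bernstein n' g + 'X * bernstein n' (fun k => g k.+1)
  else (g 0%N)%:P.

Lemma bernsteinS n g x : (bernstein n.+1 g).[x] =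
  (1 - x) * (bernstein n g).[x] + x * (bernstein n (fun k => g k.+1)).[x].
Proof. by rewrite /= !hornerE. Qed.

Lemma bernstein_le n (g h : nat -> R) x : 0 <= x <= 1 ->
  (forall k, (k <= n)%N -> g k <= h k) -> (bernstein n g).[x] <= (bernstein n h).[x].
Proof.
move=> /andP[x0 x1]; elim: n g h => [|n IH] g h gh; first by rewrite /= !hornerC gh.
rewrite !bernsteinS lerD// ler_wpM2l ?subr_ge0//.
- by apply: IH => k kn; apply: gh; rewrite ltnW.
- by apply: IH => k kn; apply: gh.
Qed.

(** Second moment of the binomial law about [a]: squared bias plus variance. Conditioning on the
    first trial only shifts [a] by one, which drives the induction. *)
Lemma bernstein_var n (a b c K : R) x :
  (bernstein n (fun k => c + K * (k%:R - a) ^+ 2)).[x] =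
  c + K * ((n%:R * x - a) ^+ 2 + n%:R * (x * (1 - x))).
Proof.
elim: n a => [|n IH] a; first by rewrite /= hornerC !mul0r addr0.
rewrite bernsteinS IH.
have -> : (fun k : nat => c + K * (k.+1%:R - a) ^+ 2) =
    (fun k : nat => c + K * (k%:R - (a - 1)) ^+ 2).
  by apply/funext => k; rewrite -natr1 opprB addrA addrAC.
by rewrite IH -natr1; ring.
Qed.

(** Chebyshev's argument: [|f y - f x| <= e / 2 + K (y - x)^2], and monotonicity of the Bernstein
    operator turns the quadratic term into a variance of order [1 / n]. *)
Lemma weierstrass01 f e : {within `[0, 1], continuous f} -> 0 < e ->
  exists q : {poly R}, forall x, 0 <= x <= 1 -> `|q.[x] - f x| <= e.
Proof.
move=> cf e0.
have [d d0 hd] := heine cf (divr_gt0 e0 (ltr0Sn _ 1)).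
have [F hF] : exists F : R, forall x, 0 <= x <= 1 -> `|f x| <= F.
  have [c _ hc] := EVT_max ler01 cf; have [c' _ hc'] := EVT_min ler01 cf.
  exists (`|f c| + `|f c'|) => x x01.
  have := hc x; have := hc' x; rewrite in_itv => /(_ x01) h1 /(_ x01) h2.
  have := ler_norm (f c); have := ler_norm (- f c'); rewrite normrN ler_norml.
  by have := normr_ge0 (f c); have := normr_ge0 (f c'); lra.
have F0 : 0 <= F by have := hF 0; rewrite lexx ler01 => /(_ isT); apply: le_trans.
(* With this [K], the quadratic term is at least the trivial bound [2 F] once [|y - x| >= d]. *)
pose K := 2 * F / d ^+ 2.
have K0 : 0 <= K by rewrite divr_ge0 ?mulr_ge0 ?exprn_ge0 ?(ltW d0).
have quad x y : 0 <= x <= 1 -> 0 <= y <= 1 -> `|f y - f x| <= e / 2 + K * (y - x) ^+ 2.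
  move=> x01 y01; have [h|h] := ltP `|y - x| d.
    by rewrite (le_trans (hd _ _ y01 x01 h))// lerDl mulr_ge0 ?sqr_ge0.
  apply: (@le_trans _ _ (2 * F)).
    by rewrite (le_trans (ler_normB _ _))// mulr2n mulrDl mul1r lerD ?hF.
  rewrite ler_wpDl ?(divr_ge0 (ltW e0))// /K mulrAC ler_pdivlMr ?exprn_gt0//.
  rewrite ler_wpM2l ?mulr_ge0//.
  by rewrite -[leRHS]real_normK ?num_real// ler_pXn2r ?nnegrE// (ltW d0).
have [n0 hn0] := @natSinv_le R (e / (2 * (K + 1))) ltac:(by rewrite divr_gt0 ?mulr_gt0// ltr_wpDl).
pose n := n0.+1; have n_gt0 : 0 < n%:R :> R by rewrite ltr0n.
exists (bernstein n (fun k => f (k%:R / n%:R))) => x x01.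
have kn01 (k : nat) : (k <= n)%N -> 0 <= (k%:R / n%:R : R) <= 1.
  by move=> kn; rewrite divr_ge0//= ler_pdivrMr// mul1r ler_nat.
pose K' := K / n%:R ^+ 2.
have KE k : K * (k%:R / n%:R - x) ^+ 2 = K' * (k%:R - n%:R * x) ^+ 2.
  by rewrite /K'; field; rewrite gt_eqF.
have small : K' * (n%:R * (x * (1 - x))) <= e / 2.
  have x1 : x * (1 - x) <= 1.
    by case/andP: x01 => x0 x1; rewrite mulr_ile1 ?subr_ge0// gerBl.
  have -> : K' * (n%:R * (x * (1 - x))) = (x * (1 - x)) * K * n%:R^-1.
    by rewrite /K'; field; rewrite gt_eqF.
  have x2 : 0 <= x * (1 - x) by case/andP: x01 => x0 x3; rewrite mulr_ge0 ?subr_ge0.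
  apply: (@le_trans _ _ (K * n%:R^-1)).
    by rewrite ler_wpM2r ?invr_ge0 ?(ltW n_gt0)// ler_piMl.
  apply: (@le_trans _ _ ((K + 1) * (e / (2 * (K + 1))))).
    by rewrite ler_pM ?invr_ge0 ?(ltW n_gt0) ?lerDl ?hn0.
  rewrite le_eqVlt; apply/orP; left; apply/eqP; field.
  by rewrite gt_eqF// ltr_wpDl.
have up : (bernstein n (fun k => f (k%:R / n%:R))).[x] <=
    (bernstein n (fun k => (f x + e / 2) + K' * (k%:R - n%:R * x) ^+ 2)).[x].
  apply: bernstein_le => // k kn; rewrite -KE.
  by have := quad _ _ x01 (kn01 k kn); rewrite ler_norml => /andP[_]; lra.
have lo : (bernstein n (fun k => (f x - e / 2) + (- K') * (k%:R - n%:R * x) ^+ 2)).[x] <=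
    (bernstein n (fun k => f (k%:R / n%:R))).[x].
  apply: bernstein_le => // k kn; rewrite mulNr -KE.
  by have := quad _ _ x01 (kn01 k kn); rewrite ler_norml => /andP[h _]; lra.
move: up lo; rewrite !bernstein_var ?subrr ?expr0n/= ?add0r//.
by move=> up lo; rewrite ler_norml; move: small; lra.
Qed.

Lemma weierstrass f M e : {within `[0, +oo[, continuous f} -> 0 < e ->
  exists q : {poly R}, forall x, 0 <= x <= M -> `|q.[x] - f x| <= e.
Proof.
move=> cf e0; pose N := `|M| + 1; have N0 : 0 < N by rewrite ltr_wpDl.
have cg : {within `[0, 1], continuous (fun x => f (N * x))}.
  apply/subspace_continuousP => x; rewrite /= in_itv/= => x01.
  have /subspace_continuousP/(_ (N * x)) := cf.
  rewrite /= in_itv/= andbT mulr_ge0 ?(ltW N0)//; last by case/andP: x01.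
  move=> /(_ isT)/cvgrPdist_le h; apply/cvgrPdist_le => r r0.
  have := h r r0; rewrite !near_withinE => hr.
  have cN : (fun t : R => N * t) @ x --> N * x by exact: mulrl_continuous.
  have {}hr := cN _ hr; near=> t; rewrite /= in_itv/= => /andP[t0 _].
  have ht : N * t \in `[0, +oo[ -> `|f (N * x) - f (N * t)| <= r.
    by near: t; exact: hr.
  by apply: ht; rewrite in_itv/= andbT mulr_ge0// ltW.
have [q hq] := weierstrass01 cg e0.
exists (q \Po (N^-1 *: 'X)) => x /andP[x0 xM].
rewrite horner_comp hornerZ hornerX.
have := hq (N^-1 * x); rewrite mulVKf ?gt_eqF//; apply.
rewrite mulr_ge0 ?invr_ge0 ?(ltW N0)//= ler_pdivrMl// mulr1 (le_trans xM)//.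
by rewrite (le_trans (ler_norm _))// lerDl.
Unshelve. all: by end_near. Qed.

End Weierstrass.

(** * Existence and algebraic rules of the functional calculus *)

Section FunctionalCalculus.
Context {R : realType} {H : hilbertType R}.
Implicit Types (A B X V : H -> H) (x y : H) (f g h : R -> R) (q : {poly R}).

Lemma opnorm_le X (m : R) : bop X -> 0 <= m ->
  (opnorm X <= m%:E)%E <-> (forall x, nm (X x) <= m * nm x).
Proof.
move=> bX m0; split=> [hX x|hX].
  have [->|x0] := eqVneq x 0; first by rewrite (bop0 bX) nm0 mulr0.
  have : ((nm (X ((nm x)^-1%:C%C *: x)))%:E <= m%:E)%E.
    apply: le_trans hX; apply: ereal_sup_ubound.
    by exists ((nm x)^-1%:C%C *: x) => //=; rewrite normE nm_normalize.
  rewrite lee_fin (bopZ bX) nmZR gtr0_norm ?invr_gt0 ?nm_gt0//.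
  by rewrite mulrC ler_pdivrMr// nm_gt0.
apply: ge_ereal_sup => _ [x /= x1 <-]; rewrite lee_fin.
rewrite normE -[1]/((1 : R)%:C%C) lecR in x1.
by rewrite (le_trans (hX x))// ler_piMr.
Qed.

Lemma opnorm_ge0 X : bop X -> (0 <= opnorm X)%E.
Proof.
move=> bX; apply: ereal_sup_ubound; exists 0 => /=; first by rewrite normr0 ler01.
by rewrite (bop0 bX) normr0.
Qed.

Lemma opnorm_cvg0 (X : nat -> H -> H) : (forall n, bop (X n)) ->
  (fun n => opnorm (X n)) @ \oo --> 0%E <->
  forall e : R, 0 < e -> exists n0 : nat, forall n, (n0 <= n)%N ->
    forall x, nm (X n x) <= e * nm x.
Proof.
move=> bX; split=> [cX e e0|hX].
  have /cX [n0 _ hn0] : nbhs (0%E : \bar R) [set y | (y < e%:E)%E].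
    by apply: (open_nbhs_nbhs); split => //; apply: open_ereal_lt_ereal.
  by exists n0 => n /hn0/= /ltW; rewrite opnorm_le// ltW.
have fin (e : R) n : 0 < e -> (forall x, nm (X n x) <= e * nm x) ->
    opnorm (X n) \is a fin_num /\ `|fine (opnorm (X n))| <= e.
  move=> e0 /(opnorm_le (bX n) (ltW e0)) h.
  have fn : opnorm (X n) \is a fin_num.
    by rewrite ge0_fin_numE ?opnorm_ge0// (le_lt_trans h)// ltry.
  by rewrite ger0_norm ?fine_ge0 ?opnorm_ge0// -lee_fin fineK.
apply/fine_cvgP; split.
  have [n0 hn0] := hX 1 ltr01.
  by exists n0 => // n /= /hn0 /(fin _ _ ltr01)[].
apply/cvgrPdist_le => e e0; have [n0 hn0] := hX e e0.
by exists n0 => // n /= /hn0 /(fin _ _ e0)[_]; rewrite sub0r normrN.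
Qed.

Lemma uniform_cvgP (D : set R) (u : nat -> R -> R) f :
  {uniform D, u @ \oo --> f} <->
  forall e : R, 0 < e -> exists n0 : nat, forall n, (n0 <= n)%N ->
    forall t, D t -> `|u n t - f t| <= e.
Proof.
split=> [cu e e0|hu].
  have [|n0 _ hn0] := cu [set h | forall t, D t -> `|h t - f t| <= e].
    apply/uniform_nbhs; exists [set xy | ball xy.1 e xy.2]; split.
      exact: (entourage_ball _ (PosNum e0)).
    by move=> h /= hh t Dt; rewrite distrC; apply/ltW/hh.
  by exists n0.
move=> P /uniform_nbhs[E [entE EP]].
move: entE; rewrite -entourage_ballE => -[e /= e0 he].
have [n0 hn0] := hu (e / 2) ltac:(by rewrite divr_gt0).
exists n0 => // n /= n0n; apply: EP => t Dt; apply: he => /=.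
rewrite /ball/= distrC (le_lt_trans (hn0 n n0n t Dt))//.
by rewrite ltr_pdivrMr// ltr_pMr// ltr1n.
Qed.

Lemma strong_limit (X : nat -> H -> H) (M : R) : (forall n, linear (X n)) -> 0 <= M ->
  (forall n x, nm (X n x) <= M * nm x) ->
  (forall x (e : R), 0 < e -> exists n0 : nat, forall n m, (n0 <= n)%N -> (n0 <= m)%N ->
    nm (X n x - X m x) <= e) ->
  exists B, [/\ bop B, forall x, nm (B x) <= M * nm x &
    forall x (e : R), 0 < e -> exists n0 : nat, forall n, (n0 <= n)%N ->
    nm (B x - X n x) <= e].
Proof.
move=> lX M0 hM hX.
have /choice[B hB] : forall x, exists l, forall e : R, 0 < e -> exists n0 : nat,
    forall n, (n0 <= n)%N -> nm (l - X n x) <= e.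
  by move=> x; apply: (hilbert_complete (u := X ^~ x)) => e /hX.
have BM x : nm (B x) <= M * nm x.
  apply/ler_addgt0Pr => e /(hB x)[n0 /(_ n0 (leqnn _)) h].
  rewrite -(subrK (X n0 x) (B x)) (le_trans (nmD _ _))// addrC lerD//.
exists B; split=> //; split; last by exists M.
move=> a u v; apply/eqP; rewrite -subr_eq0; apply/eqP/nm_eq0.
apply: ge0_small_eq0; first exact: nm_ge0.
move=> e e0; have a1 : 0 < Normc.normc a + 1 by rewrite ltr_wpDl ?normc_ge0.
have e3 : 0 < e / 3 by rewrite divr_gt0.
have [n1 h1] := hB (a *: u + v) _ e3.
have [n2 h2] := hB u _ (divr_gt0 e3 a1).
have [n3 h3] := hB v _ e3.
pose n := maxn n1 (maxn n2 n3).
have {}h1 := h1 n (leq_maxl _ _).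
have {}h2 : nm (B u - X n u) <= e / 3 / (Normc.normc a + 1).
  by apply: h2; rewrite /n maxnCA leq_maxl.
have {}h3 : nm (B v - X n v) <= e / 3 by apply: h3; rewrite /n maxnA leq_maxr.
have -> : B (a *: u + v) - (a *: B u + B v) =
    (B (a *: u + v) - X n (a *: u + v)) - (a *: (B u - X n u) + (B v - X n v)).
  rewrite lX scalerBr addrACA -opprD opprB addrA subrK//.
have h4 : Normc.normc a * nm (B u - X n u) <= e / 3.
  apply: (@le_trans _ _ ((Normc.normc a + 1) * nm (B u - X n u))).
    by rewrite ler_wpM2r ?nm_ge0// lerDl.
  by rewrite mulrC -ler_pdivlMr.
rewrite (le_trans (nmD _ _))// nmN.
have := nmD (a *: (B u - X n u)) (B v - X n v); rewrite nmZ; lra.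
Qed.

(** One polynomial per [e], close both on the spectrum and as an operator, replaces the sequence and
    the limits of [fun_calc]. *)
Definition is_fun_calc f A B := forall e : R, 0 < e -> exists q,
  (forall t : R, spectrum A t%:C%C -> `|q.[t] - f t| <= e) /\
  forall x, nm (rpop A q x - B x) <= e * nm x.

(** The approximating polynomial may be replaced by any other: [spectral_bound] controls the
    difference of the two. This makes the calculus independent of choices. *)
Lemma fun_calc_close f A B q (e : R) : bop A -> selfadj A -> is_fun_calc f A B -> 0 <= e ->
  (forall t : R, spectrum A t%:C%C -> `|q.[t] - f t| <= e) ->
  forall x, nm (rpop A q x - B x) <= e * nm x.
Proof.
move=> bA sA hB e0 hq x; apply/ler_addgt0Pr => d d0.
have x1 : 0 < 2 * nm x + 1 by rewrite ltr_wpDl// mulr_ge0 ?nm_ge0.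
have [p [hp hpB]] := hB _ (divr_gt0 d0 x1).
set c := d / _ in hp hpB.
have h1 : nm (rpop A (q - p) x) <= (e + c) * nm x.
  apply: spectral_bound => //; first by rewrite addr_ge0// divr_ge0// ltW.
  move=> t st; rewrite hornerD hornerN.
  rewrite (_ : q.[t] - p.[t] = (q.[t] - f t) - (p.[t] - f t)); last by ring.
  by rewrite (le_trans (ler_normB _ _))// lerD ?hq ?hp.
have h2 : (2 * nm x + 1) * c = d by rewrite /c mulrC divfK// gt_eqF.
rewrite (_ : rpop A q x - B x = rpop A (q - p) x + (rpop A p x - B x)); last first.
  by rewrite rpopB// addrA subrK.
rewrite (le_trans (nmD _ _))//; have := hpB x.
have c0 : 0 <= c by rewrite divr_ge0// ltW.
move: h1 h2; set u := nm x; lra.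
Qed.

Lemma rpop_ball A q (M : R) : posop A -> (forall x, nm (A x) <= M * nm x) ->
  forall m : R, 0 <= m -> (forall t, 0 <= t <= M -> `|q.[t]| <= m) ->
  forall x, nm (rpop A q x) <= m * nm x.
Proof.
move=> pA hM m m0 hq; have [bA sA _] := pA.
by apply: spectral_bound => // t st; apply: hq; exact: (spectrum_pos pA hM).
Qed.

(** Weierstrass polynomials on [[0, M]], which contains the spectrum, give a sequence of operators
    that is Cauchy in norm. *)
Lemma fun_calcP f A : {within `[0, +oo[, continuous f} -> posop A ->
  bop (fun_calc f A) /\ is_fun_calc f A (fun_calc f A).
Proof.
move=> cf pA; have [bA sA _] := pA; have [_ [M M0 hM]] := bA.
have n_gt0 n : 0 < n.+1%:R^-1 :> R by rewrite invr_gt0.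
have /choice[w hw] n := weierstrass M cf (n_gt0 n).
have hww n m x : nm (rpop A (w n) x - rpop A (w m) x) <= (n.+1%:R^-1 + m.+1%:R^-1) * nm x.
  rewrite -rpopB//; apply: (rpop_ball pA hM); first by rewrite addr_ge0.
  move=> t tM; rewrite hornerD hornerN.
  rewrite (_ : _ - _ = ((w n).[t] - f t) - ((w m).[t] - f t)); last by ring.
  by rewrite (le_trans (ler_normB _ _))// lerD ?hw.
have [B [bB _ hB]] : exists B, [/\ bop B, True &
    forall n x, nm (rpop A (w n) x - B x) <= n.+1%:R^-1 * nm x].
  have [_ [M' M'0 hM']] := bop_rpop bA (w 0%N).
  have [||||B [bB _ hB]] := @strong_limit (fun n => rpop A (w n)) (M' + 2).
  - by move=> n; have [] := bop_rpop bA (w n).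
  - by rewrite addr_ge0.
  - move=> n x; rewrite -(subrK (rpop A (w 0%N) x) (rpop A (w n) x)).
    rewrite (le_trans (nmD _ _))// mulrDl addrC lerD//.
    rewrite (le_trans (hww _ _ _))// ler_wpM2r ?nm_ge0//.
    rewrite invr1; have : n.+1%:R^-1 <= 1 :> R by rewrite invf_le1// ler1n.
    by move: (n.+1%:R^-1 : R) => ?; lra.
  - move=> x e e0; have x1 : 0 < 2 * (nm x + 1) by rewrite mulr_gt0// ltr_wpDl ?nm_ge0.
    have [n0 hn0] := natSinv_le (divr_gt0 e0 x1).
    exists n0 => n m /hn0 h1 /hn0 h2; rewrite (le_trans (hww _ _ _))//.
    apply: (@le_trans _ _ ((e / (nm x + 1)) * nm x)).
      rewrite ler_wpM2r ?nm_ge0//.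
      have -> : e / (nm x + 1) = e / (2 * (nm x + 1)) + e / (2 * (nm x + 1)).
        by field; rewrite gt_eqF// ltr_wpDl ?nm_ge0.
      exact: lerD.
    rewrite mulrAC ler_pdivrMr ?ltr_wpDl ?nm_ge0//.
    by rewrite ler_wpM2l ?(ltW e0)// lerDl.
  exists B; split=> // n x; apply/ler_addgt0Pr => e e0.
  have x1 : 0 < nm x + 1 by rewrite ltr_wpDl ?nm_ge0.
  have [n1 h1] := hB x (e / 2) ltac:(by rewrite divr_gt0).
  have [n2 h2] := natSinv_le (divr_gt0 (divr_gt0 e0 (ltr0Sn R 1)) x1).
  pose m := maxn n1 n2.
  rewrite (_ : _ - B x = (rpop A (w n) x - rpop A (w m) x) - (B x - rpop A (w m) x)); last first.
    by rewrite opprB addrA subrK.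
  rewrite (le_trans (nmD _ _))// nmN.
  have h3 := h1 m (leq_maxl _ _); have h4 := h2 m (leq_maxr _ _).
  have h5 := hww n m x.
  have h6 : m.+1%:R^-1 * nm x <= e / 2.
    apply: (@le_trans _ _ (m.+1%:R^-1 * (nm x + 1))).
      by rewrite ler_wpM2l ?(ltW (n_gt0 _))// lerDl.
    by rewrite -ler_pdivlMr.
  move: h3 h5 h6; rewrite mulrDl; clear.
  by move: (_ * nm x) (_ * nm x) => ? ?; lra.
have spM t : spectrum A t%:C%C -> 0 <= t <= M by exact: (spectrum_pos pA hM).
(* [B] serves only to exclude the default value; the chosen operator gets its properties from being
   admissible. *)
rewrite /fun_calc; case: xgetP => [B' _ [/bopP bB' [q [hq hqB]]]|hno]; last first.
  exfalso; apply: (hno B); split; first exact/bopP.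
  exists w; split.
    apply/uniform_cvgP => e e0; have [n0 hn0] := natSinv_le e0.
    by exists n0 => n /hn0 h t /spM tM; rewrite (le_trans (hw _ _ tM)).
  apply/opnorm_cvg0.
    move=> n; rewrite poly_opE; apply: bop_add; first exact: bop_rpop.
    exact: bop_opp.
  move=> e e0; have [n0 hn0] := natSinv_le e0.
  exists n0 => n /hn0 h x; rewrite poly_opE (le_trans (hB n x))//.
  by rewrite ler_wpM2r ?nm_ge0.
split=> // e e0.
have /uniform_cvgP/(_ e e0)[n1 h1] := hq.
have /opnorm_cvg0 hc : forall n, bop (poly_op (q n) A - B').
  move=> n; rewrite poly_opE; apply: bop_add; first exact: bop_rpop.
  exact: bop_opp.
have /hc/(_ e e0)[n2 h2] := hqB.
exists (q (maxn n1 n2)); split; first by apply: h1; rewrite leq_maxl.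
by move=> x; have := h2 _ (leq_maxr n1 n2) x; rewrite poly_opE.
Qed.

(** Closeness is asked on the whole interval [[0, M]], so that one polynomial can serve several
    operators or functions at once. *)
Lemma fc_near f A q (M e : R) : {within `[0, +oo[, continuous f} -> posop A ->
  (forall x, nm (A x) <= M * nm x) -> 0 <= e ->
  (forall t, 0 <= t <= M -> `|q.[t] - f t| <= e) ->
  forall x, nm (rpop A q x - fun_calc f A x) <= e * nm x.
Proof.
move=> cf pA hM e0 hq; have [bA sA _] := pA.
have [_ hfc] := fun_calcP cf pA.
by apply: (fun_calc_close bA sA hfc e0) => t st; exact: (hq _ (spectrum_pos pA hM st)).
Qed.

Lemma bop_fc f A : {within `[0, +oo[, continuous f} -> posop A -> bop (fun_calc f A).
Proof. by move=> cf pA; have [] := fun_calcP cf pA. Qed.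

Lemma posop_bound2 A A' : posop A -> posop A' -> exists2 M : R, 0 <= M &
  forall x, nm (A x) <= M * nm x /\ nm (A' x) <= M * nm x.
Proof.
move=> [[_ [M M0 hM]] _ _] [[_ [N N0 hN]] _ _].
exists (M + N); first exact: addr_ge0.
by move=> x; rewrite mulrDl; split; [rewrite ler_wpDr ?mulr_ge0 ?nm_ge0|rewrite ler_wpDl ?mulr_ge0 ?nm_ge0].
Qed.

Lemma fc_approx f A A' : {within `[0, +oo[, continuous f} -> posop A -> posop A' ->
  forall e : R, 0 < e -> exists q,
  (forall x, nm (rpop A q x - fun_calc f A x) <= e * nm x) /\
  (forall x, nm (rpop A' q x - fun_calc f A' x) <= e * nm x).
Proof.
move=> cf pA pA' e e0; have [M M0 hM] := posop_bound2 pA pA'.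
have [q hq] := weierstrass M cf e0.
exists q; split; apply: (fc_near cf _ _ (ltW e0) hq) => //.
- by move=> x; have [] := hM x.
- by move=> x; have [] := hM x.
Qed.

Lemma eq_of_nm_le (c : R) x y : (forall e : R, 0 < e -> nm (x - y) <= e * c) -> x = y.
Proof.
move=> h; apply/eqP; rewrite -subr_eq0; apply/eqP/nm_eq0.
apply: ge0_small_eq0; first exact: nm_ge0.
move=> e e0; have c1 : 0 < `|c| + 1 by rewrite ltr_wpDl.
rewrite (le_trans (h _ (divr_gt0 e0 c1)))// mulrAC ler_pdivrMr//.
by rewrite ler_wpM2l ?(ltW e0)// (le_trans (ler_norm _))// lerDl.
Qed.

(** Clear for polynomials; a common approximating polynomial for [A] and [A'] carries it to the
    limit. *)
Lemma fc_intertwine f A A' V : {within `[0, +oo[, continuous f} -> posop A -> posop A' ->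
  bop V -> (forall x, V (A x) = A' (V x)) ->
  forall x, V (fun_calc f A x) = fun_calc f A' (V x).
Proof.
move=> cf pA pA' bV VA x; have [_ [M M0 hM]] := bV.
have [bA _ _] := pA; have [bA' _ _] := pA'.
apply: (@eq_of_nm_le (M * nm x + nm (V x))) => e e0.
have [q [h1 h2]] := fc_approx cf pA pA' e0.
have Vq y : V (rpop A q y) = rpop A' q (V y).
  elim/poly_ind: q y {h1 h2} => [|q c IH] y.
    by rewrite -polyC0 !rpopC !scale0r (bop0 bV).
  rewrite !rpopD !rpopC (bopD bV) (bopZ bV) [q * 'X]mulrC !rpopM// !rpopX//.
  by rewrite VA IH.
rewrite (_ : _ - _ = (rpop A' q (V x) - fun_calc f A' (V x)) -
    V (rpop A q x - fun_calc f A x)); last first.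
  by rewrite (bopB bV) Vq opprB [RHS]addrC addrA subrK.
rewrite (le_trans (nmD _ _))// nmN mulrDr addrC lerD//.
by rewrite (le_trans (hM _))// mulrCA ler_wpM2l.
Qed.

Lemma selfadj_fc f A : {within `[0, +oo[, continuous f} -> posop A -> selfadj (fun_calc f A).
Proof.
move=> cf pA x y; have [bA sA _] := pA; apply/eqP; rewrite -subr_eq0; apply/eqP.
apply/normr0_eq0; apply: ge0_small_eq0 => // e e0.
have c0 : 0 < 2 * (nm x * nm y) + 1 by rewrite ltr_wpDl ?mulr_ge0 ?nm_ge0.
have [q [hq _]] := fc_approx cf pA pA (divr_gt0 e0 c0).
set d := e / _ in hq; set F := fun_calc f A in hq *.
rewrite (_ : _ - _ = ip x (rpop A q y - F y) - ip (rpop A q x - F x) y); last first.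
  by rewrite !ipE (selfadj_rpop bA q sA x y); ring.
rewrite (le_trans (ler_normB _ _))//.
have h1 := ip_abs x (rpop A q y - F y); have h2 := ip_abs (rpop A q x - F x) y.
have h3 := ler_wpM2l (nm_ge0 x) (hq y); have h4 := ler_wpM2r (nm_ge0 y) (hq x).
have h5 : d * (2 * (nm x * nm y) + 1) = e by rewrite /d divfK// gt_eqF.
have d0 : 0 <= d by rewrite divr_ge0// ltW.
by move: h1 h2 h3 h4 h5; rewrite mulrDr mulr1; lra.
Qed.

Lemma fc_poly f q A : {within `[0, +oo[, continuous f} -> posop A ->
  (forall t, 0 <= t -> f t = q.[t]) -> forall x, fun_calc f A x = rpop A q x.
Proof.
move=> cf pA fq x; have [[_ [M M0 hM]] _ _] := pA.
apply: (@eq_of_nm_le (nm x)) => e e0; rewrite nm_distC.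
apply: (fc_near cf pA hM (ltW e0)) => t /andP[t0 _].
by rewrite fq// subrr normr0 ltW.
Qed.

Lemma fc_id f A : {within `[0, +oo[, continuous f} -> posop A ->
  (forall t, 0 <= t -> f t = t) -> forall x, fun_calc f A x = A x.
Proof.
move=> cf pA fq x; have [bA _ _] := pA.
by rewrite (fc_poly (q := 'X) cf pA) ?rpopX// => t t0; rewrite hornerX fq.
Qed.

(** Serves to subtract a tangent line from a power function inside the calculus. *)
Lemma fc_add_poly f h q A : {within `[0, +oo[, continuous f} ->
  {within `[0, +oo[, continuous h} -> posop A ->
  (forall t, 0 <= t -> h t = f t + q.[t]) ->
  forall x, fun_calc h A x = fun_calc f A x + rpop A q x.
Proof.
move=> cf ch pA hf x; have [[_ [M M0 hM]] _ _] := pA.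
apply: (@eq_of_nm_le (2 * nm x)) => e e0.
have [p hp] := weierstrass M cf e0.
have h1 := fc_near cf pA hM (ltW e0) hp x.
have h2 : nm (rpop A (p + q) x - fun_calc h A x) <= e * nm x.
  apply: (fc_near ch pA hM (ltW e0)) => t tM; rewrite hf; last by case/andP: tM.
  by rewrite hornerD opprD addrACA subrr addr0 hp.
rewrite (_ : _ - _ = (rpop A p x - fun_calc f A x) - (rpop A (p + q) x - fun_calc h A x)).
  by rewrite (le_trans (nmD _ _))// nmN; lra.
rewrite rpopD opprB [RHS]addrC -addrA; congr (_ + _).
by rewrite !opprD addrACA addNr add0r addrC.
Qed.

Lemma continuous_bounded f (M : R) : {within `[0, +oo[, continuous f} ->
  exists2 F : R, 0 <= F & forall t, 0 <= t <= M -> `|f t| <= F.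
Proof.
move=> cf; have [q hq] := weierstrass M cf ltr01.
pose F := \sum_(i < size q) `|q`_i| * `|M| ^+ i + 1.
exists F; first by rewrite addr_ge0// sumr_ge0// => i _; rewrite mulr_ge0 ?exprn_ge0.
move=> t tM; rewrite -(subrK q.[t] (f t)) addrC (le_trans (ler_normD _ _))// lerD//; last first.
  by rewrite distrC hq.
rewrite horner_coef (le_trans (ler_norm_sum _ _ _))// ler_sum// => i _.
rewrite normrM ler_wpM2l// normrX lerXn2r ?nnegrE//.
by case/andP: tM => t0 tM; rewrite ger0_norm// (le_trans tM)// ler_norm.
Qed.

Lemma fc_mul f g h A : {within `[0, +oo[, continuous f} ->
  {within `[0, +oo[, continuous g} -> {within `[0, +oo[, continuous h} -> posop A ->
  (forall t, 0 <= t -> f t * g t = h t) ->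
  forall x, fun_calc f A (fun_calc g A x) = fun_calc h A x.
Proof.
move=> cf cg ch pA fg x; have [bA [_ [M M0 hM]] _] : [/\ bop A, bop A & True] by case: pA.
have [F F0 hF] := continuous_bounded M cf; have [G G0 hG] := continuous_bounded M cg.
have [_ [N N0 hN]] := bop_fc cf pA; have [_ [N' N'0 hN']] := bop_fc cg pA.
(* Restricting to [e <= 1] lets the term in [e^2] be absorbed into the linear ones. *)
suff key (e : R) : 0 < e -> e <= 1 ->
    nm (fun_calc f A (fun_calc g A x) - fun_calc h A x) <= e * (((N + N' + 1) + (F + G + 1)) * nm x).
  apply: (@eq_of_nm_le (((N + N' + 1) + (F + G + 1)) * nm x)) => e e0.
  have [e1|/ltW e1] := leP e 1; first exact: key.
  apply: le_trans (key 1 ltr01 (lexx _)) _; rewrite ler_wpM2r// mulr_ge0 ?nm_ge0//.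
  by rewrite !addr_ge0.
move=> e0 e1.
have [q hq] := weierstrass M cf e0; have [r hr] := weierstrass M cg e0.
have hqA := fc_near cf pA hM (ltW e0) hq; have hrA := fc_near cg pA hM (ltW e0) hr.
have h1 : nm (rpop A (q * r) x - fun_calc h A x) <= (e * (F + G + 1)) * nm x.
  apply: (fc_near ch pA hM); first by rewrite mulr_ge0 ?(ltW e0)// !addr_ge0.
  move=> t tM; rewrite hornerM -fg; last by case/andP: tM.
  rewrite (_ : _ - _ = (q.[t] - f t) * (r.[t] - g t) + f t * (r.[t] - g t) + (q.[t] - f t) * g t).
    rewrite (le_trans (ler_normD _ _))//.
    have := ler_normD ((q.[t] - f t) * (r.[t] - g t)) (f t * (r.[t] - g t)).
    rewrite !normrM.
    have h2 := ler_pM (normr_ge0 _) (normr_ge0 _) (hq t tM) (hr t tM).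
    have h3 := ler_pM (normr_ge0 _) (normr_ge0 _) (hF t tM) (hr t tM).
    have h4 := ler_pM (normr_ge0 _) (normr_ge0 _) (hq t tM) (hG t tM).
    have h5 : e * e <= e by rewrite ler_piMr// ltW.
    rewrite !mulrDr; lra.
  by ring.
rewrite rpopM// in h1.
have h2 : nm (rpop A q (rpop A r x) - fun_calc f A (rpop A r x)) <= e * ((N' + 1) * nm x).
  rewrite (le_trans (hqA _))// ler_wpM2l ?(ltW e0)//.
  rewrite -(subrK (fun_calc g A x) (rpop A r x)) (le_trans (nmD _ _))//.
  have := hrA x; have := hN' x; have := ler_wpM2r (nm_ge0 x) e1; lra.
have h3 : nm (fun_calc f A (rpop A r x - fun_calc g A x)) <= N * (e * nm x).
  by rewrite (le_trans (hN _))// ler_wpM2l.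
rewrite (bopB (bop_fc cf pA)) in h3.
rewrite -nmN opprB.
set a := fun_calc h A x in h1 *; set b := rpop A q _ in h1 h2; set c := fun_calc f A (rpop A r x) in h2 h3.
set d := fun_calc f A _ in h3 *.
rewrite (_ : a - d = (b - c) + (c - d) - (b - a)); last first.
  by rewrite addrA subrK opprB [RHS]addrC addrA subrK.
rewrite (le_trans (nmD _ _))// nmN; have := nmD (b - c) (c - d); lra.
Qed.

End FunctionalCalculus.

(** * Absolute value and polar decomposition *)

Section PositiveOperators.
Context {R : realType} {H : hilbertType R}.
Implicit Types (A B X V P : H -> H) (x y : H) (f g h : R -> R) (r m t : R).

Lemma itv0y t : `[0, +oo[%classic t = (0 <= t).
Proof. by rewrite /= in_itv/= andbT. Qed.

Lemma within_continuousP f (A : set R) : {within A, continuous f} <->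
  forall x : R, A x -> f y @[y --> within A (nbhs x)] --> f x.
Proof. exact: subspace_continuousP. Qed.

Lemma continuous_nnegP f : {within `[0, +oo[, continuous f} <->
  forall x : R, 0 <= x -> forall e : R, 0 < e ->
    \forall t \near x, 0 <= t -> `|f x - f t| <= e.
Proof.
split=> [/within_continuousP cf x x0 e e0|cf].
  have /cvgrPdist_le/(_ e e0) := cf x ltac:(by rewrite itv0y).
  by rewrite near_withinE; apply: filterS => t /= + t0; apply; rewrite in_itv/= t0.
apply/within_continuousP => x; rewrite itv0y => x0.
apply/cvgrPdist_le => e e0; rewrite near_withinE; apply: filterS (cf x x0 e e0).
by move=> t + /=; rewrite in_itv/= andbT => + t0; apply.
Qed.

Lemma continuous_sqrt_comp f : {within `[0, +oo[, continuous f} ->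
  {within `[0, +oo[, continuous (fun t => Num.sqrt (f t))}.
Proof.
move=> /within_continuousP cf; apply/within_continuousP => x x0.
apply: (continuous_cvg _ _ (cf x x0)); exact: sqrt_continuous.
Qed.

Lemma continuous_sqrt_nneg : {within `[0, +oo[, continuous (@Num.sqrt R)}.
Proof. by apply: continuous_subspaceT => x; exact: sqrt_continuous. Qed.

Lemma continuous_horner_nneg (q : {poly R}) :
  {within `[0, +oo[, continuous (fun t => q.[t])}.
Proof. by apply: continuous_subspaceT => x; exact: continuous_horner. Qed.

Lemma continuousD_nneg f g : {within `[0, +oo[, continuous f} ->
  {within `[0, +oo[, continuous g} ->
  {within `[0, +oo[, continuous (fun t => f t + g t)}.
Proof.
move=> /within_continuousP cf /within_continuousP cg.
by apply/within_continuousP => x x0; exact: (cvgD (cf x x0) (cg x x0)).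
Qed.

Lemma continuous_powR_nneg r : 1 <= r -> {within `[0, +oo[, continuous (fun t => t `^ r)}.
Proof.
move=> r1; have r0 : r != 0 by rewrite gt_eqF// (lt_le_trans ltr01).
(* At [0] the bound [t^r <= t] for [t <= 1] is used; elsewhere [t^r] is [exp (r ln t)]. *)
apply/continuous_nnegP => x; rewrite le_eqVlt => /predU1P[<- e e0|x0 e e0].
  have d0 : 0 < Num.min e 1 by rewrite lt_min e0 ltr01.
  apply/nbhs_ballP; exists (Num.min e 1) => //= t; rewrite /ball/= sub0r normrN => ht t0.
  move: ht; rewrite ger0_norm// lt_min => /andP[te /ltW t1].
  rewrite powR0// sub0r normrN ger0_norm ?powR_ge0//.
  rewrite (le_trans _ (ltW te))//.
  have [<-|tn0] := eqVneq 0 t; first by rewrite powR0.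
  have t_gt0 : 0 < t by rewrite lt_neqAle tn0.
  by rewrite -[leRHS]powRr1// ger_powR// t_gt0.
have cx : (fun t : R => expR (r * ln t)) @ x --> expR (r * ln x).
  apply: (continuous_cvg _ (@continuous_expR R _)).
  by apply: cvgMl_tmp; exact: continuous_ln.
move/cvgrPdist_le/(_ e e0) : cx => cx; near=> t => _.
have t0 : 0 < t by near: t; exact: lt_nbhsr.
rewrite /powR !gt_eqF//.
by near: t.
Unshelve. all: by end_near. Qed.

Lemma posop_sqr_ge0 X : bop X -> selfadj X -> forall x, ip (X (X x)) x = nm (X x) ^+ 2.
Proof. by move=> bX sX x; rewrite sX ipxx. Qed.

(** [f] is the square of [sqrt f] on [[0, +oo[], so the quadratic form of [f(A)] at [x] is the
    squared norm of [(sqrt f)(A) x]. *)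
Lemma posop_fc f A : {within `[0, +oo[, continuous f} -> (forall t, 0 <= t -> 0 <= f t) ->
  posop A -> posop (fun_calc f A).
Proof.
move=> cf f0 pA; split; [exact: bop_fc|exact: selfadj_fc|move=> x].
have cs := continuous_sqrt_comp cf.
rewrite -(fc_mul cs cs cf pA) ?posop_sqr_ge0 ?sqr_ge0//; [exact: bop_fc|exact: selfadj_fc|].
by move=> t t0; rewrite -expr2 sqr_sqrtr ?f0.
Qed.

Lemma posop_sqrt A : posop A -> exists Q, [/\ bop Q, selfadj Q & forall x, Q (Q x) = A x].
Proof.
move=> pA; have cs := continuous_sqrt_nneg; exists (fun_calc Num.sqrt A).
split; [exact: bop_fc|exact: selfadj_fc|move=> x].
rewrite (fc_mul cs cs (@continuous_horner_nneg 'X) pA); last first.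
  by move=> t t0; rewrite -expr2 sqr_sqrtr ?hornerX.
by rewrite (fc_id (@continuous_horner_nneg 'X) pA)// => t _; rewrite hornerX.
Qed.

(** Cauchy-Schwarz for the form of [A], in its arithmetic-mean version: expand the form at [x + y]
    and [x - y]. *)
Lemma posop_cs A x y : posop A -> `|ip (A x) y| <= (ip (A x) x + ip (A y) y) / 2.
Proof.
move=> [bA sA pA]; have := pA (x + y); have := pA (x - y).
rewrite !(bopD bA) (bopN bA) !ipE (sA y x) (ipC y (A x)) ler_norml.
by move=> h1 h2; apply/andP; split; lra.
Qed.

Lemma adjK X : bop X -> adjoint (adjoint X) = X.
Proof.
by move=> bX; apply: adj_uniq; [exact: bop_adj|exact: ip_adjl].
Qed.

Lemma posop_gram X : bop X -> posop (adjoint X \o X).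
Proof.
move=> bX; split; first by apply: bop_comp => //; exact: bop_adj.
  by move=> x y /=; rewrite ip_adjl// ip_adj.
by move=> x /=; rewrite ip_adjl// ip_ge0.
Qed.

Lemma posop_abs X : bop X -> posop (abs_op X).
Proof.
move=> bX; apply: posop_fc; [exact: continuous_sqrt_nneg|by move=> t _; exact: sqrtr_ge0|].
exact: posop_gram.
Qed.

Lemma abs_opK X x : bop X -> abs_op X (abs_op X x) = adjoint X (X x).
Proof.
move=> bX; have cs := continuous_sqrt_nneg; have pX := posop_gram bX.
rewrite /abs_op (fc_mul cs cs (@continuous_horner_nneg 'X) pX); last first.
  by move=> t t0; rewrite -expr2 sqr_sqrtr ?hornerX.
by rewrite (fc_id (@continuous_horner_nneg 'X) pX)// => t _; rewrite hornerX.
Qed.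

Lemma nm_abs X x : bop X -> nm (abs_op X x) = nm (X x).
Proof.
move=> bX; have [bA sA _] := posop_abs bX.
apply/eqP; rewrite -(@eqrXn2 _ 2) ?nm_ge0// -posop_sqr_ge0// abs_opK//.
by rewrite ip_adjl// ipxx.
Qed.

Lemma abs_intertwine X : bop X -> forall x, X (abs_op X x) = abs_op (adjoint X) (X x).
Proof.
move=> bX; have bX' := bop_adj bX; apply: fc_intertwine => //.
- exact: continuous_sqrt_nneg.
- exact: posop_gram.
- exact: posop_gram.
- by move=> x /=; rewrite adjK.
Qed.

(** [V] is the strong limit of [X (|X| + ep)^-1] as [ep] tends to 0. These operators are
    contractions, and they commute with the calculus up to intertwining, so both properties pass to
    [V]. *)
Lemma polar_decomposition X : bop X -> exists V,
  [/\ bop V, forall x, nm (V x) <= nm x, forall x, V (abs_op X x) = X x &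
   forall f, {within `[0, +oo[, continuous f} -> forall x,
     V (fun_calc f (abs_op X) x) = fun_calc f (abs_op (adjoint X)) (V x)].
Proof.
move=> bX; have pA := posop_abs bX; have [bA sA posA] := pA.
have pA' := posop_abs (bop_adj bX).
set A := abs_op X in pA bA sA posA *.
pose ep n : R := n.+1%:R^-1; have ep0 n : 0 < ep n by rewrite invr_gt0.
pose C n x : H := A x + (ep n)%:C%C *: x.
have bC n : bop (C n) by apply: bop_add => //; apply: bop_scale; exact: bop_id.
have sC n : selfadj (C n) by move=> x y; rewrite /C !ipE sA (ipC x y).
have C2 n x : nm (C n x) ^+ 2 = nm (A x) ^+ 2 + 2 * ep n * ip (A x) x + (ep n * nm x) ^+ 2.
  by rewrite /C nmD2 ipZrR nmZR (ger0_norm (ltW (ep0 n))) mulrA.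
have CA n x : nm (A x) <= nm (C n x).
  rewrite -(@ler_pXn2r _ 2)// ?nnegrE ?nm_ge0// C2 -addrA lerDl.
  by rewrite addr_ge0 ?sqr_ge0 ?mulr_ge0 ?posA ?(ltW (ep0 n)).
have Cep n x : ep n * nm x <= nm (C n x).
  rewrite -(@ler_pXn2r _ 2)// ?nnegrE ?mulr_ge0 ?nm_ge0 ?(ltW (ep0 n))// C2 lerDr.
  by rewrite addr_ge0 ?sqr_ge0 ?mulr_ge0 ?posA ?(ltW (ep0 n)).
have /choice[S /all_and3[bS SC CS]] : forall n, exists B,
    [/\ bop B, forall x, B (C n x) = x & forall x, C n (B x) = x].
  by move=> n; exact: (selfadj_inverse (bC n) (sC n) (ep0 n) (Cep n)).
have SA n x : S n (A x) = A (S n x).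
  rewrite -[in RHS](SC n (A (S n x))); congr (S n _).
  by rewrite /C -(bopZ bA) -(bopD bA) -/(C n (S n x)) CS.
pose V n x := X (S n x).
have bV n : bop (V n) by apply: bop_comp.
have V1 n x : nm (V n x) <= nm x.
  by rewrite /V -nm_abs// (le_trans (CA n _))// CS.
have VA n y : nm (V n (A y) - X y) <= ep n * nm y.
  have -> : V n (A y) - X y = - ((ep n)%:C%C *: X (S n y)).
    rewrite /V -(bopB bX) -(bopZ bX) -(bopN bX); congr (X _).
    rewrite -{2}(CS n y) /C SA -opprB; congr (- _).
    by rewrite addrAC subrr add0r.
  rewrite nmN nmZR (ger0_norm (ltW (ep0 n))) ler_wpM2l ?(ltW (ep0 n))//.
  exact: V1.
have V0 n z : A z = 0 -> V n z = 0.
  move=> Az; apply: nm_eq0; rewrite /V -nm_abs// -/A -SA Az (bop0 (bS n)) nm0//.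
have [||||W [bW W1 hW]] := @strong_limit _ _ V 1.
- by move=> n; have [] := bV n.
- exact: ler01.
- by move=> n x; rewrite mul1r.
- move=> x e e0; pose L := range A.
  have L0 : L 0 by exists 0 => //; exact: bop0.
  have LP a u v : L u -> L v -> L (a *: u + v).
    by move=> [u' _ <-] [v' _ <-]; exists (a *: u' + v') => //; exact: bA.1.
  have [y0 [hy0 oy0]] := projection L0 LP x.
  have Az : A (x - y0) = 0.
    by apply: ip_ext => z; rewrite -sA ipC /ip oy0 ?linear0r//; exists z.
  have e4 : 0 < e / 4 by rewrite divr_gt0.
  have [_ [v _ <-] hv] := hy0 _ e4.
  have v1 : 0 < nm v + 1 by rewrite ltr_wpDl ?nm_ge0.
  have [n0 hn0] := natSinv_le (divr_gt0 e4 v1).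
  (* [x] is split as [(x - y0) + (y0 - A v) + A v]: [V n] kills the first part, which lies in the
     kernel of [A], the second is small, and [V n (A v)] tends to [X v]. *)
  have Vx n : V n x = V n (y0 - A v) + V n (A v).
    by rewrite -(bopD (bV n)) subrK -[in LHS](subrK y0 x) (bopD (bV n)) V0// add0r.
  have small n : (n0 <= n)%N -> nm (V n (A v) - X v) <= e / 4.
    move=> /hn0 h; rewrite (le_trans (VA n v))//.
    apply: (@le_trans _ _ (ep n * (nm v + 1))); first by rewrite ler_wpM2l ?(ltW (ep0 n))// lerDl.
    by rewrite -ler_pdivlMr.
  exists n0 => n k n0n n0k; rewrite !Vx.
  set a := V n (y0 - A v); set b := V k (y0 - A v); set c := V n (A v); set d := V k (A v).
  have -> : a + c - (b + d) = (a - b) + ((c - X v) - (d - X v)).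
    by rewrite opprB [c - _ + _]addrA subrK opprD addrACA.
  rewrite (le_trans (nmD _ _))//.
  have h1 : nm (a - b) <= e / 4 + e / 4.
    by rewrite (le_trans (nmD _ _))// nmN lerD// (le_trans (V1 _ _)).
  have h2 : nm ((c - X v) - (d - X v)) <= e / 4 + e / 4.
    by rewrite (le_trans (nmD _ _))// nmN lerD// small.
  lra.
exists W; split=> //.
- by move=> x; rewrite -[leRHS]mul1r.
- move=> x; apply: (@eq_of_nm_le _ _ (1 + nm x)) => e e0.
  have [n1 h1] := hW (A x) e e0; have [n2 h2] := natSinv_le e0.
  pose n := maxn n1 n2.
  have {}h1 := h1 n (leq_maxl _ _); have {}h2 := h2 n (leq_maxr _ _).
  rewrite (_ : W (A x) - X x = (W (A x) - V n (A x)) + (V n (A x) - X x)); last first.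
    by rewrite addrA subrK.
  rewrite (le_trans (nmD _ _))// mulrDr mulr1 lerD//.
  by rewrite (le_trans (VA n x))// ler_wpM2r ?nm_ge0.
- move=> f cf x; have bf := bop_fc cf pA; have [_ [M M0 hM]] := bop_fc cf pA'.
  have Vf n : V n (fun_calc f A x) = fun_calc f (abs_op (adjoint X)) (V n x).
    rewrite /V (fc_intertwine cf pA pA (bS n) (SA n)).
    by rewrite (fc_intertwine cf pA pA' bX (abs_intertwine bX)).
  apply: (@eq_of_nm_le _ _ (1 + M)) => e e0.
  have [n1 h1] := hW (fun_calc f A x) e e0; have [n2 h2] := hW x e e0.
  pose n := maxn n1 n2.
  have {}h1 := h1 n (leq_maxl _ _); have {}h2 := h2 n (leq_maxr _ _).
  set F := fun_calc f (abs_op (adjoint X)) in Vf hM *.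
  have bF : bop F := bop_fc cf pA'.
  rewrite (_ : _ - _ = (W (fun_calc f A x) - V n (fun_calc f A x)) - F (W x - V n x)); last first.
    by rewrite (bopB bF) Vf opprB addrA subrK.
  rewrite (le_trans (nmD _ _))// nmN mulrDr mulr1 lerD//.
  by rewrite (le_trans (hM _))// [leRHS]mulrC ler_wpM2l.
Qed.

(* [W] is the adjoint of the partial isometry [V] of the polar decomposition. *)
Lemma polar X : bop X -> exists V W,
  [/\ bop V, bop W, (forall x, nm (V x) <= nm x) /\ (forall x, nm (W x) <= nm x) &
  [/\ forall x y, ip (V x) y = ip x (W y), forall x, V (abs_op X x) = X x,
   forall f, {within `[0, +oo[, continuous f} -> forall x,
     V (fun_calc f (abs_op X) x) = fun_calc f (abs_op (adjoint X)) (V x) &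
   forall x, adjoint X x = W (X (W x))]].
Proof.
move=> bX; have [V [bV V1 VA Vf]] := polar_decomposition bX.
have bW := bop_adj bV; set W := adjoint V in bW.
have VW x y : ip (V x) y = ip x (W y) by rewrite ip_adj.
have W1 x : nm (W x) <= nm x.
  have [->|x0] := eqVneq (W x) 0; first by rewrite nm0 nm_ge0.
  rewrite -(ler_pM2l (nm_gt0 x0)) -expr2 -ipxx -VW (le_trans (ip_le _ _))//.
  by rewrite ler_wpM2r ?nm_ge0.
have [bA sA _] := posop_abs bX.
(* [V] is isometric on the range of [|X|] and [W] is a contraction, so expanding [|W (V u) - u|^2]
   leaves at most 0. *)
have WX z : W (X z) = abs_op X z.
  rewrite -VA; set u := abs_op X z.
  have Vu : nm (V u) = nm u by rewrite /u VA nm_abs.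
  apply/eqP; rewrite -subr_eq0; apply/eqP/nm_eq0/eqP.
  rewrite -sqrf_eq0 eq_le sqr_ge0 andbT nmB2 ipC -VW ipxx Vu.
  have : nm (W (V u)) ^+ 2 <= nm u ^+ 2.
    by rewrite ler_pXn2r// ?nnegrE ?nm_ge0// (le_trans (W1 _)) ?Vu.
  lra.
exists V, W; split=> //; split=> // x.
rewrite WX; have -> // : adjoint X = (fun x => abs_op X (W x)).
apply: adj_uniq => // a b; by rewrite -VA VW sA.
Qed.

End PositiveOperators.

(** * Orthonormal bases, compact operators and the trace *)

Section OrthonormalFamilies.
Context {R : realType} {H : hilbertType R}.
Implicit Types (x y z : H) (E : set H).

Lemma inner_suml (I : Type) (r : seq I) (F : I -> H) y :
  inner (\sum_(i <- r) F i) y = \sum_(i <- r) inner (F i) y.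
Proof. by apply: (big_morph (fun x => inner x y)) => [u v|]; rewrite ?linearDl ?linear0l. Qed.

Lemma ip_sumr (I : Type) (r : seq I) (F : I -> H) y :
  ip y (\sum_(i <- r) F i) = \sum_(i <- r) ip y (F i).
Proof. by apply: (big_morph (ip y)) => [u v|]; rewrite ?ipDr ?ip0r. Qed.

Lemma ip_suml (I : Type) (r : seq I) (F : I -> H) y :
  ip (\sum_(i <- r) F i) y = \sum_(i <- r) ip (F i) y.
Proof. by rewrite ipC ip_sumr; apply: eq_bigr => i _; rewrite ipC. Qed.

Lemma inner_Zl (a : R[i]) x y : inner (a *: x) y = a * inner x y.
Proof. exact: linearZl. Qed.

Lemma inner_Zr (a : R[i]) x y : inner x (a *: y) = conjc a * inner x y.
Proof. by rewrite -conjE linearZr. Qed.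

Lemma inner_Nl x y : inner (- x) y = - inner x y.
Proof. exact: linearNl. Qed.

Lemma inner_Dl x y z : inner (x + y) z = inner x z + inner y z.
Proof. exact: linearDl. Qed.

Lemma inner_Bl x y z : inner (x - y) z = inner x z - inner y z.
Proof. by rewrite inner_Dl inner_Nl. Qed.

Lemma inner_eq0C x y : inner x y = 0 -> inner y x = 0.
Proof. by rewrite innerC => /eqP; rewrite conjc_eq0 => /eqP. Qed.

Definition orthonormal_on (I : eqType) (r : seq I) (w : I -> H) :=
  {in r &, forall i j, inner (w i) (w j) = (i == j)%:R}.

Lemma bessel (I : eqType) (r : seq I) (w : I -> H) z : uniq r -> orthonormal_on r w ->
  let z' := z - \sum_(i <- r) inner z (w i) *: w i in
  (forall i, i \in r -> inner z' (w i) = 0) /\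
  nm z' ^+ 2 = nm z ^+ 2 - \sum_(i <- r) msq z (w i).
Proof.
move=> ur ow z'; have z'0 i : i \in r -> inner z' (w i) = 0.
  move=> ir; rewrite inner_Bl inner_suml (bigD1_seq i)//= big_seq_cond big1 ?addr0.
    by rewrite inner_Zl ow// eqxx mulr1 subrr.
  by move=> j /andP[jr ji]; rewrite inner_Zl ow// (negbTE ji) mulr0.
split=> //; rewrite -ipxx {2}/z' ipDr ipNr ip_sumr big_seq big1 => [|i ir].
  rewrite subr0 /z' ipDl ipNl ip_suml ipxx; congr (_ - _); apply: eq_bigr => i _.
  by rewrite msqE /ip inner_Zl.
by rewrite /ip inner_Zr z'0// mulr0.
Qed.

Lemma bessel_le (I : eqType) (r : seq I) (w : I -> H) z : uniq r -> orthonormal_on r w ->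
  \sum_(i <- r) msq (w i) z <= nm z ^+ 2.
Proof.
move=> ur ow; have [_] := bessel z ur ow.
rewrite /= => h; rewrite -subr_ge0 (eq_bigr (fun i => msq z (w i))) => [|i _].
  by rewrite -h sqr_ge0.
exact: msqC.
Qed.

Lemma orthonormal_set_on E (s : seq H) : (forall u v, E u -> E v -> inner u v = (u == v)%:R) ->
  (forall u, u \in s -> E u) -> orthonormal_on s id.
Proof. by move=> hE sE u v us vs; apply: hE; exact: sE. Qed.

(** One inequality is Bessel's. For the other, completeness of [E] makes [x] a limit of points [v]
    of finite spans, and the Bessel remainder is no longer than [x - v]. *)
Lemma parseval E x : orthonormal_basis E ->
  \esum_(u in E) (msq x u)%:E = (nm x ^+ 2)%:E.
Proof.
move=> [oE cE]; apply/eqP; rewrite eq_le; apply/andP; split.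
  apply: ge_ereal_sup => _ [A [finA AE] <-].
  rewrite fsbig_finite// sumEFin lee_fin.
  rewrite (eq_bigr (fun u => msq u x)) => [|u _]; last exact: msqC.
  apply: bessel_le; first exact: finmap.fset_uniq.
  apply: (orthonormal_set_on oE) => u; rewrite in_fset_set// inE; exact: AE.
(* Finite spans of [E], encoded by duality: [v] is orthogonal to all that is orthogonal to a finite
   part of [E]. *)
pose L := [set v : H | exists2 s : seq H, uniq s /\ (forall u, u \in s -> E u) &
   forall z, (forall u, u \in s -> inner z u = 0) -> inner z v = 0].
have L0 : L 0 by exists [::] => // z _; rewrite linear0r.
have LP a u v : L u -> L v -> L (a *: u + v).
  move=> [s [us sE] hs] [t [ut tE] ht]; exists (undup (s ++ t)).
    split; first exact: undup_uniq.
    by move=> w; rewrite mem_undup mem_cat => /orP[/sE|/tE].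
  move=> z hz; rewrite linearPr/= hs ?ht ?mulr0 ?addr0// => w wst; apply: hz;
    by rewrite mem_undup mem_cat wst ?orbT.
have [y [hy oy]] := projection L0 LP x.
have {}oy : x = y.
  apply/eqP; rewrite -subr_eq0; apply/eqP/cE => u Eu; apply: oy.
  exists [:: u]; first by split=> // v; rewrite inE => /eqP ->.
  by move=> z; apply; rewrite mem_head.
rewrite -{y}oy in hy.
apply/lee_addgt0Pr => e e0.
have se0 : 0 < Num.sqrt e by rewrite sqrtr_gt0.
have [v [s [us sE] hs] hv] := hy _ se0.
have os := orthonormal_set_on oE sE.
have [h1 h2] := bessel x us os.
set z := x - _ in h1 h2.
have zv : inner z v = 0 by exact: hs.
have z2 : nm z ^+ 2 = ip z (x - v).
  have ipzv : ip z v = 0 by rewrite /ip zv.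
  rewrite ipDr ipNr ipzv subr0 -ipxx {2}/z ipDr ipNr.
  rewrite ip_sumr big_seq big1 ?subr0// => i si.
  by rewrite /ip inner_Zr h1// mulr0.
have z3 : nm z <= Num.sqrt e.
  have [->|z0] := eqVneq z 0; first by rewrite nm0 ltW.
  rewrite -(ler_pM2l (nm_gt0 z0)) -expr2 z2 (le_trans (ip_le _ _))//.
  by rewrite ler_wpM2l ?nm_ge0.
have z4 : nm z ^+ 2 <= e.
  by rewrite -(sqr_sqrtr (ltW e0)) ler_pXn2r// ?nnegrE ?nm_ge0 ?ltW.
apply: (@le_trans _ _ ((\sum_(u <- s) msq x u)%:E + e%:E)).
  by rewrite -EFinD lee_fin; move: h2 z4; rewrite /=; lra.
rewrite leeD2r// -sumEFin; apply: ereal_sup_ubound.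
exists [set` s]; first by split=> [|u /=]; [exact: finite_seq|exact: sE].
by rewrite -fsbig_seq.
Qed.

(** With [D = Q^2], Parseval turns the left side into a double sum of [|<Q a_j, e>|^2]; after
    exchanging the sums, the hypothesis at [z = Q e] bounds the inner one by [|Q e|^2]. Coordinates
    and contracted images of orthonormal families satisfy this hypothesis. *)
Lemma bessel_trace E (D : H -> H) (J : choiceType) (r : seq J) (a : J -> H) :
  orthonormal_basis E -> posop D -> (forall z, \sum_(j <- r) msq (a j) z <= nm z ^+ 2) ->
  ((\sum_(j <- r) ip (D (a j)) (a j))%:E <= \esum_(e in E) (ip (D e) e)%:E)%E.
Proof.
move=> bE pD ha; have [Q [bQ sQ QD]] := posop_sqrt pD.
rewrite -sumEFin.
under eq_bigr do rewrite -QD posop_sqr_ge0// -(parseval _ bE).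
rewrite -esum_sum; last by move=> *; rewrite lee_fin msq_ge0.
apply: le_esum => e Ee; rewrite sumEFin lee_fin -QD posop_sqr_ge0//.
apply: le_trans (ha (Q e)); rewrite ler_sum// => j _.
by rewrite /msq -(bopZ bQ) !sQ.
Qed.

Lemma orthonormal_basis_esum_le E F (D : H -> H) :
  orthonormal_basis E -> orthonormal_basis F -> posop D ->
  (\esum_(e in F) (ip (D e) e)%:E <= \esum_(e in E) (ip (D e) e)%:E)%E.
Proof.
move=> bE [oF _] pD; apply: ge_ereal_sup => _ [A [finA AF] <-].
rewrite fsbig_finite// sumEFin; apply: bessel_trace => // z.
apply: bessel_le; first exact: finmap.fset_uniq.
by apply: (orthonormal_set_on oF) => u; rewrite in_fset_set// inE; exact: AF.
Qed.

(** Zorn's lemma gives a maximal orthonormal set of eigenvectors. Its orthogonal complement is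
    invariant, and compactness would turn approximate eigenvectors there into a further
    eigenvector. *)
Lemma compact_spectral (N : H -> H) : compact_op N -> selfadj N ->
  exists2 E, orthonormal_basis E & forall e, E e -> exists l : R, N e = l%:C%C *: e.
Proof.
move=> [/bopP bN cN] sN; rewrite precompactE in cN.
pose P (E : set H) := (forall u v, E u -> E v -> inner u v = (u == v)%:R) /\
  (forall e, E e -> exists l : R, N e = l%:C%C *: e).
have [E [[oE eE] maxE]] : exists E, P E /\ forall F, E `<` F -> ~ P F.
  apply: Zorn_bigcup => F FP totF; split; last by move=> e [X FX Xe]; apply: (FP X FX).2.
  move=> u v [X FX Xu] [Y FY Yv].
  have [XY|YX] := totF _ _ FX FY.
    by apply: (FP Y FY).1 => //; exact: XY.
  by apply: (FP X FX).1 => //; exact: YX.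
exists E => //; split=> // x hx; apply: contrapT => /eqP x0.
pose L := [set z : H | forall e, E e -> inner z e = 0].
have sL : linear_subset L.
  by split=> [e _|a u v Lu Lv e Ee]; rewrite ?linear0l// linearPl/= Lu// Lv// mulr0 addr0.
have NL z : L z -> L (N z).
  move=> Lz e Ee; have [l el] := eE e Ee.
  by rewrite (adj_real_inner (bopZ bN) sN) el inner_Zr Lz// mulr0.
suff [y [Ly y0 [l yl]]] : exists y, [/\ L y, y != 0 & exists l : R, N y = l%:C%C *: y].
  pose y1 := (nm y)^-1%:C%C *: y.
  have Ly1 : L y1 := linear_subsetZ _ sL Ly.
  have y11 : inner y1 y1 = 1 by rewrite innerxx nm_normalize// expr1n.
  apply: (maxE (E `|` [set y1])).
    split; first by move=> u Eu; left.
    move=> h; have /Ly1 : E y1 by apply: h; right.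
    by rewrite y11 => /eqP; rewrite oner_eq0.
  split.
    have ne u : E u -> (u == y1) = false.
      move=> Eu; apply/eqP => uy; have := Ly1 u Eu.
      by rewrite uy y11 => /eqP; rewrite oner_eq0.
    move=> u v [Eu|->] [Ev|->].
    - exact: oE.
    - by rewrite ne//= inner_eq0C//; exact: Ly1.
    - by rewrite eq_sym ne//=; exact: Ly1.
    - by rewrite eqxx.
  move=> e [/eE//|->]; exists l.
  by rewrite /y1 (bopZ bN) yl !scalerA mulrC.
have [m [l [m0 hm lm hl]]] := selfadj_approx_eigen bN sN sL NL (ex_intro2 _ _ x hx x0).
(* If [l = 0], then [N] vanishes on [L] and [x] itself is an eigenvector; the limit argument below
   needs [l] nonzero to exclude the zero vector. *)
have [l0|l0] := eqVneq l 0.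
  exists x; split=> //; exists 0; rewrite scale0r; apply: nm_eq0.
  apply/eqP; rewrite eq_le nm_ge0 andbT (le_trans (hm x hx))//.
  by rewrite -lm l0 normr0 mul0r.
have ep0 n : 0 < n.+1%:R^-1 :> R by rewrite invr_gt0.
have /choice[z /all_and3[Lz z1 hz]] := fun n => hl _ (ep0 n).
pose K := closure (N @` [set x | `|x| <= 1]).
(* A cluster point [y] of [N (z n)] is also one of [l z n], hence nonzero and an eigenvector. *)
have /cN[y [_ cly]] : ((fun n => N (z n)) @ \oo) K.
  exists 0%N => // n _ /=; apply: subset_closure; exists (z n) => //=.
  by rewrite normE z1 lexx.
have near_y (e : R) : 0 < e -> exists u, [/\ L u, nm u = 1, nm (y - N u) <= e & nm (y - l%:C%C *: u) <= e].
  move=> e0; have e2 : 0 < e / 2 by rewrite divr_gt0.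
  have [n0 hn0] := natSinv_le e2.
  have e2C : 0 < (e / 2)%:C%C :> R[i] by rewrite ltcR.
  have [] := cly [set N (z n) | n in [set n | (n0 <= n)%N]] (ball y (e / 2)%:C%C).
  - by exists n0 => // n /= n0n; exists n.
  - exact: nbhsx_ballx.
  move=> _ [[n /= n0n <-]]; rewrite -ball_normE/= normE ltcR => hy.
  exists (z n); split=> //.
    by rewrite (le_trans (ltW hy))// ler_pdivrMr// ler_peMr ?(ltW e0)// ler1n.
  rewrite -(subrK (N (z n)) y) -addrA (le_trans (nmD _ _))// [leRHS]splitr lerD ?(ltW hy)//.
  by rewrite (le_trans (hz n))// hn0.
have l1 : 0 < `|l| by rewrite normr_gt0.
exists y; split.
- move=> e Ee; rewrite innerE; have n1 (w : H) : (forall u, L u -> ip u w = 0) -> ip y w = 0.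
    move=> hw; apply/normr0_eq0; apply: ge0_small_eq0 => // d d0.
    have w1 : 0 < nm w + 1 by rewrite ltr_wpDl ?nm_ge0.
    have [u [Lu _ _ hu]] := near_y _ (divr_gt0 d0 w1).
    have -> : ip y w = ip (y - l%:C%C *: u) w by rewrite !ipE (hw u Lu) mulr0 oppr0 addr0.
    rewrite (le_trans (ip_abs _ _))// (@le_trans _ _ (nm (y - l%:C%C *: u) * (nm w + 1)))//.
      by rewrite ler_wpM2l ?nm_ge0// lerDl.
    by rewrite -ler_pdivlMr.
  rewrite !n1// => u Lu; last by rewrite /ip Lu.
  by rewrite /ip inner_Zr Lu// mulr0.
- apply/eqP => y0; have [u [_ u1 _]] := near_y (`|l| / 2) ltac:(by rewrite divr_gt0).
  by rewrite y0 sub0r nmN nmZR u1; lra.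
exists l; have [_ [M M0 hM]] := bN.
apply: (@eq_of_nm_le _ _ (M + `|l|)) => e e0.
have [u [Lu u1 hu1 hu2]] := near_y _ e0.
rewrite (_ : N y - _ = N (y - l%:C%C *: u) - l%:C%C *: (y - N u)); last first.
  by rewrite (bopB bN) (bopZ bN) scalerBr opprB addrA subrK.
rewrite (le_trans (nmD _ _))// nmN nmZR mulrDr lerD//.
  by rewrite (le_trans (hM _))// mulrC ler_wpM2r.
by rewrite mulrC ler_wpM2r.
Qed.

(** The spectral theorem for the zero operator. *)
Lemma orthonormal_basis_ex : exists E : set H, orthonormal_basis E.
Proof.
have [||E bE _] := @compact_spectral (fun _ => 0); last by exists E.
  split; first by apply/bopP; exact: bop_zero.
  apply: (@precompact_subset _ _ [set 0]); first by move=> _ [x _ <-].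
  apply: compact_precompact; first exact: norm_hausdorff.
  exact: compact_set1.
by move=> x y; rewrite ip0l ip0r.
Qed.

(** Lets the trace, taken in a basis fixed by choice, be estimated in a basis of eigenvectors. *)
Lemma trace_le E (D : H -> H) : orthonormal_basis E -> posop D ->
  (trace D <= \esum_(e in E) (ip (D e) e)%:E)%E.
Proof.
move=> bE pD; apply: orthonormal_basis_esum_le => //.
by case: xgetP => // h; have [F /h] := orthonormal_basis_ex.
Qed.

Lemma trace_bessel (D : H -> H) (J : choiceType) (r : seq J) (a : J -> H) (t : R) :
  posop D -> (forall z, \sum_(j <- r) msq (a j) z <= nm z ^+ 2) ->
  (trace D <= t%:E)%E -> \sum_(j <- r) ip (D (a j)) (a j) <= t.
Proof.
move=> pD ha ht; rewrite -lee_fin; apply: le_trans ht.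
apply: bessel_trace => //; case: xgetP => // h; have [F /h] := orthonormal_basis_ex.
by [].
Qed.

End OrthonormalFamilies.

(** * Power inequalities and the Schatten trace *)

Section PowerInequalities.
Context {R : realType}.
Implicit Types (r m t u v a b : R).

(* Young's inequality for [t / m] and [1], rescaled by [m `^ r]. *)
Lemma powR_tangent r m t : 1 <= r -> 0 < m -> 0 <= t ->
  (1 - r) * m `^ r + r * (m `^ (r - 1)) * t <= t `^ r.
Proof.
move=> r1 m0 t0.
have mr : m `^ r = m `^ (r - 1) * m.
  rewrite -[X in _ = _ * X]powRr1 ?ltW// -powRD; last by rewrite (gt_eqF m0) implybT.
  by rewrite subrK.
have [->|rn1] := eqVneq r 1.
  by rewrite subrr mul0r add0r powRr0 !mul1r powRr1.
have r_gt1 : 1 < r by rewrite lt_neqAle eq_sym rn1.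
have r0 : 0 < r by rewrite (lt_trans ltr01).
have q0 : 0 < r / (r - 1) by rewrite divr_gt0// subr_gt0.
have := @conjugate_powR R (t / m) 1 r (r / (r - 1)).
rewrite divr_ge0 ?(ltW m0)// ler01 => /(_ isT isT r0 q0).
have -> : r^-1 + (r / (r - 1))^-1 = 1.
  by field; rewrite subr_eq0 rn1 gt_eqF.
move=> /(_ erefl); rewrite powR1 mulr1 mul1r.
rewrite powRM ?invr_ge0 ?(ltW m0)//.
have mi : m^-1 `^ r = (m `^ r)^-1.
  by rewrite -powR_inv1 ?(ltW m0)// -powRrM mulrC powRrM powR_inv1 ?powR_ge0.
rewrite mi => h.
have mr0 : 0 < m `^ r by rewrite powR_gt0.
have rmr0 : 0 < r * m `^ r by rewrite mulr_gt0.
have := ler_wpM2l (ltW rmr0) h.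
have -> : r * m `^ r * (t / m) = r * m `^ (r - 1) * t.
  by rewrite mr; field; rewrite gt_eqF.
have -> : r * m `^ r * (t `^ r * (m `^ r)^-1 / r + (r / (r - 1))^-1) =
   t `^ r + (r - 1) * m `^ r.
  by field; rewrite subr_eq0 rn1 !gt_eqF.
lra.
Qed.

(** Average of the tangent inequalities at the mean [m]. *)
Lemma powR_convex r t u v : 1 <= r -> 0 <= t <= 1 -> 0 <= u -> 0 <= v ->
  (t * u + (1 - t) * v) `^ r <= t * u `^ r + (1 - t) * v `^ r.
Proof.
move=> r1 /andP[t0 t1] u0 v0; set m := _ + _.
have m0 : 0 <= m by rewrite addr_ge0 ?mulr_ge0 ?subr_ge0.
have [m00|mn0] := eqVneq m 0.
  rewrite m00 powR0 ?addr_ge0 ?mulr_ge0 ?subr_ge0 ?powR_ge0//.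
  by rewrite gt_eqF// (lt_le_trans ltr01).
have mp : 0 < m by rewrite lt_neqAle eq_sym mn0.
have hu := ler_wpM2l t0 (powR_tangent r1 mp u0).
have hv : (1 - t) * ((1 - r) * m `^ r + r * m `^ (r - 1) * v) <= (1 - t) * v `^ r.
  by rewrite ler_wpM2l ?subr_ge0// powR_tangent.
have mr : m `^ r = m `^ (r - 1) * m.
  rewrite -[X in _ = _ * X]powRr1 ?ltW// -powRD; last by rewrite (gt_eqF mp) implybT.
  by rewrite subrK.
apply: le_trans (lerD hu hv); rewrite le_eqVlt; apply/orP; left; apply/eqP.
rewrite mr; set c := m `^ (r - 1); rewrite /m; ring.
Qed.

(** [(a + b) / (A + B)] is the convex combination of [a / A] and [b / B] with weight [A / (A + B)];
    convexity is then summed. If [A] or [B] is 0, the corresponding terms all vanish. *)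
Lemma powR_minkowski (I : eqType) (s : seq I) (a b : I -> R) (A B r : R) : 1 <= r ->
  (forall i, 0 <= a i) -> (forall i, 0 <= b i) -> 0 <= A -> 0 <= B ->
  \sum_(i <- s) a i `^ r <= A `^ r -> \sum_(i <- s) b i `^ r <= B `^ r ->
  \sum_(i <- s) (a i + b i) `^ r <= (A + B) `^ r.
Proof.
move=> r1; have r0 : r != 0 by rewrite gt_eqF// (lt_le_trans ltr01).
wlog : a b A B / A != 0 => [wlg|An0] a0 b0 A0 B0 hA hB.
  have [Az|An0] := eqVneq A 0; last exact: wlg.
  have az : {in s, forall i, a i = 0}.
    move: hA; rewrite Az powR0// => hA.
    have /eqP : \sum_(i <- s) a i `^ r = 0.
      by apply/eqP; rewrite eq_le hA sumr_ge0// => i _; exact: powR_ge0.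
    rewrite psumr_eq0; last by move=> i _; exact: powR_ge0.
    by move=> /allP h i /h /= /eqP /powR_eq0_eq0.
  rewrite Az add0r; apply: le_trans hB.
  by rewrite le_eqVlt; apply/orP; left; apply/eqP; apply: eq_big_seq => i si; rewrite az// add0r.
have [Bz|Bn0] := eqVneq B 0.
  have bz : {in s, forall i, b i = 0}.
    move: hB; rewrite Bz powR0// => hB.
    have /eqP : \sum_(i <- s) b i `^ r = 0.
      by apply/eqP; rewrite eq_le hB sumr_ge0// => i _; exact: powR_ge0.
    rewrite psumr_eq0; last by move=> i _; exact: powR_ge0.
    by move=> /allP h i /h /= /eqP /powR_eq0_eq0.
  rewrite Bz addr0; apply: le_trans hA.
  by rewrite le_eqVlt; apply/orP; left; apply/eqP; apply: eq_big_seq => i si; rewrite bz// addr0.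
have Ap : 0 < A by rewrite lt_neqAle eq_sym An0.
have Bp : 0 < B by rewrite lt_neqAle eq_sym Bn0.
have ABp : 0 < A + B by rewrite addr_gt0.
pose t := A / (A + B).
have t01 : 0 <= t <= 1 by rewrite divr_ge0 ?(ltW ABp)//= ler_pdivrMr// mul1r lerDl.
have At : 0 < A `^ r by rewrite powR_gt0.
have Bt : 0 < B `^ r by rewrite powR_gt0.
have key i : (a i + b i) `^ r <=
    (A + B) `^ r * (t * (a i `^ r / A `^ r) + (1 - t) * (b i `^ r / B `^ r)).
  have -> : a i + b i = (A + B) * (t * (a i / A) + (1 - t) * (b i / B)).
    by rewrite /t; field; rewrite !gt_eqF.
  have inv (x y : R) : 0 <= x -> 0 < y -> x `^ r / y `^ r = (x / y) `^ r.
    move=> x0 y0; rewrite powRM ?invr_ge0 ?(ltW y0)//; congr (_ * _).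
    by rewrite -[in RHS]powR_inv1 ?(ltW y0)// -powRrM mulrC powRrM powR_inv1 ?powR_ge0.
  have t1 : 0 <= 1 - t by case/andP: t01; rewrite subr_ge0.
  have t0 : 0 <= t by case/andP: t01.
  rewrite !inv// powRM ?(ltW ABp)//; last first.
    by rewrite addr_ge0// mulr_ge0// divr_ge0// ltW.
  by rewrite ler_wpM2l ?powR_ge0// powR_convex// divr_ge0// ltW.
apply: (@le_trans _ _ (\sum_(i <- s)
   ((A + B) `^ r * (t * (a i `^ r / A `^ r) + (1 - t) * (b i `^ r / B `^ r))))).
  by apply: ler_sum => i _; exact: key.
rewrite -mulr_sumr big_split/= -!mulr_sumr -!mulr_suml.
rewrite -[leRHS]mulr1 ler_wpM2l ?powR_ge0//.
have h1 : (\sum_(i <- s) a i `^ r) / A `^ r <= 1 by rewrite ler_pdivrMr// mul1r.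
have h2 : (\sum_(i <- s) b i `^ r) / B `^ r <= 1 by rewrite ler_pdivrMr// mul1r.
have t1 : 0 <= 1 - t by case/andP: t01; rewrite subr_ge0.
have t0 : 0 <= t by case/andP: t01.
have := ler_wpM2l t0 h1; have := ler_wpM2l t1 h2; lra.
Qed.

End PowerInequalities.

(** * Eigenvalue sums and Jensen's inequality for Schatten traces *)

Section SchattenTrace.
Context {R : realType} {H : hilbertType R}.
Implicit Types (x y z : H) (A X P : H -> H) (r : R).

Lemma fc_eigen (f : R -> R) A (l : R) x : {within `[0, +oo[, continuous f} -> posop A ->
  0 <= l -> A x = l%:C%C *: x -> fun_calc f A x = (f l)%:C%C *: x.
Proof.
move=> cf pA l0 Ax; have [bA sA _] := pA; have [_ [M M0 hM]] := bA.
have [->|x0] := eqVneq x 0; first by rewrite scaler0 (bop0 (bop_fc cf pA)).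
have lM : l <= M.
  rewrite -(ler_pM2r (nm_gt0 x0)) (le_trans _ (hM x))// Ax nmZR.
  by rewrite ler_wpM2r ?nm_ge0 ?ler_norm.
apply: (@eq_of_nm_le _ _ (2 * nm x)) => e e0.
have [q hq] := weierstrass M cf e0.
have h1 := fc_near cf pA hM (ltW e0) hq x.
have rq : rpop A q x = (q.[l])%:C%C *: x.
  elim/poly_ind: q {hq h1} => [|q c IH].
    by rewrite -polyC0 rpopC hornerC.
  rewrite rpopD mulrC rpopM// rpopX// IH (bopZ bA) Ax rpopC scalerA -scalerDl.
  by rewrite -rmorphM -rmorphD/= !hornerE mulrC.
rewrite (_ : _ - _ = (q.[l]%:C%C *: x - (f l)%:C%C *: x) - (rpop A q x - fun_calc f A x)).
  rewrite -scalerBl -rmorphB (le_trans (nmD _ _))// nmN nmZR.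
  have := ler_wpM2r (nm_ge0 x) (hq l ltac:(by rewrite l0)); lra.
by rewrite rq opprB [RHS]addrC addrA subrK.
Qed.

Lemma posop_powR r X : 1 <= r -> bop X -> posop (fun_calc (fun t => t `^ r) (abs_op X)).
Proof.
move=> r1 bX; apply: posop_fc; [exact: continuous_powR_nneg| |exact: posop_abs].
by move=> t _; exact: powR_ge0.
Qed.

(** The power minus its tangent line at [m] is non-negative on [[0, +oo[], so the calculus makes it
    a positive operator. *)
Lemma fc_powR_tangent r P (m : R) x : 1 <= r -> posop P -> 0 < m ->
  (1 - r) * m `^ r * nm x ^+ 2 + r * m `^ (r - 1) * ip (P x) x <=
  ip (fun_calc (fun t => t `^ r) P x) x.
Proof.
move=> r1 pP m0; have [bP _ _] := pP; have cp := continuous_powR_nneg r1.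
pose q : {poly R} := - ((1 - r) * m `^ r)%:P - (r * m `^ (r - 1))%:P * 'X.
have qE t : q.[t] = - ((1 - r) * m `^ r) - r * m `^ (r - 1) * t.
  by rewrite /q !hornerE.
pose h t := t `^ r + q.[t].
have ch : {within `[0, +oo[, continuous h}.
  by apply: continuousD_nneg => //; exact: continuous_horner_nneg.
have h0 t : 0 <= t -> 0 <= h t.
  by move=> t0; rewrite /h qE; have := powR_tangent r1 m0 t0; lra.
have [_ _ /(_ x)] := posop_fc ch h0 pP.
rewrite (fc_add_poly cp ch pP (fun _ _ => erefl)) ipDl.
rewrite /q rpopB// rpopM// rpopX// -polyCN !rpopC !ipE ipxx; lra.
Qed.

(** In a basis of eigenvectors of [X] the diagonal of [|X|^r] is [|l|^r]. Zero eigenvalues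
    contribute nothing and are dropped, since the exchange of [A B] and [B A] works only for nonzero
    ones. *)
Lemma schatten_trace_le r X (t : R) : 1 <= r -> compact_op X -> selfadj X ->
  (forall (n : nat) (u : nat -> H) (l : nat -> R),
     orthonormal_on (iota 0 n) u ->
     (forall i, (i < n)%N -> X (u i) = (l i)%:C%C *: u i /\ l i != 0) ->
     \sum_(i <- iota 0 n) `|l i| `^ r <= t) ->
  (schatten_trace r X <= t%:E)%E.
Proof.
move=> r1 cX sX ht; have bX : bop X by apply/bopP; case: cX.
have r0 : r != 0 by rewrite gt_eqF// (lt_le_trans ltr01).
have [E bE eE] := compact_spectral cX sX; have [oE _] := bE.
have /choice[l hl] : forall e, exists l : R, E e -> X e = l%:C%C *: e.
  move=> e; have [/eE[l el]|nE] := pselect (E e); first by exists l.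
  by exists 0.
have adjX : adjoint X = X by apply: adj_uniq.
have De e : E e -> ip (fun_calc (fun t => t `^ r) (abs_op X) e) e = `|l e| `^ r.
  move=> Ee; have Ae : abs_op X e = `|l e|%:C%C *: e.
    rewrite /abs_op (fc_eigen continuous_sqrt_nneg (posop_gram bX) (sqr_ge0 (l e))).
      by rewrite sqrtr_sqr.
    by rewrite /= adjX (hl e Ee) (bopZ bX) (hl e Ee) scalerA -rmorphM -expr2.
  rewrite (fc_eigen (continuous_powR_nneg r1) (posop_abs bX) (normr_ge0 _) Ae).
  by rewrite ipZlR /ip oE// eqxx mulr1.
apply: le_trans (trace_le bE (posop_powR r1 bX)) _.
apply: ge_ereal_sup => _ [A [finA AE] <-].
rewrite fsbig_finite// sumEFin lee_fin.
set s := finmap.enum_fset _.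
have sE u : u \in s -> E u by rewrite in_fset_set// inE => /AE.
have us : uniq s by exact: finmap.fset_uniq.
rewrite (eq_big_seq (fun e => `|l e| `^ r)); last by move=> e /sE /De.
rewrite (bigID (fun e => l e != 0))/= [X in _ + X]big1 ?addr0; last first.
  by move=> e; rewrite negbK => /eqP ->; rewrite normr0 powR0.
rewrite -big_filter; set s' := [seq e <- s | _].
have us' : uniq s' by rewrite filter_uniq.
rewrite (big_nth 0) /index_iota subn0.
apply: (ht _ (nth 0 s') (fun i => l s'`_i)) => [i j|i isz].
  rewrite !mem_iota !add0n => /= isz jsz; rewrite oE ?nth_uniq//.
    by apply: sE; have := mem_nth 0 isz; rewrite mem_filter => /andP[].
  by apply: sE; have := mem_nth 0 jsz; rewrite mem_filter => /andP[].
have := mem_nth 0 isz; rewrite mem_filter => /andP[li si].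
by split=> //; apply: hl; exact: sE.
Qed.

Lemma msq_adj (V W : H -> H) : scalable V -> (forall x y, ip (V x) y = ip x (W y)) ->
  forall x y, msq (W y) x = msq y (V x).
Proof. by move=> lV VW x y; rewrite /msq -lV !(ipC _ (V _)) !VW !(ipC (W y)). Qed.

(* Jensen's inequality in tangent form; the mixed Schwarz inequality
   |<X a, b>| <= (<|X| a, a> + <|X| V^* b, V^* b>) / 2 reduces to [|X|]. *)
Lemma schatten_jensen r (I : choiceType) (s : seq I) (J : finType) (X : J -> H -> H)
    (a b : I -> J -> H) (c : R) (t : J -> R) : 1 <= r -> (forall j, bop (X j)) -> 0 < c ->
  (forall i, i \in s -> \sum_j (nm (a i j) ^+ 2 + nm (b i j) ^+ 2) <= 2 * c) ->
  (forall j z, \sum_(i <- s) msq (a i j) z <= nm z ^+ 2) ->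
  (forall j z, \sum_(i <- s) msq (b i j) z <= nm z ^+ 2) ->
  (forall j, (schatten_trace r (X j) <= (t j)%:E)%E) ->
  \sum_(i <- s) (\sum_j `|ip (X j (a i j)) (b i j)|) `^ r <= c `^ (r - 1) * \sum_j t j.
Proof.
move=> r1 bX c0 hc ha hb ht.
have r_gt0 : 0 < r by rewrite (lt_le_trans ltr01).
have /choice[V /choice[W hVW]] := fun j => polar (bX j).
pose P j := abs_op (X j); have pP j : posop (P j) by exact: posop_abs.
pose D j := fun_calc (fun t => t `^ r) (P j).
have pD j : posop (D j) by exact: posop_powR.
pose S i := \sum_j (ip (P j (a i j)) (a i j) + ip (P j (W j (b i j))) (W j (b i j))) / 2.
pose T i := \sum_j (ip (D j (a i j)) (a i j) + ip (D j (W j (b i j))) (W j (b i j))) / 2.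
have S0 i : 0 <= S i.
  apply: sumr_ge0 => j _; have [_ _ h] := pP j.
  by rewrite divr_ge0// addr_ge0.
have T0 i : 0 <= T i.
  apply: sumr_ge0 => j _; have [_ _ h] := pD j.
  by rewrite divr_ge0// addr_ge0.
have leS i : \sum_j `|ip (X j (a i j)) (b i j)| <= S i.
  apply: ler_sum => j _; have [_ _ _ [VW VA _ _]] := hVW j.
  by rewrite -VA VW; exact: (posop_cs _ _ (pP j)).
have cr : c `^ r = c `^ (r - 1) * c.
  rewrite -[X in _ = _ * X]powRr1 ?ltW// -powRD; last by rewrite (gt_eqF c0) implybT.
  by rewrite subrK.
have ST i : i \in s -> S i `^ r <= c `^ (r - 1) * T i.
  move=> si; have [->|Sn0] := eqVneq (S i) 0.
    by rewrite powR0 ?gt_eqF// mulr_ge0 ?powR_ge0.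
  have Sp : 0 < S i by rewrite lt_neqAle eq_sym Sn0 S0.
  (* With tangent point [m = S / c] and mass [Q <= c], the tangent bound collapses to [c m^r], where
     [(c m)^r = S^r]. *)
  pose m := S i / c; have m0 : 0 < m by rewrite divr_gt0.
  have mr : m `^ r = m `^ (r - 1) * m.
    rewrite -[X in _ = _ * X]powRr1 ?ltW// -powRD; last by rewrite (gt_eqF m0) implybT.
    by rewrite subrK.
  have -> : S i `^ r = c `^ (r - 1) * (c * m `^ r).
    by rewrite mulrA -cr -powRM ?(ltW c0) ?(ltW m0)// /m mulrC divfK// gt_eqF.
  rewrite ler_wpM2l ?powR_ge0//.
  pose Q := \sum_j (nm (a i j) ^+ 2 + nm (W j (b i j)) ^+ 2) / 2.
  have Qc : Q <= c.
    rewrite /Q -mulr_suml ler_pdivrMr// mulrC (le_trans _ (hc i si))// ler_sum// => j _.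
    have [_ _ [_ W1] _] := hVW j.
    by rewrite lerD2l ler_pXn2r// ?nnegrE ?nm_ge0.
  have : (1 - r) * m `^ r * Q + r * m `^ (r - 1) * S i <= T i.
    rewrite /Q /S !mulr_sumr -big_split/=; apply: ler_sum => j _.
    have := fc_powR_tangent (a i j) r1 (pP j) m0.
    have := fc_powR_tangent (W j (b i j)) r1 (pP j) m0.
    rewrite -/(D j); lra.
  apply: le_trans.
  have -> : S i = c * m by rewrite /m mulrC divfK// gt_eqF.
  have -> : r * m `^ (r - 1) * (c * m) = r * m `^ r * c by rewrite mr; ring.
  have h1 : 0 <= (r - 1) * m `^ r by rewrite mulr_ge0 ?powR_ge0// subr_ge0.
  have := ler_wpM2l h1 Qc; lra.
apply: (@le_trans _ _ (\sum_(i <- s) c `^ (r - 1) * T i)).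
  rewrite big_seq [leRHS]big_seq; apply: ler_sum => i si; apply: le_trans (ST i si).
  apply: ge0_ler_powR; rewrite ?nnegrE ?(ltW r_gt0)//.
  by apply: sumr_ge0.
rewrite -mulr_sumr ler_wpM2l ?powR_ge0// exchange_big/=; apply: ler_sum => j _.
rewrite -mulr_suml big_split/= ler_pdivrMr// mulr_natr mulr2n lerD//.
  exact: trace_bessel (pD j) (ha j) (ht j).
(* [<W b, z>] has the modulus of [<b, V z>], so contractivity of [V] passes Bessel's inequality to
   the vectors [W b]. *)
apply: (@trace_bessel _ _ _ _ _ (fun i => W j (b i j)) _ (pD j) _ (ht j)) => z.
have [bV _ [V1 _] [VW _ _ _]] := hVW j.
under eq_bigr do rewrite (msq_adj (bopZ bV) VW).
by rewrite (le_trans (hb j _))// ler_pXn2r// ?nnegrE ?nm_ge0.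
Qed.

End SchattenTrace.

(** * Operators on direct sums *)

Section DirectSum.
Context {R : realType} {H : hilbertType R}.
Implicit Types (x y : H).

Lemma inner_dsum (K : hilbertType R) (u v : dsum H K) :
  inner u v = inner u.1 v.1 + inner u.2 v.2.
Proof. by []. Qed.

Lemma ip_dsum (K : hilbertType R) (u v : dsum H K) : ip u v = ip u.1 v.1 + ip u.2 v.2.
Proof. by rewrite /ip inner_dsum ReD. Qed.

Lemma nm_dsum (K : hilbertType R) (u : dsum H K) : nm u ^+ 2 = nm u.1 ^+ 2 + nm u.2 ^+ 2.
Proof. by rewrite -!ipxx ip_dsum. Qed.

Lemma msq_dsum1 (K : hilbertType R) (u : dsum H K) (z : H) :
  msq u ((z, 0) : dsum H K) = msq u.1 z.
Proof. by rewrite /msq !ip_dsum/= scaler0 !ip0r !addr0. Qed.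

Lemma msq_dsum2 (K : hilbertType R) (u : dsum H K) (z : K) :
  msq u ((0, z) : dsum H K) = msq u.2 z.
Proof. by rewrite /msq !ip_dsum/= scaler0 !ip0r !add0r. Qed.

Lemma nm_dsum1 (K : hilbertType R) (z : H) : nm ((z, 0) : dsum H K) = nm z.
Proof.
by apply/eqP; rewrite -(@eqrXn2 _ 2) ?nm_ge0// nm_dsum/= nm0 expr0n addr0.
Qed.

Lemma nm_dsum2 (K : hilbertType R) (z : K) : nm ((0, z) : dsum H K) = nm z.
Proof.
by apply/eqP; rewrite -(@eqrXn2 _ 2) ?nm_ge0// nm_dsum/= nm0 expr0n add0r.
Qed.

Lemma nm_fst (K : hilbertType R) (u : dsum H K) : nm u.1 <= nm u.
Proof. by rewrite -(@ler_pXn2r _ 2)// ?nnegrE ?nm_ge0// (nm_dsum u) lerDl sqr_ge0. Qed.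

Lemma nm_snd (K : hilbertType R) (u : dsum H K) : nm u.2 <= nm u.
Proof. by rewrite -(@ler_pXn2r _ 2)// ?nnegrE ?nm_ge0// (nm_dsum u) lerDr sqr_ge0. Qed.

Lemma nm_dsum_le (K : hilbertType R) (u : dsum H K) : nm u <= nm u.1 + nm u.2.
Proof.
rewrite -(@ler_pXn2r _ 2)// ?nnegrE ?addr_ge0 ?nm_ge0// nm_dsum sqrrD.
by rewrite lerD2r lerDl mulrn_wge0// mulr_ge0 ?nm_ge0.
Qed.

Lemma bop_pair (U K : hilbertType R) (X : U -> H) (Y : U -> K) : bop X -> bop Y ->
  bop (fun u => (X u, Y u) : dsum H K).
Proof.
move=> bX bY; split=> [a u v|]; first by rewrite bX.1 bY.1.
have [_ [M M0 hM]] := bX; have [_ [N N0 hN]] := bY.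
exists (M + N); first exact: addr_ge0.
move=> u; apply: le_trans (nm_dsum_le _) _.
by rewrite mulrDl; apply: lerD; [exact: hM|exact: hN].
Qed.

Lemma bop_fst (K : hilbertType R) : bop (fst : dsum H K -> H).
Proof. by split=> [a u v //|]; exists 1 => // u; rewrite mul1r; exact: nm_fst. Qed.

Lemma bop_snd (K : hilbertType R) : bop (snd : dsum H K -> K).
Proof. by split=> [a u v //|]; exists 1 => // u; rewrite mul1r; exact: nm_snd. Qed.

End DirectSum.

(** * Passing from [A B] to [B A] *)

Section GramSchmidt.
Context {R : realType}.

(* Gram-Schmidt turns the matrix of [C] on the span of the eigenvectors into a
   triangular one with the eigenvalues on the diagonal. *)
Lemma schur_family (W : hilbertType R) (C : W -> W) (z : nat -> W) (l : nat -> R) n :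
  bop C -> (forall i, (i < n)%N -> C (z i) = (l i)%:C%C *: z i) ->
  (forall k, (k < n)%N -> forall c : nat -> R[i], z k <> \sum_(i <- iota 0 k) c i *: z i) ->
  exists w : nat -> W, orthonormal_on (iota 0 n) w /\
    forall i, (i < n)%N -> ip (C (w i)) (w i) = l i.
Proof.
move=> bC; pose S k := [set x : W | exists c : nat -> R[i], x = \sum_(i <- iota 0 k) c i *: z i].
have S0 k : S k 0 by exists (fun=> 0); rewrite big1// => i _; rewrite scale0r.
have SP k a x y : S k x -> S k y -> S k (a *: x + y).
  move=> [c ->] [d ->]; exists (fun i => a * c i + d i).
  by rewrite scaler_sumr -big_split/=; apply: eq_bigr => i _; rewrite scalerA -scalerDl.
have Ssum k (c : nat -> R[i]) (v : nat -> W) (s : seq nat) :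
    (forall i, i \in s -> S k (v i)) -> S k (\sum_(i <- s) c i *: v i).
  elim: s => [|i s IH] hv; first by rewrite big_nil.
  rewrite big_cons; apply: SP; first by apply: hv; rewrite mem_head.
  by apply: IH => j js; apply: hv; rewrite inE js orbT.
have SS k x : S k x -> S k.+1 x.
  move=> [c ->]; exists (fun i => if (i < k)%N then c i else 0).
  rewrite -addn1 iotaD big_cat/= big_cons big_nil add0n ltnn scale0r !addr0.
  by apply: eq_big_seq => i; rewrite mem_iota => /andP[_ ik]; rewrite ik.
have Sz k : S k.+1 (z k).
  exists (fun i => (i == k)%:R); rewrite -addn1 iotaD big_cat/= big_cons big_nil add0n eqxx.
  rewrite scale1r addr0 big_seq big1 ?add0r// => i; rewrite mem_iota => /andP[_ ik].
  by rewrite (ltn_eqF ik) scale0r.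
move=> Cz zind.
(* The last two clauses carry the induction: the [w i] lie in the span of the [z i], and conversely,
   the converse being stated by duality. *)
suff : forall k, (k <= n)%N -> exists w : nat -> W, [/\ orthonormal_on (iota 0 k) w,
    forall i, (i < k)%N -> ip (C (w i)) (w i) = l i,
    forall i, (i < k)%N -> S k (w i) &
    forall y, (forall i, (i < k)%N -> inner y (w i) = 0) ->
      forall i, (i < k)%N -> inner y (z i) = 0].
  by move=> /(_ n (leqnn _)) [w [h1 h2 _ _]]; exists w.
elim=> [_|k IH kn]; first by exists (fun=> 0); split.
have [w [ow Cw Sw wz]] := IH (ltnW kn).
have [h1 _] := bessel (z k) (iota_uniq 0 k) ow.
set P := \sum_(i <- _) _ in h1; set z' := z k - P in h1.
have SPk : S k P by apply: Ssum => i; rewrite mem_iota add0n => /Sw.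
have z'0 : z' != 0.
  rewrite subr_eq0; apply/eqP => zP.
  have [c Pc] := SPk; apply: (zind k kn c); by rewrite zP.
have z'w i : (i < k)%N -> inner z' (w i) = 0 by move=> ik; apply: h1; rewrite mem_iota.
have z'S x : S k x -> inner x z' = 0.
  move=> [c ->]; rewrite inner_suml big_seq big1// => i; rewrite mem_iota add0n => /= ik.
  rewrite inner_Zl (inner_eq0C _) ?mulr0//; exact: wz.
have CS x : S k x -> S k (C x).
  move=> [c ->]; rewrite (bop_sum bC).
  exists (fun i => c i * (l i)%:C%C); apply: eq_big_seq => i; rewrite mem_iota add0n => /= ik.
  by rewrite (bopZ bC) Cz ?scalerA// (ltn_trans ik).
pose v := (nm z')^-1%:C%C *: z'.
have v1 : inner v v = 1 by rewrite innerxx nm_normalize// expr1n.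
have wv i : (i < k)%N -> inner (w i) v = 0.
  by move=> ik; rewrite /v inner_Zr (inner_eq0C (z'w i ik)) mulr0.
(* [C] preserves [S k], so [C v] is [l k] times [v] plus an element of [S k], which is orthogonal to
   [v]. *)
have Cv : ip (C v) v = l k.
  have -> : C v = (l k)%:C%C *: v + (nm z')^-1%:C%C *: ((l k)%:C%C *: P - C P).
    rewrite /v (bopZ bC) /z' (bopB bC) (Cz _ kn) !scalerA mulrC -scalerA -scalerDr; congr (_ *: _).
    by rewrite scalerBr addrA subrK.
  have Sx : S k ((l k)%:C%C *: P - C P).
    by apply: (SP) => //; rewrite -scaleN1r -(addr0 (_ *: _)); apply: SP => //; exact: CS.
  rewrite ipDl ipZlR /ip v1 /= mulr1 inner_Zl /v inner_Zr z'S// !mulr0/= addr0//.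
exists (fun i => if (i < k)%N then w i else v); split.
- move=> i j; rewrite !mem_iota !add0n !ltnS => /= ik jk.
  case: ltnP => ik'; case: ltnP => jk'.
  + by apply: ow; rewrite mem_iota.
  + by rewrite wv// (ltn_eqF (leq_trans ik' jk')).
  + by rewrite inner_eq0C ?wv// eq_sym (ltn_eqF (leq_trans jk' ik')).
  + have -> : i = j by apply/eqP; rewrite eqn_leq (leq_trans ik jk') (leq_trans jk ik').
    by rewrite v1 eqxx.
- move=> i; rewrite ltnS leq_eqVlt => /predU1P[->|ik]; first by rewrite ltnn.
  by rewrite ik Cw.
- move=> i _; case: ltnP => [ik|_]; first by apply/SS/Sw.
  rewrite /v -(addr0 (_ *: _)); apply: (SP) => //.
  by rewrite /z' addrC -scaleN1r; apply: SP => //; exact: SS.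
- move=> y hy; have hyw i : (i < k)%N -> inner y (w i) = 0.
    by move=> ik; have := hy i (ltnW ik); rewrite ik.
  have hyz i : (i < k)%N -> inner y (z i) = 0 by apply: wz.
  move=> i; rewrite ltnS leq_eqVlt => /predU1P[->|]; last exact: hyz.
  have yz' : inner y z' = 0.
    have := hy k (ltnSn k); rewrite ltnn /v inner_Zr => /eqP.
    rewrite mulf_eq0 conjc_eq0 => /orP[|/eqP//].
    by move=> /eqP/(congr1 (@complex.Re R))/= /eqP; rewrite invr_eq0 => /eqP/nm_eq0/eqP; rewrite (negbTE z'0).
  have yP : inner y P = 0.
    have [c Pc] := SPk; apply: inner_eq0C; rewrite Pc inner_suml big_seq big1// => j.
    rewrite mem_iota add0n => /= jk; by rewrite inner_Zl (inner_eq0C (hyz j jk)) mulr0.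
  have -> : z k = z' + P by rewrite /z' subrK.
  by apply: inner_eq0C; rewrite inner_Dl (inner_eq0C yz') (inner_eq0C yP) addr0.
Qed.

Variables (U : hilbertType R) (f K K' : U -> U).
Hypotheses (bf : bop f) (bK : bop K) (bK' : bop K') (sf : selfadj f)
  (KK' : forall x y, ip (K x) y = ip x (K' y)).

Let A (w : dsum U U) : U := K w.1 + f w.2.
Let B (u : U) : dsum U U := (f u, K' u).

Let bA : bop A.
Proof.
apply: bop_add.
  by apply: (bop_comp bK); exact: bop_fst.
by apply: (bop_comp bf); exact: bop_snd.
Qed.

Let bB : bop B. Proof. exact: bop_pair. Qed.

Let ipBA w : ip (B (A w)) w = ip (K w.1 + f w.2) (f w.1 + K w.2).
Proof. by rewrite ip_dsum /= ipDr sf; congr (_ + _); rewrite ipC -KK' ipC. Qed.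

(* [N = A B] with [A = (K, f)] and [B = (f, K^* )]; the eigenvectors of [A B]
   are mapped by [B] to eigenvectors of [B A]. *)
Lemma eigen_swap (u : nat -> U) (l : nat -> R) n : orthonormal_on (iota 0 n) u ->
  (forall i, (i < n)%N -> K (f (u i)) + f (K' (u i)) = (l i)%:C%C *: u i /\ l i != 0) ->
  exists w : nat -> dsum U U, orthonormal_on (iota 0 n) w /\
    forall i, (i < n)%N -> ip (K (w i).1 + f (w i).2) (f (w i).1 + K (w i).2) = l i.
Proof.
move=> ou hu; have [||| w [ow hw]] := @schur_family (dsum U U) (B \o A) (B \o u) l n.
- exact: bop_comp.
- by move=> i /hu[h _]; rewrite /= {2}/B /A/= h (bopZ bB).
(* Independence of the [B (u i)]: [A] maps a relation between them to one between the [l i u i], and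
   [l k] is nonzero. *)
- move=> k kn c /(congr1 A) /= hA; have [hk lk] := hu k kn.
  have : inner (A (B (u k))) (u k) = 0.
    rewrite hA (bop_sum bA) inner_suml big_seq big1// => i; rewrite mem_iota add0n => /= ik.
    have [hi _] := hu i (ltn_trans ik kn).
    rewrite (bopZ bA) inner_Zl {1}/A /= hi inner_Zl ou ?mem_iota ?add0n//.
      by rewrite (ltn_eqF ik) !mulr0.
    exact: ltn_trans ik kn.
  rewrite {1}/A /= hk inner_Zl ou ?mem_iota// eqxx mulr1 => /(congr1 (@complex.Re R))/= /eqP.
  by rewrite (negbTE lk).
by exists w; split=> // i /hw; rewrite /= ipBA.
Qed.

(** Operator-norm counterpart of [eigen_swap]: eigenvectors may not exist, so a unit vector [u] with
    [N u] close to [l u] is used. If [m < |l|], the form of [B A] at [B u] exceeds its bound. *)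
Lemma norm_swap (m : R) : 0 <= m ->
  (forall w : dsum U U, `|ip (K w.1 + f w.2) (f w.1 + K w.2)| <= m * nm w ^+ 2) ->
  forall u, nm (K (f u) + f (K' u)) <= m * nm u.
Proof.
move=> m0 hm u0; pose N u := K (f u) + f (K' u).
have bN : bop N.
  by apply: bop_add; [exact: (bop_comp bK bf)|exact: (bop_comp bf bK')].
have sN : selfadj N.
  move=> x y; rewrite /N ipDl ipDr addrC; congr (_ + _); last by rewrite KK' sf.
  by rewrite sf ipC -KK' ipC.
have [->|u00] := eqVneq u0 0; first by rewrite -/(N 0) (bop0 bN) nm0 mulr0.
have [k [l [k0 hk lk hl]]] := selfadj_approx_eigen bN sN (linear_subsetT U) (fun _ _ => I)
  (ex_intro2 _ _ u0 I u00).
apply: (le_trans (hk u0 I)); rewrite ler_wpM2r ?nm_ge0//.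
have [_ [a a0 ha]] := bA; have [_ [b b0 hb]] := bB.
rewrite leNgt; apply/negP => mk.
have a1 : 0 < a + 1 by rewrite ltr_wpDl.
have kp : 0 < k by rewrite (le_lt_trans m0).
(* [B u] stays away from [0] while [<B A B u, B u>] is close to [l |B u|^2] *)
pose d := Num.min (k / 2) ((k - m) * (k / 2 / (a + 1)) / (2 * (b + 1))).
have b1 : 0 < b + 1 by rewrite ltr_wpDl.
have d0 : 0 < d.
  by rewrite lt_min !(divr_gt0, mulr_gt0) ?subr_gt0.
have [u [_ u1 hu]] := hl d d0.
have NB : N u = A (B u) by [].
have dk : d <= k / 2 by rewrite ge_min lexx.
have dk2 : d * (2 * (b + 1)) <= (k - m) * (k / 2 / (a + 1)).
  by rewrite -ler_pdivlMr ?mulr_gt0// ge_min lexx orbT.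
have Nu : k / 2 <= nm (N u).
  have := nmD (N u) (- (N u - l%:C%C *: u)); rewrite nmN opprB addrC subrK.
  rewrite nmZR lk u1 mulr1; lra.
have Bu : k / 2 / (a + 1) <= nm (B u).
  rewrite ler_pdivrMr// (le_trans Nu)// NB (le_trans (ha _))// mulrC ler_wpM2l ?nm_ge0//.
  by rewrite lerDl.
have e1 : ip (B (A (B u))) (B u) = l * nm (B u) ^+ 2 + ip (B (N u - l%:C%C *: u)) (B u).
  by rewrite (bopB bB) (bopZ bB) ipDl ipNl ipZlR ipxx -NB; ring.
have := hm (B u); rewrite -ipBA e1.
have e2 : `|ip (B (N u - l%:C%C *: u)) (B u)| <= (b + 1) * d * nm (B u).
  rewrite (le_trans (ip_abs _ _))// ler_wpM2r ?nm_ge0// (le_trans (hb _))//.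
  by rewrite ler_pM ?nm_ge0 ?lerDl.
have e3 : k * nm (B u) ^+ 2 = `|l * nm (B u) ^+ 2|.
  by rewrite normrM lk (ger0_norm (sqr_ge0 _)).
have e4 := ler_normB (l * nm (B u) ^+ 2 + ip (B (N u - l%:C%C *: u)) (B u))
  (ip (B (N u - l%:C%C *: u)) (B u)).
rewrite addrK -e3 in e4 => e5.
have Bp : 0 < nm (B u) by apply: lt_le_trans Bu; rewrite !divr_gt0.
have e6 : (k - m) * nm (B u) ^+ 2 <= (b + 1) * d * nm (B u) by rewrite mulrBl; lra.
have e7 : (k - m) * nm (B u) <= (b + 1) * d.
  by rewrite -(ler_pM2r Bp) -mulrA -expr2.
have km : 0 < k - m by rewrite subr_gt0.
have e8 := ler_wpM2l (ltW km) Bu.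
have e9 : 0 < (b + 1) * d by rewrite mulr_gt0.
move: dk2 e7 e8 e9; rewrite mulrCA [d * _]mulrC; lra.
Qed.

End GramSchmidt.

(** * Stability of compact operators *)

Section Compactness.
Context {R : realType}.
Implicit Types (H K : hilbertType R).

Lemma bop_continuous H K (X : H -> K) : bop X -> continuous X.
Proof.
move=> [lX [M M0 hM]] x; apply/cvgrPdist_le => e0 /gt0_complexP[e e_gt0 ->].
have M1 : 0 < M + 1 by rewrite ltr_wpDl.
apply/nbhs_ballP; exists (e / (M + 1))%:C%C; first by rewrite /= ltcR divr_gt0.
move=> y; rewrite -ball_normE/= !normE ltcR lecR => xy.
have bX : bop X by split=> //; exists M.
rewrite -(bopB bX) (le_trans (hM _))// (@le_trans _ _ ((M + 1) * nm (x - y)))//.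
  by rewrite ler_wpM2r ?nm_ge0// lerDl.
by rewrite mulrC -ler_pdivlMr// ltW.
Qed.

Lemma precompact_image H K (X : H -> K) (A : set H) : continuous X ->
  precompact A -> precompact (X @` A).
Proof.
move=> cX; rewrite precompactE => cA.
apply: (@precompact_subset _ _ (X @` closure A)).
  by apply: image_subset; exact: subset_closure.
apply: compact_precompact; first exact: norm_hausdorff.
by apply: continuous_compact => //; exact: continuous_subspaceT.
Qed.

Lemma compact_op_comp H K (X : H -> H) (J : H -> K) (Q : K -> H) : compact_op X ->
  bop J -> bop Q -> (forall u, nm (Q u) <= nm u) -> compact_op (J \o X \o Q).
Proof.
move=> [/bopP bX cX] bJ bQ Q1; split.
  by apply/bopP; apply: bop_comp => //; exact: bop_comp.
apply: (@precompact_subset _ _ (J @` (X @` [set x | `|x| <= 1]))).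
  move=> _ [u /= u1 <-]; exists (X (Q u)) => //; exists (Q u) => //=.
  by apply: le_trans u1; rewrite !normE lecR.
by apply: precompact_image => //; exact: bop_continuous.
Qed.

Lemma compact_op_add H (X Y : H -> H) : compact_op X -> compact_op Y ->
  compact_op (fun u => X u + Y u).
Proof.
move=> [/bopP bX cX] [/bopP bY cY]; split; first by apply/bopP; exact: bop_add.
rewrite !precompactE in cX cY.
set A := closure _ in cX; set B := closure _ in cY.
apply: (@precompact_subset _ _ ((fun z : H * H => z.1 + z.2) @` (A `*` B))).
  move=> _ [u /= u1 <-]; exists (X u, Y u) => //; split=> /=.
    by apply: subset_closure; exists u.
  by apply: subset_closure; exists u.
apply: compact_precompact; first exact: norm_hausdorff.
apply: continuous_compact; last exact: compact_setX.
apply: continuous_subspaceT => z; exact: add_continuous.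
Qed.

Lemma compact_op_scale H (a : R[i]) (X : H -> H) : compact_op X ->
  compact_op (fun u => a *: X u).
Proof.
move=> cX.
exact: (compact_op_comp cX (bop_scale a (bop_id H)) (bop_id H) (fun _ => lexx _)).
Qed.

(** The polar decomposition gives [X^* = W X W], which is compact because [X] is. *)
Lemma compact_adjoint H (X : H -> H) : compact_op X -> compact_op (adjoint X).
Proof.
move=> cX; have [/bopP bX _] := cX.
have [V [W [bV bW [_ W1] [_ _ _ XW]]]] := polar bX.
have -> : adjoint X = W \o X \o W by apply/funext => x; rewrite XW.
exact: compact_op_comp.
Qed.

End Compactness.

(** * Factorisation of the real part of the operator matrix *)

Section Core.
Context {R : realType} {H : hilbertType R}.
Implicit Types (x y z : H) (u v w : dsum H H).

Lemma normc_expi (t : R) : Normc.normc (expi t) = 1.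
Proof. by rewrite /expi /= cos2Dsin2 sqrtr1. Qed.

Lemma normc_conj (a : R[i]) : Normc.normc (conjc a) = Normc.normc a.
Proof. by case: a => b c /=; rewrite sqrrN. Qed.

Lemma ip_scale_adj (K : hilbertType R) (a : R[i]) (x y : K) :
  ip (a *: x) y = ip x (conjc a *: y).
Proof. by rewrite /ip inner_Zl inner_Zr conjcK. Qed.

Lemma dsum_ext (K : hilbertType R) (u v : dsum H K) : u.1 = v.1 -> u.2 = v.2 -> u = v.
Proof. by case: u v => [? ?] [? ?] /= -> ->. Qed.

Variables (T S : H -> H) (f g : R -> R) (e : R[i]).
Hypotheses (bT : bop T) (bS : bop S)
  (cf : {within `[0, +oo[, continuous f}) (cg : {within `[0, +oo[, continuous g})
  (fg : forall x : R, 0 <= x -> f x * g x = x) (e1 : Normc.normc e = 1).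
Let bT' : bop (adjoint T) := bop_adj bT.
Let bS' : bop (adjoint S) := bop_adj bS.

Let M := op_mx 0 T S 0.

Let G1 := fun_calc f (abs_op S) \o fun_calc g (abs_op (adjoint T)).
Let G2 := fun_calc f (abs_op T) \o fun_calc g (abs_op (adjoint S)).
Let PS := (fun_calc f (abs_op S) \o fun_calc f (abs_op S)) +
          (fun_calc g (abs_op S) \o fun_calc g (abs_op S)).
Let PT := (fun_calc f (abs_op T) \o fun_calc f (abs_op T)) +
          (fun_calc g (abs_op T) \o fun_calc g (abs_op T)).

Lemma bop_op_mx : bop M.
Proof.
apply: bop_pair.
  apply: (bop_add (bop_comp (bop_zero H H) (@bop_fst _ H H))).
  by apply: (bop_comp bT); exact: bop_snd.
apply: bop_add; first by apply: (bop_comp bS); exact: bop_fst.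
exact: (bop_comp (bop_zero H H) (@bop_snd _ H H)).
Qed.

Lemma adjoint_op_mx u : adjoint (e *: M) u =
  (conjc e *: adjoint S u.2, conjc e *: adjoint T u.1).
Proof.
have bM : bop (e *: M : dsum H H -> dsum H H) by apply: bop_scale; exact: bop_op_mx.
rewrite (_ : adjoint (e *: M) = fun u => (conjc e *: adjoint S u.2, conjc e *: adjoint T u.1))//.
apply: adj_uniq => // {}u v; rewrite !ip_dsum /M /op_mx /= add0r addr0.
by rewrite !ip_scale_adj !ip_adj// !(bopZ bT', bopZ bS') addrC.
Qed.

Lemma re_op_mxE u : re_op (e *: M) u = (2^-1)%:C%C *:
  ((e *: T u.2 + conjc e *: adjoint S u.2, e *: S u.1 + conjc e *: adjoint T u.1) : dsum H H).
Proof.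
rewrite /re_op adjoint_op_mx; congr (_ *: _); first by rewrite fmorphV/= rmorph_nat.
by rewrite /M /op_mx/= /GRing.scale/= add0r addr0.
Qed.

Lemma selfadj_re_op_mx : selfadj (re_op (e *: M)).
Proof.
have bM : bop (e *: M : dsum H H -> dsum H H) by apply: bop_scale; exact: bop_op_mx.
move=> u v; have h2 : (2^-1 : R[i]) = (2^-1)%:C%C by rewrite fmorphV/= rmorph_nat.
by rewrite /re_op h2 !ipE (ip_adj bM) (ip_adjl bM) addrC.
Qed.

Lemma compact_re_op_mx : compact_op T -> compact_op S -> compact_op (re_op (e *: M)).
Proof.
move=> cT cS; have cT' := compact_adjoint cT; have cS' := compact_adjoint cS.
pose J1 x : dsum H H := (x, 0); pose J2 x : dsum H H := (0, x).
have bJ1 : bop J1 by apply: bop_pair; [exact: bop_id|exact: bop_zero].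
have bJ2 : bop J2 by apply: bop_pair; [exact: bop_zero|exact: bop_id].
have -> : re_op (e *: M) = fun u => (2^-1)%:C%C *:
   (((e *: (J1 \o T \o snd) u) + (conjc e *: (J1 \o adjoint S \o snd) u)) +
    ((e *: (J2 \o S \o fst) u) + (conjc e *: (J2 \o adjoint T \o fst) u))).
  apply/funext => u; rewrite re_op_mxE; congr (_ *: _).
  apply: dsum_ext => /=.
    by rewrite !scaler0 !addr0.
  by rewrite !scaler0 !add0r.
have b1 := @bop_fst _ H H; have b2 := @bop_snd _ H H.
apply: compact_op_scale; apply: compact_op_add; apply: compact_op_add;
  apply: compact_op_scale; apply: compact_op_comp => //; by [exact: nm_snd|exact: nm_fst].
Qed.

(* [K = e U g(|M|)] for the polar decomposition [M = U |M|], and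
   [F = f(|M|)]; then [2 Re(e M) = K F + F K^*]. *)
Lemma block_factorization : exists (F K K' : dsum H H -> dsum H H) (V1 W1 V2 W2 : H -> H),
  [/\ [/\ bop F, bop K, bop K' & selfadj F], forall u v, ip (K u) v = ip u (K' v),
   forall u, re_op (e *: M) u = (2^-1)%:C%C *: (K (F u) + F (K' u)),
   [/\ bop V1, bop V2, forall x y, ip (V1 x) y = ip x (W1 y) & forall x y, ip (V2 x) y = ip x (W2 y)] /\
   [/\ bop W1, bop W2, forall x, nm (V1 x) <= nm x, forall x, nm (V2 x) <= nm x &
   (forall x, nm (W1 x) <= nm x) /\ (forall x, nm (W2 x) <= nm x)] &
   forall w : dsum (dsum H H) (dsum H H),
   `|ip (K w.1 + F w.2) (F w.1 + K w.2)| <=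
     (`|ip (G1 (V1 w.1.2)) w.1.1| + `|ip (G1 (V1 w.2.2)) w.2.1|) +
     (`|ip (G2 (V2 w.1.1)) w.1.2| + `|ip (G2 (V2 w.2.1)) w.2.2|) +
     (ip (PS w.1.1) w.1.1 + ip (PS w.2.1) w.2.1 + (ip (PT w.1.2) w.1.2 + ip (PT w.2.2) w.2.2)) / 2].
Proof.
have pT := posop_abs bT; have pS := posop_abs bS.
have pT' := posop_abs bT'; have pS' := posop_abs bS'.
have [VT [WT [bVT bWT [VT1 WT1] [VWT VTA VTf _]]]] := polar bT.
have [VS [WS [bVS bWS [VS1 WS1] [VWS VSA VSf _]]]] := polar bS.
pose fT := fun_calc f (abs_op T); pose fS := fun_calc f (abs_op S).
pose gT := fun_calc g (abs_op T); pose gS := fun_calc g (abs_op S).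
have VTg x : VT (gT x) = fun_calc g (abs_op (adjoint T)) (VT x) by exact: VTf.
have VSg x : VS (gS x) = fun_calc g (abs_op (adjoint S)) (VS x) by exact: VSf.
have bfT : bop fT := bop_fc cf pT; have bfS : bop fS := bop_fc cf pS.
have bgT : bop gT := bop_fc cg pT; have bgS : bop gS := bop_fc cg pS.
have sfT : selfadj fT := selfadj_fc cf pT; have sfS : selfadj fS := selfadj_fc cf pS.
have sgT : selfadj gT := selfadj_fc cg pT; have sgS : selfadj gS := selfadj_fc cg pS.
have ch := @continuous_horner_nneg R 'X.
have gf t : 0 <= t -> g t * f t = 'X.[t] by move=> t0; rewrite mulrC fg// hornerX.
have fg' t : 0 <= t -> f t * g t = 'X.[t] by move=> t0; rewrite fg// hornerX.
have idX A : posop A -> forall x, fun_calc (fun t => 'X.[t]) A x = A x.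
  by move=> pA; apply: fc_id => // t _; rewrite hornerX.
have gfT x : gT (fT x) = abs_op T x by rewrite /gT /fT (fc_mul cg cf ch pT gf) idX.
have gfS x : gS (fS x) = abs_op S x by rewrite /gS /fS (fc_mul cg cf ch pS gf) idX.
have fgT x : fT (gT x) = abs_op T x by rewrite /gT /fT (fc_mul cf cg ch pT fg') idX.
have fgS x : fS (gS x) = abs_op S x by rewrite /gS /fS (fc_mul cf cg ch pS fg') idX.
have [bAT sAT _] := pT; have [bAS sAS _] := pS.
have adjT x : adjoint T x = abs_op T (WT x).
  by apply: ip_ext => z; rewrite -ip_adj// -sAT -VWT VTA.
have adjS x : adjoint S x = abs_op S (WS x).
  by apply: ip_ext => z; rewrite -ip_adj// -sAS -VWS VSA.
pose F u : dsum H H := (fS u.1, fT u.2).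
pose K u : dsum H H := (e *: VT (gT u.2), e *: VS (gS u.1)).
pose K' u : dsum H H := (conjc e *: gS (WS u.2), conjc e *: gT (WT u.1)).
pose V1 x := e *: VT x; pose V2 x := e *: VS x.
pose W1 x := conjc e *: WT x; pose W2 x := conjc e *: WS x.
have b1 := @bop_fst _ H H; have b2 := @bop_snd _ H H.
have bK : bop K.
  by apply: bop_pair; apply: bop_scale; [apply: (bop_comp bVT); exact: (bop_comp bgT b2)|
     apply: (bop_comp bVS); exact: (bop_comp bgS b1)].
have e1' : Normc.normc (conjc e) = 1 by rewrite normc_conj.
have KK' u v : ip (K u) v = ip u (K' v).
  rewrite !ip_dsum /K /K' /= !ip_scale_adj VWT VWS sgT sgS.
  by rewrite !(bopZ bWT, bopZ bWS, bopZ bgS, bopZ bgT) addrC.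
exists F, K, K', V1, W1, V2, W2; split.
- split=> //.
  + by apply: bop_pair; [exact: (bop_comp bfS b1)|exact: (bop_comp bfT b2)].
  + by apply: bop_pair; apply: bop_scale; [apply: (bop_comp bgS); exact: (bop_comp bWS b2)|
       apply: (bop_comp bgT); exact: (bop_comp bWT b1)].
  + by move=> u v; rewrite !ip_dsum /= sfS sfT.
- exact: KK'.
- move=> u; rewrite re_op_mxE; congr (_ *: _).
  apply: dsum_ext => /=.
    by rewrite gfT VTA (bopZ bfS) fgS adjS.
  by rewrite gfS VSA (bopZ bfT) fgT adjT.
- split; split; first exact: bop_scale.
  + exact: bop_scale.
  + by move=> x y; rewrite ip_scale_adj VWT (bopZ bWT).
  + by move=> x y; rewrite ip_scale_adj VWS (bopZ bWS).
  + exact: bop_scale.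
  + exact: bop_scale.
  + by move=> x; rewrite nmZ e1 mul1r.
  + by move=> x; rewrite nmZ e1 mul1r.
  + by split=> x; rewrite nmZ e1' mul1r.
move=> [[x1 x2] [y1 y2]] /=; set x : dsum H H := (x1, x2); set y : dsum H H := (y1, y2).
have gV1 z : fun_calc g (abs_op (adjoint T)) (V1 z) = e *: VT (gT z).
  by rewrite VTg; exact: (bopZ (bop_fc cg pT')).
have gV2 z : fun_calc g (abs_op (adjoint S)) (V2 z) = e *: VS (gS z).
  by rewrite VSg; exact: (bopZ (bop_fc cg pS')).
(* Here [f] and [g] of different operators meet: [F] is moved to the left of [K], and intertwining
   carries the polar parts across [g], turning [|T|] into [|T^*|] and [|S|] into [|S^*|]. *)
have diag u : ip (K u) (F u) = ip (G1 (V1 u.2)) u.1 + ip (G2 (V2 u.1)) u.2.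
  rewrite ip_dsum; congr (_ + _).
    change (ip (e *: VT (gT u.2)) (fS u.1) =
      ip (fS (fun_calc g (abs_op (adjoint T)) (V1 u.2))) u.1).
    by rewrite gV1 sfS.
  change (ip (e *: VS (gS u.1)) (fT u.2) =
    ip (fT (fun_calc g (abs_op (adjoint S)) (V2 u.1))) u.2).
  by rewrite gV2 sfT.
have ipPS z : ip (PS z) z = nm (fS z) ^+ 2 + nm (gS z) ^+ 2.
  by rewrite [PS z]/(fS (fS z) + gS (gS z)) ipDl sfS sgS !ipxx.
have ipPT z : ip (PT z) z = nm (fT z) ^+ 2 + nm (gT z) ^+ 2.
  by rewrite [PT z]/(fT (fT z) + gT (gT z)) ipDl sfT sgT !ipxx.
have nmF u : nm (F u) ^+ 2 = nm (fS u.1) ^+ 2 + nm (fT u.2) ^+ 2 by rewrite nm_dsum.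
have nmK u : nm (K u) ^+ 2 <= nm (gT u.2) ^+ 2 + nm (gS u.1) ^+ 2.
  rewrite nm_dsum /= !nmZ e1 !mul1r.
  by rewrite lerD// ler_pXn2r// ?nnegrE ?nm_ge0.
have am (a b : dsum H H) : `|ip a b| <= (nm a ^+ 2 + nm b ^+ 2) / 2.
  apply: le_trans (ip_abs _ _) _; have := sqr_ge0 (nm a - nm b); rewrite sqrrB; lra.
have E : ip (K x + F y) (F x + K y) =
    (ip (G1 (V1 x2)) x1 + ip (G2 (V2 x1)) x2 + (ip (G1 (V1 y2)) y1 + ip (G2 (V2 y1)) y2)) +
    (ip (F y) (F x) + ip (K x) (K y)).
  rewrite -(diag x) -(diag y) ipDl !ipDr (ipC (F y) (K y)).
  move: (ip (K x) (F x)) (ip (K y) (F y)) (ip (F y) (F x)) (ip (K x) (K y)) => ? ? ? ?.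
  by ring.
(* The off-diagonal terms are split by the arithmetic-geometric mean inequality; the [F] terms give
   [f^2], the [K] terms [g^2]. *)
have cross : `|ip (F y) (F x) + ip (K x) (K y)| <=
    (ip (PS x1) x1 + ip (PS y1) y1 + (ip (PT x2) x2 + ip (PT y2) y2)) / 2.
  rewrite (ipPS x1) (ipPS y1) (ipPT x2) (ipPT y2).
  apply: le_trans (ler_normD _ _) _; apply: le_trans (lerD (am _ _) (am _ _)) _.
  have := nmK x; have := nmK y; rewrite (nmF x) (nmF y) /x /y /=.
  move: (nm (K _) ^+ 2) (nm (K _) ^+ 2) (nm (fS _) ^+ 2) (nm (fT _) ^+ 2).
  move: (nm (fS _) ^+ 2) (nm (fT _) ^+ 2) (nm (gT _) ^+ 2) (nm (gT _) ^+ 2) => ? ? ? ? ? ? ? ?.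
  by move: (nm (gS _) ^+ 2) (nm (gS _) ^+ 2) => ? ?; lra.
rewrite E; apply: le_trans (ler_normD _ _) _; apply: lerD; last exact: cross.
apply: le_trans (ler_normD _ _) _.
by apply: le_trans (lerD (ler_normD _ _) (ler_normD _ _)) _; rewrite addrACA.
Qed.

End Core.

(** * The Schatten norm bound *)

Section SchattenNorm.
Context {R : realType} {H : hilbertType R}.
Implicit Types (X : H -> H) (r : R).

Lemma schatten_trace_ge0 r X : 1 <= r -> bop X -> (0 <= schatten_trace r X)%E.
Proof.
move=> r1 bX; apply: esum_ge0 => u _; rewrite lee_fin.
by have [_ _ h] := posop_powR r1 bX; exact: h.
Qed.

(** Separates an infinite norm from a norm that is the root of a real trace. *)
Lemma schatten_norm_alt r X : 1 <= r -> schatten_norm r%:E X = +oo%E \/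
  exists t : R, [/\ 0 <= t, bop X, (schatten_trace r X <= t%:E)%E &
    schatten_norm r%:E X = (t `^ r^-1)%:E].
Proof.
move=> r1; rewrite /schatten_norm; case: asboolP => [[[/bopP bX _] fX]|_]; last by left.
right; have X0 := schatten_trace_ge0 r1 bX.
have /fineK h : schatten_trace r X \is a fin_num by rewrite ge0_fin_numE.
exists (fine (schatten_trace r X)); split=> //; first exact: fine_ge0.
  by rewrite h.
by rewrite -{1}h.
Qed.

Lemma schatten_norm_le r X (b : R) : 1 <= r -> compact_op X -> 0 <= b ->
  (schatten_trace r X <= (b `^ r)%:E)%E -> (schatten_norm r%:E X <= b%:E)%E.
Proof.
move=> r1 cX b0 hX; have r0 : 0 < r by rewrite (lt_le_trans ltr01).
have fX : (schatten_trace r X < +oo)%E by rewrite (le_lt_trans hX) ?ltry.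
have X0 : (0 <= schatten_trace r X)%E.
  by apply: schatten_trace_ge0 => //; apply/bopP; case: cX.
have /fineK h : schatten_trace r X \is a fin_num by rewrite ge0_fin_numE.
have cl : schatten_class r%:E X by split.
rewrite /schatten_norm (asboolT cl) -h poweR_EFin lee_fin.
have -> : b = (b `^ r) `^ r^-1 by rewrite -powRrM mulfV ?gt_eqF// powRr1.
apply: ge0_ler_powR; rewrite ?nnegrE ?invr_ge0 ?(ltW r0) ?powR_ge0 ?fine_ge0//.
by rewrite -lee_fin h.
Qed.

Lemma schatten_norm_ge0 r X : (0 <= schatten_norm r%:E X)%E.
Proof. by rewrite /schatten_norm; case: ifP => // _; exact: poweR_ge0. Qed.

Lemma opnorm_alt X : bop X -> exists2 m : R, 0 <= m &
  opnorm X = m%:E /\ forall x, nm (X x) <= m * nm x.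
Proof.
move=> bX; have [_ [M M0 hM]] := bX.
have h : (opnorm X <= M%:E)%E by apply/opnorm_le.
have X0 := opnorm_ge0 bX.
have /fineK fX : opnorm X \is a fin_num by rewrite ge0_fin_numE// (le_lt_trans h) ?ltry.
exists (fine (opnorm X)); first exact: fine_ge0.
by split=> //; apply/(opnorm_le bX (fine_ge0 X0)); rewrite fX.
Qed.

End SchattenNorm.

(** * The bound for an abstract factorisation *)

Section Bounds.
Context {R : realType} {H : hilbertType R}.
Local Notation HH := (dsum H H).
Local Notation W4 := (dsum HH HH).
Variables (N F K K' : HH -> HH) (G1 G2 PS PT V1 W1 V2 W2 : H -> H).
Hypotheses (bF : bop F) (bK : bop K) (bK' : bop K') (sF : selfadj F)
  (KK' : forall u v, ip (K u) v = ip u (K' v))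
  (NE : forall u, N u = (2^-1)%:C%C *: (K (F u) + F (K' u)))
  (VW1 : forall x y, ip (V1 x) y = ip x (W1 y)) (VW2 : forall x y, ip (V2 x) y = ip x (W2 y))
  (bW1 : bop W1) (bW2 : bop W2)
  (V1c : forall x, nm (V1 x) <= nm x) (V2c : forall x, nm (V2 x) <= nm x)
  (W1c : forall x, nm (W1 x) <= nm x) (W2c : forall x, nm (W2 x) <= nm x)
  (key : forall w : W4, `|ip (K w.1 + F w.2) (F w.1 + K w.2)| <=
     (`|ip (G1 (V1 w.1.2)) w.1.1| + `|ip (G1 (V1 w.2.2)) w.2.1|) +
     (`|ip (G2 (V2 w.1.1)) w.1.2| + `|ip (G2 (V2 w.2.1)) w.2.2|) +
     (ip (PS w.1.1) w.1.1 + ip (PS w.2.1) w.2.1 + (ip (PT w.1.2) w.1.2 + ip (PT w.2.2) w.2.2)) / 2).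

Lemma nm_dsum4 (w : W4) : nm w ^+ 2 =
  nm w.1.1 ^+ 2 + nm w.1.2 ^+ 2 + (nm w.2.1 ^+ 2 + nm w.2.2 ^+ 2).
Proof. by rewrite nm_dsum !(nm_dsum w.1, nm_dsum w.2). Qed.

(** [norm_swap] bounds [2 N] by [m]: each diagonal pair contributes half of its [a], the
    off-diagonal part half of the maximum. The real part halves once more, whence the denominator
    4. *)
Lemma opnorm_re_op_mx (a1 a2 b1 b2 : R) : 0 <= a1 -> 0 <= a2 -> 0 <= b1 -> 0 <= b2 ->
  (forall x, nm (G1 x) <= a1 * nm x) -> (forall x, nm (G2 x) <= a2 * nm x) ->
  (forall x, nm (PS x) <= b1 * nm x) -> (forall x, nm (PT x) <= b2 * nm x) ->
  (opnorm N <= ((a1 + a2 + Num.max b1 b2) / 4)%:E)%E.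
Proof.
move=> a10 a20 b10 b20 hG1 hG2 hPS hPT.
pose b := Num.max b1 b2.
have b0 : 0 <= b by rewrite le_max b10.
pose m := (a1 + a2 + b) / 2.
have m0 : 0 <= m by rewrite divr_ge0// !addr_ge0.
have hKF u : nm (K (F u) + F (K' u)) <= m * nm u.
  apply: (norm_swap bF bK bK' sF KK' m0) => w.
  apply: le_trans (key w) _; rewrite nm_dsum4.
  have gb (G V : H -> H) (a : R) x y : 0 <= a -> (forall x, nm (G x) <= a * nm x) ->
      (forall x, nm (V x) <= nm x) ->
      `|ip (G (V x)) y| <= a * (nm x ^+ 2 + nm y ^+ 2) / 2.
    move=> a0 hG hV; apply: le_trans (ip_abs _ _) _.
    apply: (@le_trans _ _ (a * nm x * nm y)).
      rewrite ler_wpM2r ?nm_ge0// (le_trans (hG _))// ler_wpM2l//.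
    rewrite -!mulrA ler_wpM2l// ler_pdivlMr//.
    by have := sqr_ge0 (nm x - nm y); rewrite sqrrB; lra.
  have pb (P : H -> H) (a : R) x : a <= b -> (forall x, nm (P x) <= a * nm x) ->
      ip (P x) x <= b * nm x ^+ 2.
    move=> ab hP; apply: le_trans (ip_le _ _) _.
    rewrite expr2 mulrA ler_wpM2r ?nm_ge0// (le_trans (hP _))// ler_wpM2r ?nm_ge0//.
  have b1b : b1 <= b by rewrite le_max lexx.
  have b2b : b2 <= b by rewrite le_max lexx orbT.
  have := gb _ _ _ w.1.2 w.1.1 a10 hG1 V1c; have := gb _ _ _ w.2.2 w.2.1 a10 hG1 V1c.
  have := gb _ _ _ w.1.1 w.1.2 a20 hG2 V2c; have := gb _ _ _ w.2.1 w.2.2 a20 hG2 V2c.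
  have := pb _ _ w.1.1 b1b hPS; have := pb _ _ w.2.1 b1b hPS.
  have := pb _ _ w.1.2 b2b hPT; have := pb _ _ w.2.2 b2b hPT.
  rewrite /m.
  set p1 := ip _ _; set p2 := ip _ _; set p3 := ip _ _; set p4 := ip _ _.
  set n1 := nm _ ^+ 2; set n2 := nm _ ^+ 2; set n3 := nm _ ^+ 2; set n4 := nm _ ^+ 2.
  lra.
have bN : bop N.
  have -> : N = fun u => (2^-1)%:C%C *: (K (F u) + F (K' u)) by apply/funext => u; exact: NE.
  apply: bop_scale; apply: bop_add; [exact: (bop_comp bK bF)|exact: (bop_comp bF bK')].
apply/(opnorm_le bN); first by rewrite divr_ge0// !addr_ge0.
move=> u; rewrite NE nmZR ger0_norm// -/b.
have -> : (a1 + a2 + b) / 4 * nm u = 2^-1 * (m * nm u) by rewrite /m; field.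
by rewrite ler_wpM2l.
Qed.

(** Components of an orthonormal family keep Bessel's inequality, as testing against vectors
    supported on one summand shows. *)
Lemma bessel4 n (w : nat -> W4) (z : H) : orthonormal_on (iota 0 n) w ->
  [/\ \sum_(i <- iota 0 n) msq (w i).1.1 z <= nm z ^+ 2,
      \sum_(i <- iota 0 n) msq (w i).1.2 z <= nm z ^+ 2,
      \sum_(i <- iota 0 n) msq (w i).2.1 z <= nm z ^+ 2 &
      \sum_(i <- iota 0 n) msq (w i).2.2 z <= nm z ^+ 2].
Proof.
move=> ow; have us := iota_uniq 0 n; split.
- have := bessel_le (((z, 0) : HH, 0) : W4) us ow; rewrite !nm_dsum1.
  by under eq_bigr do rewrite !msq_dsum1.
- have := bessel_le (((0, z) : HH, 0) : W4) us ow; rewrite nm_dsum1 nm_dsum2.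
  by under eq_bigr do rewrite msq_dsum1 msq_dsum2.
- have := bessel_le ((0, (z, 0) : HH) : W4) us ow; rewrite nm_dsum2 nm_dsum1.
  by under eq_bigr do rewrite msq_dsum2 msq_dsum1.
- have := bessel_le ((0, (0, z) : HH) : W4) us ow; rewrite !nm_dsum2.
  by under eq_bigr do rewrite !msq_dsum2.
Qed.

Lemma powR2_scale (r a b t : R) : 0 < r -> 0 <= t -> a * r = b ->
  (2 `^ a * t `^ r^-1) `^ r = 2 `^ b * t.
Proof.
move=> r0 t0 ab; rewrite powRM ?powR_ge0// -!powRrM ab mulVf ?gt_eqF//.
by rewrite powRr1.
Qed.

Lemma powR2D (a b : R) : 2 `^ a * 2 `^ b = 2 `^ (a + b) :> R.
Proof. by rewrite powRD// (gt_eqF (ltr0Sn R 1)) implybT. Qed.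

Lemma powR_half (r : R) : (2^-1 : R) `^ r = 2 `^ (- r).
Proof. by rewrite -powR_inv1// -powRrM mulN1r. Qed.

(** It suffices to bound finite sums over nonzero eigenvalues of [N]. After [eigen_swap] each
    eigenvalue is dominated by three terms, whose [r]-norms over the family are at most [A1], [A2],
    [A3]; Minkowski's inequality is used twice. *)
Lemma schatten_norm_re_op_mx (r t1 t2 tS tT : R) : 1 <= r ->
  compact_op N -> selfadj N ->
  0 <= t1 -> 0 <= t2 -> 0 <= tS -> 0 <= tT ->
  bop G1 -> bop G2 -> bop PS -> bop PT ->
  (schatten_trace r G1 <= t1%:E)%E -> (schatten_trace r G2 <= t2%:E)%E ->
  (schatten_trace r PS <= tS%:E)%E -> (schatten_trace r PT <= tT%:E)%E ->
  (schatten_norm r%:E N <= (2 `^ (2 * r^-1 - 2) * (t1 `^ r^-1 + t2 `^ r^-1) +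
     2 `^ (r^-1 - 2) * (tS + tT) `^ r^-1)%:E)%E.
Proof.
have aux1 (a b c d : R) : 1 = a + b + (c + d) ->
    a + a + (c + c) + (b + b + (d + d)) <= 2 by lra.
have aux2 (a b c d k : R) : 2 * k <= a + b + c / 2 -> c <= d ->
    k <= a / 2 + b / 2 + d / 4 by lra.
move=> r1 cN sN t10 t20 tS0 tT0 bG1 bG2 bPS bPT hG1 hG2 hPS hPT.
have r0 : 0 < r by rewrite (lt_le_trans ltr01).
pose A1 := 2 `^ (2 * r^-1 - 2) * t1 `^ r^-1.
pose A2 := 2 `^ (2 * r^-1 - 2) * t2 `^ r^-1.
pose A3 := 2 `^ (r^-1 - 2) * (tS + tT) `^ r^-1.
have A10 : 0 <= A1 by rewrite mulr_ge0 ?powR_ge0.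
have A20 : 0 <= A2 by rewrite mulr_ge0 ?powR_ge0.
have A30 : 0 <= A3 by rewrite mulr_ge0 ?powR_ge0.
rewrite mulrDr -/A1 -/A2 -/A3.
apply: schatten_norm_le => //; first by rewrite !addr_ge0.
apply: schatten_trace_le => //.
move=> n u l ou hu.
(* [N] is half of [K F + F K'], so the eigenvalues of the latter are [2 l i]. *)
have [|w [ow hw]] := @eigen_swap _ _ F K K' bF bK bK' sF KK' u (fun i => 2 * l i) n ou.
  move=> i /hu[]; rewrite NE => h l0; split; last by rewrite mulf_neq0.
  rewrite rmorphM/= -scalerA -h scalerA -rmorphM/= mulfV// scale1r//.
have nw i : i \in iota 0 n -> nm (w i) ^+ 2 = 1.
  by move=> iin; rewrite -ipxx /ip ow// eqxx.
have VWc (V W : H -> H) : bop W -> (forall x, nm (W x) <= nm x) ->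
    (forall x y, ip (V x) y = ip x (W y)) -> forall (p : nat -> H),
    (forall z, \sum_(i <- iota 0 n) msq (p i) z <= nm z ^+ 2) ->
    forall z, \sum_(i <- iota 0 n) msq (V (p i)) z <= nm z ^+ 2.
  move=> bW Wc VW p hp z.
  under eq_bigr do rewrite (msq_adj (V := W) (W := V) (bopZ bW)
    (fun x y => etrans (ipC _ _) (etrans (esym (VW y x)) (ipC _ _)))).
  by rewrite (le_trans (hp _))// ler_pXn2r// ?nnegrE ?nm_ge0.
(* [c = 1 / 2]: the four component vectors have total squared norm at most 1 *)
have diag (G V W : H -> H) (t : R) (p q : bool -> W4 -> H) : bop G -> bop W ->
    (forall x, nm (W x) <= nm x) -> (forall x y, ip (V x) y = ip x (W y)) ->
    (forall x, nm (V x) <= nm x) -> (schatten_trace r G <= t%:E)%E -> 0 <= t ->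
    (forall j z, \sum_(i <- iota 0 n) msq (p j (w i)) z <= nm z ^+ 2) ->
    (forall j z, \sum_(i <- iota 0 n) msq (q j (w i)) z <= nm z ^+ 2) ->
    (forall v, nm (p true v) ^+ 2 + nm (q true v) ^+ 2 +
       (nm (p false v) ^+ 2 + nm (q false v) ^+ 2) = nm v ^+ 2) ->
    \sum_(i <- iota 0 n) ((`|ip (G (V (p true (w i)))) (q true (w i))| +
       `|ip (G (V (p false (w i)))) (q false (w i))|) / 2) `^ r <=
    (2 `^ (2 * r^-1 - 2) * t `^ r^-1) `^ r.
  move=> bG bW Wc VW Vc hG t0 hp hq pq.
  have := @schatten_jensen R H r _ (iota 0 n) bool (fun=> G)
    (fun i j => V (p j (w i))) (fun i j => q j (w i)) 2^-1 (fun=> t) r1 (fun=> bG)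
    ltac:(by rewrite invr_gt0).
  move=> /(_ _ _ hq (fun=> hG)) jen.
  have {jen} : \sum_(i <- iota 0 n) (\sum_(j : bool) `|ip (G (V (p j (w i)))) (q j (w i))|) `^ r <=
      2^-1 `^ (r - 1) * \sum_(j : bool) t.
    apply: jen => [i iin|j]; last exact: (VWc V W bW Wc VW (fun i => p j (w i)) (hp j)).
    rewrite mulfV// big_bool/= -(nw i iin) -(pq (w i)).
    by rewrite !lerD// ler_pXn2r// ?nnegrE ?nm_ge0.
  rewrite big_bool/= => jen.
  (* The exponent collects [- r] from the halving of the sum, [1 - r] from [c = 1/2], and 1 from the
     two blocks containing [G]. *)
  rewrite (powR2_scale (b := 2 - 2 * r))//; last by field; rewrite gt_eqF.
  rewrite (eq_bigr (fun i => 2 `^ (- r) * (\sum_(j : bool) `|ip (G (V (p j (w i)))) (q j (w i))|) `^ r)).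
    rewrite -mulr_sumr (_ : 2 `^ (2 - 2 * r) * t = 2 `^ (- r) * (2^-1 `^ (r - 1) * (t + t))).
      by rewrite ler_wpM2l ?powR_ge0.
    rewrite powR_half mulrA powR2D.
    have -> : t + t = 2 `^ 1 * t by rewrite powRr1// mulr_natl mulr2n.
    by rewrite mulrA powR2D; congr (2 `^ _ * _); ring.
  move=> i _; rewrite big_bool/= powRM ?addr_ge0 ?invr_ge0//.
  by rewrite powR_half mulrC.
have bes z := bessel4 z ow.
have d1 := diag G1 V1 W1 t1 (fun j v => if j then v.1.2 else v.2.2)
  (fun j v => if j then v.1.1 else v.2.1) bG1 bW1 W1c VW1 V1c hG1 t10.
have {}d1 := d1 ltac:(by case=> z; have [] := bes z) ltac:(by case=> z; have [] := bes z)
  ltac:(by move=> v; rewrite (nm_dsum4 v) /=; ring).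
have d2 := diag G2 V2 W2 t2 (fun j v => if j then v.1.1 else v.2.1)
  (fun j v => if j then v.1.2 else v.2.2) bG2 bW2 W2c VW2 V2c hG2 t20.
have {}d2 := d2 ltac:(by case=> z; have [] := bes z) ltac:(by case=> z; have [] := bes z)
  ltac:(by move=> v; rewrite (nm_dsum4 v) /=; ring).
rewrite /= in d1 d2.
pose o i := ip (PS (w i).1.1) (w i).1.1 + ip (PS (w i).2.1) (w i).2.1 +
  (ip (PT (w i).1.2) (w i).1.2 + ip (PT (w i).2.2) (w i).2.2).
pose o' i := `|ip (PS (w i).1.1) (w i).1.1| + `|ip (PS (w i).2.1) (w i).2.1| +
  (`|ip (PT (w i).1.2) (w i).1.2| + `|ip (PT (w i).2.2) (w i).2.2|).
have oo' i : o i <= o' i by rewrite !lerD ?ler_norm.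
have d3 : \sum_(i <- iota 0 n) (o' i / 4) `^ r <= A3 `^ r.
  pose p (j : bool * bool) (v : W4) : H :=
    if j.1 then (if j.2 then v.1.1 else v.2.1) else (if j.2 then v.1.2 else v.2.2).
  have hp j z : \sum_(i <- iota 0 n) msq (p j (w i)) z <= nm z ^+ 2.
    by have [] := bes z; case: j => [[] []].
  have big4 (Q : bool * bool -> R) : \sum_j Q j =
      Q (true, true) + Q (true, false) + (Q (false, true) + Q (false, false)).
    rewrite -(eq_bigr _ (fun j _ => congr1 Q (esym (surjective_pairing j)))).
    by rewrite -(pair_bigA _ (fun a b => Q (a, b)))/= !big_bool.
  (* Both vectors of a pair are the same component, so the squares add up to [2 |w|^2 = 2] and
     [c = 1]. *)
  have := @schatten_jensen R H r _ (iota 0 n) (bool * bool)%type (fun j => if j.1 then PS else PT)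
    (fun i j => p j (w i)) (fun i j => p j (w i)) 1 (fun j => if j.1 then tS else tT) r1 
    ltac:(by case=> [[] b]) ltr01.
  move=> /(_ _ hp hp) jen.
  have {jen} : \sum_(i <- iota 0 n) (o' i) `^ r <= 1 `^ (r - 1) * (tS + tS + (tT + tT)).
    have := jen _ ltac:(by case=> [[] b]); rewrite big4/=.
    under eq_bigr do rewrite big4/=.
    apply=> i iin; rewrite big4 /p /= mulr1; have := nm_dsum4 (w i); rewrite nw//.
    exact: aux1.
  rewrite powR1 mul1r => jen.
  (* The exponent collects [- 2 r] from the factor 1/4, and 1 because [PS] and [PT] are each tested
     on two components. *)
  rewrite /A3 (powR2_scale (b := 1 - 2 * r)) ?addr_ge0//; last by field; rewrite gt_eqF.
  have four : (4^-1 : R) `^ r = 2 `^ (- (2 * r)).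
    have -> : (4^-1 : R) = 2^-1 * 2^-1 by rewrite -invfM -natrM.
    by rewrite powRM ?invr_ge0// !powR_half powR2D -opprD mulr_natl mulr2n.
  rewrite (eq_bigr (fun i => 2 `^ (- (2 * r)) * (o' i) `^ r)).
    rewrite -mulr_sumr -powR2D [2 `^ 1 * _]mulrC -mulrA ler_wpM2l ?powR_ge0//.
    by rewrite powRr1// mulr_natl mulr2n addrACA.
  by move=> i _; rewrite powRM ?invr_ge0 ?addr_ge0// four mulrC.
have lle i : i \in iota 0 n -> `|l i| <=
    ((`|ip (G1 (V1 (w i).1.2)) (w i).1.1| + `|ip (G1 (V1 (w i).2.2)) (w i).2.1|) / 2 +
     (`|ip (G2 (V2 (w i).1.1)) (w i).1.2| + `|ip (G2 (V2 (w i).2.1)) (w i).2.2|) / 2) + o' i / 4.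
  rewrite mem_iota add0n => /= iin; have := key (w i); rewrite hw// normrM ger0_norm//.
  by move=> /aux2; apply; exact: oo'.
apply: (@le_trans _ _ (\sum_(i <- iota 0 n)
    (((`|ip (G1 (V1 (w i).1.2)) (w i).1.1| + `|ip (G1 (V1 (w i).2.2)) (w i).2.1|) / 2 +
     (`|ip (G2 (V2 (w i).1.1)) (w i).1.2| + `|ip (G2 (V2 (w i).2.1)) (w i).2.2|) / 2) +
     o' i / 4) `^ r)).
  rewrite big_seq [leRHS]big_seq; apply: ler_sum => i iin.
  apply: ge0_ler_powR; rewrite ?nnegrE ?(ltW r0)//; last exact: lle.
  by apply: le_trans (lle i iin).
have o'0 i : 0 <= o' i / 4 by rewrite divr_ge0// !addr_ge0.
have half0 (x y : R) : 0 <= (`|x| + `|y|) / 2 by rewrite divr_ge0// addr_ge0.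
have half1 i := addr_ge0 (half0 (ip (G1 (V1 (w i).1.2)) (w i).1.1) (ip (G1 (V1 (w i).2.2)) (w i).2.1))
  (half0 (ip (G2 (V2 (w i).1.1)) (w i).1.2) (ip (G2 (V2 (w i).2.1)) (w i).2.2)).
apply: (powR_minkowski r1 half1 o'0 (addr_ge0 A10 A20) A30 _ d3).
exact: (powR_minkowski r1 _ _ A10 A20 d1 d2).
Qed.

(** For finite [p] an infinite norm on the right makes the whole right side infinite, because its
    coefficients are positive powers of 2; otherwise the estimate between real traces applies. *)
Lemma schatten_norm_bound (p : \bar R) : selfadj N -> bop G1 -> bop G2 -> bop PS -> bop PT ->
  (1 <= p)%E -> (p \is a fin_num -> compact_op N) ->
  (schatten_norm p N <= (2 `^ (2 * inv_exp p - 2))%R%:E *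
     (schatten_norm p G1 + schatten_norm p G2) +
   (2 `^ (inv_exp p - 2))%R%:E * lp_sum p (schatten_norm p PS) (schatten_norm p PT))%E.
Proof.
move=> sN bG1 bG2 bPS bPT.
case: p => [r r1 cN|_ _|//]; last first.
  rewrite /inv_exp mulr0 sub0r /lp_sum /schatten_norm.
  have [a1 a10 [-> hG1]] := opnorm_alt bG1; have [a2 a20 [-> hG2]] := opnorm_alt bG2.
  have [b1 b10 [-> hPS]] := opnorm_alt bPS; have [b2 b20 [-> hPT]] := opnorm_alt bPT.
  have := opnorm_re_op_mx a10 a20 b10 b20 hG1 hG2 hPS hPT.
  rewrite -EFin_max -(EFinD a1 a2) -!EFinM -EFinD => /le_trans; apply; rewrite lee_fin.
  have -> : 2 `^ (- 2) = 4^-1 :> R.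
    by rewrite powRN (powR_mulrn 2)// -natrX.
  by rewrite -mulrDr mulrC.
rewrite lee_fin in r1; have r0 : 0 < r by rewrite (lt_le_trans ltr01).
have rV0 : 0 < r^-1 by rewrite invr_gt0.
have {}cN := cN isT.
rewrite /inv_exp /lp_sum.
set c1 := 2 `^ _; set c2 := 2 `^ _.
have c10 : (0 < c1%:E)%E by rewrite lte_fin powR_gt0.
have c20 : (0 < c2%:E)%E by rewrite lte_fin powR_gt0.
have lp0 : (0 <= c2%:E * (schatten_norm r%:E PS `^ r + schatten_norm r%:E PT `^ r) `^ r^-1)%E.
  by rewrite mule_ge0 ?(ltW c20)// poweR_ge0.
have d0 : (0 <= c1%:E * (schatten_norm r%:E G1 + schatten_norm r%:E G2))%E.
  by rewrite mule_ge0 ?(ltW c10)// adde_ge0 ?schatten_norm_ge0.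
have [e1|[t1 [t10 _ h1 e1]]] := schatten_norm_alt G1 r1.
  rewrite e1 addye ?gt_eqF ?(lt_le_trans _ (schatten_norm_ge0 r G2)) ?ltNy0//.
  rewrite gt0_muley// addye ?leey// gt_eqF// (lt_le_trans _ lp0)// ltNy0.
have [e2|[t2 [t20 _ h2 e2]]] := schatten_norm_alt G2 r1.
  rewrite e2 addey ?gt_eqF ?(lt_le_trans _ (schatten_norm_ge0 r G1)) ?ltNy0//.
  rewrite gt0_muley// addye ?leey// gt_eqF// (lt_le_trans _ lp0)// ltNy0.
have [e3|[tS [tS0 _ h3 e3]]] := schatten_norm_alt PS r1.
  rewrite e3 poweRyr ?gt_eqF// addye ?gt_eqF ?(lt_le_trans _ (poweR_ge0 _ _)) ?ltNy0//.
  rewrite poweRyr ?gt_eqF// gt0_muley// addey ?leey// gt_eqF// (lt_le_trans _ d0)// ltNy0.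
have [e4|[tT [tT0 _ h4 e4]]] := schatten_norm_alt PT r1.
  rewrite e4 poweRyr ?gt_eqF// addey ?gt_eqF ?(lt_le_trans _ (poweR_ge0 _ _)) ?ltNy0//.
  rewrite poweRyr ?gt_eqF// gt0_muley// addey ?leey// gt_eqF// (lt_le_trans _ d0)// ltNy0.
rewrite e1 e2 e3 e4 !poweR_EFin.
rewrite -(EFinD (t1 `^ _)) -!EFinM -EFinD.
rewrite -!powRrM !mulVf ?gt_eqF// !powRr1//.
exact: (schatten_norm_re_op_mx r1 cN sN
  t10 t20 tS0 tT0 bG1 bG2 bPS bPT h1 h2 h3 h4).
Qed.

End Bounds.

Theorem theorem2p3 (R : realType) (H : hilbertType R) (p : \bar R)
    (T S : H -> H) (f g : R -> R)
    (H_separable : separable_hilbert H)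
    (p_ge1 : (1 <= p)%E)
    (TCp : schatten_class p T) (SCp : schatten_class p S)
    (f_cont : {within `[0, +oo[, continuous f})
    (g_cont : {within `[0, +oo[, continuous g})
    (f_ge0 : forall x : R, 0 <= x -> 0 <= f x)
    (g_ge0 : forall x : R, 0 <= x -> 0 <= g x)
    (fg : forall x : R, 0 <= x -> f x * g x = x) :
  (num_radius p (op_mx 0%R T S 0%R) <=
   (2 `^ (2 * inv_exp p - 2))%R%:E *
     (schatten_norm p
        (fun_calc f (abs_op S) \o fun_calc g (abs_op (adjoint T))) +
      schatten_norm p
        (fun_calc f (abs_op T) \o fun_calc g (abs_op (adjoint S)))) +
   (2 `^ (inv_exp p - 2))%R%:E *
     lp_sum p
       (schatten_norm p
          ((fun_calc f (abs_op S) \o fun_calc f (abs_op S)) +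
           (fun_calc g (abs_op S) \o fun_calc g (abs_op S)))%R)
       (schatten_norm p
          ((fun_calc f (abs_op T) \o fun_calc f (abs_op T)) +
           (fun_calc g (abs_op T) \o fun_calc g (abs_op T)))%R))%E.
Proof.
(* The bound does not depend on the angle, so one [theta] is fixed and [e = expi theta]. *)
apply: ge_ereal_sup => _ [theta _ <-].
have bT : bop T.
  by case: p p_ge1 TCp {SCp} => [r _ [[/bopP]]| _ /bopP |].
have bS : bop S.
  by case: p p_ge1 SCp {TCp} => [r _ [[/bopP]]| _ /bopP |].
have [F [K [K' [V1 [W1 [V2 [W2 [[bF bK bK' sF] KK' NE
    [[_ _ VW1 VW2] [bW1 bW2 V1c V2c [W1c W2c]]] key]]]]]]]] :=
  block_factorization bT bS f_cont g_cont fg (normc_expi theta).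
have bfS := bop_fc f_cont (posop_abs bS); have bfT := bop_fc f_cont (posop_abs bT).
have bgS := bop_fc g_cont (posop_abs bS); have bgT := bop_fc g_cont (posop_abs bT).
have bgT' := bop_fc g_cont (posop_abs (bop_adj bT)).
have bgS' := bop_fc g_cont (posop_abs (bop_adj bS)).
apply: (schatten_norm_bound bF bK bK' sF KK' NE VW1 VW2 bW1 bW2 V1c V2c W1c W2c key).
- exact: (selfadj_re_op_mx (expi theta) bT bS).
- exact: (bop_comp bfS bgT').
- exact: (bop_comp bfT bgS').
- exact: (bop_add (bop_comp bfS bfS) (bop_comp bgS bgS)).
- exact: (bop_add (bop_comp bfT bfT) (bop_comp bgT bgT)).
- exact: p_ge1.
- move=> pfin; apply: (compact_re_op_mx (expi theta) bT bS).
    by case: p pfin TCp {SCp p_ge1} => [r _ []|//|//].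
  by case: p pfin SCp {TCp p_ge1} => [r _ []|//|//].
Qed.
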